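(* Let $[a,b]\subset\mathbb{R}$ be a compact interval, $m\in\mathbb{N}$, and let $\mathcal{H}\in BV([a,b],\mathbb{K}^{m\times m})$ be an energy density. Let $X:=L^2([a,b],\mathbb{K}^m)$ be endowed with the $\mathcal{H}$-energy norm $\|\cdot\|_X$, and let $A:D(A)\subset X\to X$ be a first-order port-Hamiltonian operator with energy density $\mathcal{H}$. Suppose that the domain of $A$ is of the form $$D(A)=\big\{x\in X:\ \mathcal{H}x\in W^{1,2}((a,b),\mathbb{K}^m)\ \text{and}\ W(\mathcal{H}x)|_{\partial}=0\big\}$$ for some matrix $W\in\mathbb{K}^{m\times 2m}$, and that there exists $\kappa\in(0,\infty)$ such that for $c=a$ or $c=b$ one has $$\operatorname{Re}\langle x,Ax\rangle_X\le-\kappa\,|(\mathcal{H}x)(c)|^2\qquad\text{for all }x\in D(A).$$ Then $A$ generates an exponentially stable contraction semigroup on $X$.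
   Context: $\mathbb{K}$ is $\mathbb{R}$ or $\mathbb{C}$; $|\cdot|$ is the standard norm on $\mathbb{K}^m$; $^*$ denotes conjugate transpose. Bounded variation: $BV([a,b],\mathbb{K}^{m\times m})$ is the set of functions $f:[a,b]\to\mathbb{K}^{m\times m}$ with $\operatorname{Var}(f):=\sup\{\sum_{l=1}^{L}\|f(t_l)-f(t_{l-1})\|:\ (t_l)_{l\in\{0,\dots,L\}}\text{ a partition of }[a,b]\}<\infty$, where $\|\cdot\|$ is the operator norm on $\mathbb{K}^{m\times m}$. Energy density: a measurable function $\mathcal{H}:[a,b]\to\mathbb{K}^{m\times m}$ such that $\mathcal{H}(\zeta)$ is self-adjoint for almost all $\zeta$ and there are constants $\underline{m},\overline{m}\in(0,\infty)$ with $\underline{m}\le\mathcal{H}(\zeta)\le\overline{m}$ (in the sense of quadratic forms) for almost all $\zeta\in[a,b]$. The symbol $\mathcal{H}$ also denotes the multiplication operator $x\mapsto\mathcal{H}x$, $(\mathcal{H}x)(\zeta)=\mathcal{H}(\zeta)x(\zeta)$. $\mathcal{H}$-energy scalar product and norm: $\langle x,y\rangle_X:=\frac12\int_a^b x(\zeta)^*\mathcal{H}(\zeta)y(\zeta)\,d\zeta$ and $\|x\|_X:=\langle x,x\rangle_X^{1/2}$; this norm is equivalent to the standard $L^2$ norm. First-order port-Hamiltonian operator with energy density $\mathcal{H}$: a linear operator $A:D(A)\subset X\to X$ whose domain is a dense subspace of $X$ with $D(A)\subset\{x\in X:\mathcal{H}x\in W^{1,2}((a,b),\mathbb{K}^m)\}$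 and which is of the form $Ax=P_1\partial_\zeta(\mathcal{H}x)+P_0\mathcal{H}x$ for $x\in D(A)$, for some invertible self-adjoint matrix $P_1=P_1^*\in\mathbb{K}^{m\times m}$ and some skew-adjoint matrix $P_0=-P_0^*\in\mathbb{K}^{m\times m}$. Boundary values: for $x$ with $\mathcal{H}x\in W^{1,2}((a,b),\mathbb{K}^m)$, the values $(\mathcal{H}x)(a),(\mathcal{H}x)(b)$ are those of the continuous representative of $\mathcal{H}x$ on $[a,b]$, and $(\mathcal{H}x)|_{\partial}:=\begin{pmatrix}(\mathcal{H}x)(b)\\(\mathcal{H}x)(a)\end{pmatrix}\in\mathbb{K}^{2m}$. A contraction semigroup on $X$ is a strongly continuous semigroup $(e^{At})_{t\ge0}$ with $\|e^{At}\|_{X,X}\le1$ for all $t\ge0$ (operator norm induced by $\|\cdot\|_X$); it is exponentially stable if there are $M\in[1,\infty)$ and $\omega<0$ with $\|e^{At}\|_{X,X}\le Me^{\omega t}$ for all $t\ge0$. *)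

(* Defs.v *)
From HB Require Import structures.
From mathcomp Require Import all_boot all_order all_algebra.
From mathcomp Require Import generic_quotient ring.
From mathcomp.real_closed Require Import complex.
From mathcomp Require Import all_classical all_reals all_analysis.
From mathcomp Require Import measurable_realfun measurable_fun_approximation.

Set Implicit Arguments.
Unset Strict Implicit.
Unset Printing Implicit Defensive.

Import Order.TTheory GRing.Theory Num.Theory.
Import numFieldNormedType.Exports.

Local Open Scope classical_set_scope.
Local Open Scope ring_scope.

Variant scalar_kind := RealScalars | ComplexScalars.

Definition scalar_field (k : scalar_kind) (R : realType) : numFieldType :=
  match k with
  | RealScalars => R
  | ComplexScalars => R[i]
  end.

Section Scalar.
Context {k : scalar_kind} {R : realType}.
Local Notation K := (scalar_field k R).

Definition re : K -> R :=
  match k return scalar_field k R -> R with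
  | RealScalars => fun z => z
  | ComplexScalars => fun z => complex.Re z
  end.

Definition im : K -> R :=
  match k return scalar_field k R -> R with
  | RealScalars => fun=> 0
  | ComplexScalars => fun z => complex.Im z
  end.

Definition cconj : K -> K :=
  match k return scalar_field k R -> scalar_field k R with
  | RealScalars => fun z => z
  | ComplexScalars => fun z => conjc z
  end.

(* [mkscalar x y] is x + iy if K = C, and x if K = R. *)
Definition mkscalar : R -> R -> K :=
  match k return R -> R -> scalar_field k R with
  | RealScalars => fun x _ => x
  | ComplexScalars => fun x y => Complex x y
  end.

Definition of_real (x : R) : K := mkscalar x 0.

Lemma reD (z w : K) : re (z + w) = re z + re w.
Proof. by rewrite /re; case: k z w => // -[a b] [c d]. Qed.

Lemma imD (z w : K) : im (z + w) = im z + im w.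
Proof. by rewrite /im; case: k z w => [z w|[a b] [c d]] //; rewrite addr0. Qed.

Lemma reM (z w : K) : re (z * w) = re z * re w - im z * im w.
Proof.
by rewrite /re /im; case: k z w => [z w|[a b] [c d]] //; rewrite mul0r subr0.
Qed.

Lemma imM (z w : K) : im (z * w) = re z * im w + im z * re w.
Proof.
by rewrite /re /im; case: k z w => [z w|[a b] [c d]] //;
  rewrite mulr0 mul0r addr0.
Qed.

Lemma re0 : re 0 = 0. Proof. by rewrite /re; case: k. Qed.

Lemma im0 : im 0 = 0. Proof. by rewrite /im; case: k. Qed.

Definition adjmx m n (M : 'M[K]_(m, n)) : 'M[K]_(n, m) := map_mx cconj M^T.

Definition sqnorm m (v : 'cV[K]_m) : R :=
  \sum_i (re (v i 0) ^+ 2 + im (v i 0) ^+ 2).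

Definition vnorm m (v : 'cV[K]_m) : R := Num.sqrt (sqnorm v).

Definition measurable_mx (D : set R) m n (F : R -> 'M[K]_(m, n)) :=
  forall i j, measurable_fun D (fun t => re (F t i j)) /\
              measurable_fun D (fun t => im (F t i j)).

Definition mxintegral (D : set R) m n (F : R -> 'M[K]_(m, n)) : 'M[K]_(m, n) :=
  \matrix_(i, j)
    mkscalar (\int[lebesgue_measure]_(t in D) re (F t i j))
             (\int[lebesgue_measure]_(t in D) im (F t i j)).

Definition square_integrable (a b : R) m (u : R -> 'cV[K]_m) :=
  measurable_mx `[a, b] u /\
  (\int[lebesgue_measure]_(t in `[a, b]) (vnorm (u t) ^+ 2)%:E < +oo)%E.

Lemma sqnorm_ge0 m (v : 'cV[K]_m) : 0 <= sqnorm v.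
Proof. by apply: sumr_ge0 => i _; rewrite addr_ge0// sqr_ge0. Qed.

Lemma vnorm_sqr m (v : 'cV[K]_m) : vnorm v ^+ 2 = sqnorm v.
Proof. by rewrite sqr_sqrtr// sqnorm_ge0. Qed.

Lemma sqnorm0 m : sqnorm (0 : 'cV[K]_m) = 0.
Proof.
by rewrite /sqnorm big1// => i _; rewrite !mxE re0 im0 expr0n addr0.
Qed.

Lemma sqnorm_lin m (c : K) (u v : 'cV[K]_m) :
  sqnorm (c *: u + v) <=
    2 * (re c ^+ 2 + im c ^+ 2) * sqnorm u + 2 * sqnorm v.
Proof.
rewrite /sqnorm !mulr_sumr -big_split/=; apply: ler_sum => i _.
rewrite !mxE !reD !imD !reM !imM.
set p := re c; set q := im c; set x := re _; set y := im (u i 0).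
set z := re _; set w := im _.
rewrite -subr_ge0 [leRHS](_ : _ =
  (p * x - q * y - z) ^+ 2 + (p * y + q * x - w) ^+ 2); last by ring.
by rewrite addr_ge0// sqr_ge0.
Qed.

Lemma measurable_sqnorm D m (u : R -> 'cV[K]_m) :
  measurable_mx D u -> measurable_fun D (fun t => sqnorm (u t)).
Proof.
move=> mu; apply: measurable_sum => i.
by apply: measurable_funD; apply: measurable_funX; have [] := mu i 0.
Qed.

End Scalar.

Arguments vnorm {k R m} v.

Section L2.
Context (k : scalar_kind) (R : realType) (a b : R) (m : nat).
Local Notation K := (scalar_field k R).

Definition L2pred : {pred R -> 'cV[K]_m} :=
  mem [set u | square_integrable a b u].

Lemma L2_submod_closed : submod_closed L2pred.
Proof.
have m0 : measurable_mx `[a, b] (0 : R -> 'cV[K]_m).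
  move=> i j.
  have h t : (0 : R -> 'cV[K]_m) t i j = 0 by rewrite (_ : (0 : R -> 'cV[K]_m) t = 0) ?mxE.
  split; [apply: (@eq_measurable_fun _ _ _ _ _ (fun=> 0 : R)) |
          apply: (@eq_measurable_fun _ _ _ _ _ (fun=> 0 : R))];
    by [exact: measurable_cst|move=> t _; rewrite h ?re0 ?im0].
split.
  rewrite inE; split => //.
  rewrite integral0_eq// => t _.
  by rewrite vnorm_sqr [X in sqnorm X](_ : _ = 0)// sqnorm0.
move=> c u v; rewrite !inE => -[mu fu] [mv fv].
have mw : measurable_mx `[a, b] (c *: u + v).
  move=> i j; have [ru iu] := mu i j; have [rv iv] := mv i j.
  have e t : (c *: u + v) t i j = c * u t i j + v t i j.
    by rewrite (_ : (c *: u + v) t = c *: u t + v t)// !mxE.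
  split.
    apply: (@eq_measurable_fun _ _ _ _ _ (fun t => (re c * re (u t i j)
      - im c * im (u t i j)) + re (v t i j))).
      by move=> t _; rewrite e reD reM.
    by apply: measurable_funD => //; apply: measurable_funB;
      apply: measurable_funM.
  apply: (@eq_measurable_fun _ _ _ _ _ (fun t => (re c * im (u t i j)
    + im c * re (u t i j)) + im (v t i j))).
    by move=> t _; rewrite e imD imM.
  by apply: measurable_funD => //; apply: measurable_funD;
    apply: measurable_funM.
split => //; set C := 2 * (re c ^+ 2 + im c ^+ 2).
have C0 : 0 <= C by rewrite mulr_ge0// addr_ge0// sqr_ge0.
have sqE w : (\int[lebesgue_measure]_(t in `[a, b])
    (vnorm (w t : 'cV[K]_m) ^+ 2)%:E =
    \int[lebesgue_measure]_(t in `[a, b]) (sqnorm (w t))%:E)%E.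
  by apply: eq_integral => t _; rewrite vnorm_sqr.
move: fu fv; rewrite !sqE => fu fv.
have := measurable_sqnorm mu; have := measurable_sqnorm mv.
move=> /measurable_EFinP mv2 /measurable_EFinP mu2.
have nn (w : 'cV[K]_m) : (0 <= (sqnorm w)%:E)%E by rewrite lee_fin sqnorm_ge0.
have /measurable_EFinP mw2 := measurable_sqnorm mw.
have nnM (e : R) (w : 'cV[K]_m) : 0 <= e -> (0 <= e%:E * (sqnorm w)%:E)%E.
  by move=> e0; rewrite mule_ge0.
apply: (@le_lt_trans _ _ (\int[lebesgue_measure]_(t in `[a, b])
  (C%:E * (sqnorm (u t))%:E + 2%:E * (sqnorm (v t))%:E))%E).
  apply: ge0_le_integral => //=.
  - by apply: emeasurable_funD; apply: measurable_funeM.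
  - by move=> t _; rewrite -!EFinM -EFinD lee_fin; exact: sqnorm_lin.
rewrite ge0_integralD//=.
- by rewrite !ge0_integralZl// lte_add_pinfty// lte_mul_pinfty.
- by move=> t _; exact: nnM.
- exact: measurable_funeM.
- by move=> t _; exact: nnM.
- exact: measurable_funeM.
Qed.

HB.instance Definition _ :=
  GRing.isSubmodClosed.Build K _ L2pred L2_submod_closed.

(* [L2fun] consists of functions, [L2] below of classes modulo a.e. equality on
   [a, b]; in both, the values outside of [a, b] are irrelevant. *)
Definition L2fun : Type := {u : R -> 'cV[K]_m | u \in L2pred}.
HB.instance Definition _ := SubChoice.on L2fun.
HB.instance Definition _ := [SubChoice_isSubLmodule of L2fun by <:].

Definition ae_equal (u v : R -> 'cV[K]_m) :=
  u = v %[ae lebesgue_measure in `[a, b]%classic].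

Definition L2_equiv (u v : L2fun) := `[< ae_equal (val u) (val v) >].

Lemma L2_equiv_refl : reflexive L2_equiv.
Proof. by move=> u; apply/asboolP; apply: ae_eq_refl. Qed.

Lemma L2_equiv_sym : symmetric L2_equiv.
Proof.
by move=> u v; apply/idP/idP => /asboolP h; apply/asboolP; apply: ae_eq_sym.
Qed.

Lemma L2_equiv_trans : transitive L2_equiv.
Proof.
by move=> v u w /asboolP uv /asboolP vw; apply/asboolP; apply: ae_eq_trans vw.
Qed.

Canonical L2_equivRel :=
  EquivRel L2_equiv L2_equiv_refl L2_equiv_sym L2_equiv_trans.

Local Open Scope quotient_scope.

Definition L2 : Type := {eq_quot L2_equiv}.
HB.instance Definition _ := Choice.on L2.
HB.instance Definition _ := EqQuotient.on L2.

Definition L2_to_fun (x : L2) : R -> 'cV[K]_m := val (repr x).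

Definition L2_zero : L2 := \pi_L2 0.
Definition L2_add (x y : L2) : L2 := \pi_L2 (repr x + repr y).
Definition L2_opp (x : L2) : L2 := \pi_L2 (- repr x).
Definition L2_scale (c : K) (x : L2) : L2 := \pi_L2 (c *: repr x).

Lemma L2_piP (u v : L2fun) :
  ae_equal (val u) (val v) <-> \pi_L2 u = \pi_L2 v.
Proof.
split=> [h|/eqP]; first by apply/eqP; rewrite eqmodE; apply/asboolP.
by rewrite eqmodE => /asboolP.
Qed.

Lemma repr_pi (u : L2fun) : ae_equal (val (repr (\pi_L2 u))) (val u).
Proof. by apply/L2_piP; rewrite reprK. Qed.

Let aeF : Filter (almost_everywhere (@lebesgue_measure R)).
Proof. exact: ae_filter_ringOfSetsType. Qed.

Lemma L2_pi_add (u v : L2fun) : \pi_L2 (u + v) = L2_add (\pi_L2 u) (\pi_L2 v).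
Proof.
apply/L2_piP; have h2 := repr_pi u; have h3 := repr_pi v.
apply: (@filterS2 _ _ aeF) h2 h3 => t h2 h3 tab.
rewrite -[LHS]/(val u t + val v t).
by rewrite -[RHS]/(val (repr (\pi_L2 u)) t + val (repr (\pi_L2 v)) t) h2// h3.
Qed.

Lemma L2_pi_scale c (u : L2fun) : \pi_L2 (c *: u) = L2_scale c (\pi_L2 u).
Proof.
apply/L2_piP; have h2 := repr_pi u; apply: (@filterS _ _ aeF) h2 => t h2 tab.
by rewrite -[LHS]/(c *: val u t) -[RHS]/(c *: val (repr (\pi_L2 u)) t) h2.
Qed.

Lemma L2_pi_opp (u : L2fun) : \pi_L2 (- u) = L2_opp (\pi_L2 u).
Proof.
apply/L2_piP; have h2 := repr_pi u; apply: (@filterS _ _ aeF) h2 => t h2 tab.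
by rewrite -[LHS]/(- val u t) -[RHS]/(- val (repr (\pi_L2 u)) t) h2.
Qed.

Lemma L2_ind (P : L2 -> Prop) : (forall u, P (\pi_L2 u)) -> forall x, P x.
Proof. by move=> h x; rewrite -[x]reprK. Qed.

Lemma L2_addA : associative L2_add.
Proof.
elim/L2_ind => x; elim/L2_ind => y; elim/L2_ind => z.
by rewrite -!L2_pi_add addrA.
Qed.

Lemma L2_addC : commutative L2_add.
Proof.
by elim/L2_ind => x; elim/L2_ind => y; rewrite -!L2_pi_add addrC.
Qed.

Lemma L2_add0 : left_id L2_zero L2_add.
Proof. by elim/L2_ind => x; rewrite -L2_pi_add add0r. Qed.

Lemma L2_addN : left_inverse L2_zero L2_opp L2_add.
Proof. by elim/L2_ind => x; rewrite -L2_pi_opp -L2_pi_add addNr. Qed.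

HB.instance Definition _ :=
  GRing.isZmodule.Build L2 L2_addA L2_addC L2_add0 L2_addN.

Lemma L2_scaleA c d (x : L2) :
  L2_scale c (L2_scale d x) = L2_scale (c * d) x.
Proof. by elim/L2_ind: x => x; rewrite -!L2_pi_scale scalerA. Qed.

Lemma L2_scale1 : left_id 1 L2_scale.
Proof. by elim/L2_ind => x; rewrite -L2_pi_scale scale1r. Qed.

Lemma L2_scaleDr : right_distributive L2_scale +%R.
Proof.
move=> c; elim/L2_ind => x; elim/L2_ind => y.
rewrite -[_ + _]L2_pi_add -!L2_pi_scale.
by rewrite -[RHS]L2_pi_add scalerDr.
Qed.

Lemma L2_scaleDl (x : L2) : {morph L2_scale^~ x : c d / c + d}.
Proof.
move=> c d; elim/L2_ind: x => x.
by rewrite -!L2_pi_scale -[RHS]L2_pi_add scalerDl.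
Qed.

HB.instance Definition _ := GRing.Zmodule_isLmodule.Build K L2
  L2_scaleA L2_scale1 L2_scaleDr L2_scaleDl.

End L2.

(* A class in L^2 is evaluated through a chosen representative. *)
Coercion L2_to_fun : L2 >-> Funclass.

Definition opnorm (R : realType) (V W : Type) (NV : V -> R) (NW : W -> R)
    (S : V -> W) : \bar R :=
  ereal_sup [set (NW (S x))%:E | x in [set x | NV x <= 1]].

Definition test_function (R : realType) (a b : R) (phi : R -> R) :=
  [/\ forall n t, derivable (derive1n n phi) t 1,
      compact (closure [set t | phi t != 0]) &
      closure [set t | phi t != 0] `<=` `]a, b[ ].

Section Sobolev.
Context {k : scalar_kind} {R : realType} (a b : R) {m : nat}.
Local Notation K := (scalar_field k R).
Implicit Types u g : R -> 'cV[K]_m.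

Definition is_weak_derivative u g := forall phi, test_function a b phi ->
  mxintegral `]a, b[ (fun t => of_real (derive1 phi t) *: u t) =
  - mxintegral `]a, b[ (fun t => of_real (phi t) *: g t).

Definition W12 : set (R -> 'cV[K]_m) :=
  [set u | square_integrable a b u /\
    exists g, square_integrable a b g /\ is_weak_derivative u g].

(* For u in W^{1,2}, the next two functions are unique almost everywhere on
   [a, b], respectively everywhere on [a, b]; outside of W^{1,2}, or of [a, b],
   their values are meaningless. *)
Definition weak_derivative u : R -> 'cV[K]_m :=
  xget 0 [set g | square_integrable a b g /\ is_weak_derivative u g].

Definition continuous_representative u : R -> 'cV[K]_m :=
  xget 0 [set f | {within `[a, b], continuous f} /\ ae_equal a b f u].

Definition boundary_values u : 'cV[K]_(m + m) :=
  col_mx (continuous_representative u b) (continuous_representative u a).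

End Sobolev.

Section Energy.
Context {k : scalar_kind} {R : realType} (a b : R) {m : nat}.
Local Notation K := (scalar_field k R).
Local Notation mu := (@lebesgue_measure R).
Local Notation X := (L2 k a b m).
Variable H : R -> 'M[K]_m.

Definition energy_density :=
  [/\ measurable_mx `[a, b] H,
      \forall t \ae mu, `[a, b]%classic t -> adjmx (H t) = H t &
      exists lo up : R, [/\ 0 < lo, 0 < up &
        \forall t \ae mu, `[a, b]%classic t -> forall v : 'cV[K]_m,
          lo * vnorm v ^+ 2 <= re ((adjmx v *m H t *m v) 0 0)
            <= up * vnorm v ^+ 2]].

Definition total_variation_mx : \bar R :=
  ereal_sup [set (\sum_(0 <= l < size s)
      opnorm vnorm vnorm (mulmx (H (nth b (a :: s) l.+1) -
                                 H (nth b (a :: s) l)) : 'cV[K]_m -> 'cV[K]_m))%E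
    | s in itv_partition a b].

Definition BV_mx := (total_variation_mx < +oo)%E.

(* Multiplication by H, on the chosen representative of x. *)
Definition mulH (x : X) : R -> 'cV[K]_m := fun t => H t *m x t.

Definition energy_product (x y : X) : K :=
  2^-1 * mxintegral `[a, b] (fun t => adjmx (x t) *m H t *m y t) 0 0.

Definition energy_norm (x : X) : R := Num.sqrt (re (energy_product x x)).

End Energy.

Section Operators.
Context {k : scalar_kind} {R : realType} {V : lmodType (scalar_field k R)}.
Variable N : V -> R.

(* An operator A : D -> V on a subspace D of V is given by D and a function on V
   whose values outside of D are irrelevant. *)
Definition linear_operator (D : set V) (A : V -> V) :=
  [/\ D 0,
      forall c x y, D x -> D y -> D (c *: x + y) &
      forall c x y, D x -> D y -> A (c *: x + y) = c *: A x + A y].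

Definition norm_dense (D : set V) :=
  forall x (e : R), 0 < e -> exists2 y, D y & N (x - y) < e.

Definition strongly_continuous_semigroup (T : R -> V -> V) :=
  [/\ forall t, 0 <= t -> linear (T t) /\ (opnorm N N (T t) < +oo)%E,
      forall x, T 0 x = x,
      forall s t x, 0 <= s -> 0 <= t -> T (s + t) x = T s (T t x) &
      forall x, N (T t x - x) @[t --> 0^'+] --> 0].

Definition contraction_semigroup (T : R -> V -> V) :=
  strongly_continuous_semigroup T /\
  forall t, 0 <= t -> (opnorm N N (T t) <= 1)%E.

Definition exponentially_stable (T : R -> V -> V) :=
  exists M omega : R, [/\ 1 <= M, omega < 0 &
    forall t, 0 <= t -> (opnorm N N (T t) <= (M * expR (omega * t))%:E)%E].

Definition is_generator (D : set V) (A : V -> V) (T : R -> V -> V) :=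
  forall x y, (D x /\ A x = y) <->
    N (of_real t^-1 *: (T t x - x) - y) @[t --> 0^'+] --> 0.

End Operators.

Definition port_hamiltonian (k : scalar_kind) (R : realType) (a b : R) (m : nat)
    (H : R -> 'M[scalar_field k R]_m) (D : set (L2 k a b m))
    (A : L2 k a b m -> L2 k a b m) :=
  [/\ linear_operator D A,
      norm_dense (energy_norm H) D,
      D `<=` [set x | W12 a b (mulH H x)] &
      exists P1 P0 : 'M[scalar_field k R]_m,
        [/\ P1 \in unitmx, adjmx P1 = P1, adjmx P0 = - P0 &
          forall x, D x -> ae_equal a b (A x)
            (fun t => P1 *m weak_derivative a b (mulH H x) t +
                      P0 *m mulH H x t)]].

(* Main.v *)
(** For h > 0 the resolvents J_h = (I - hA)^-1 are contractions defined on all of X: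
    dissipativity and the boundary term control ||x|| by ||theta x / h + (1 - theta)
    P0 H x - A x|| uniformly in 0 <= theta <= 1, so the method of continuity reduces
    surjectivity to the operator x |-> - P1 (Hx)', which is inverted explicitly
    because W (1 1)^T is invertible: constants in D(A) satisfying the boundary
    condition are killed by the dissipation. On D(A^2) the iterates of J_h along
    dyadic meshes h = 2^-j converge geometrically, and their limit is the semigroup.

    Exponential stability comes from boundary observability of the discrete orbits
    x_n = J_h^n x_0. With u_n = H x_n, freeze H at a point r and follow F_r(t) = h
    sum_n <P1 u_n(t), H(r) P1 u_n(t)> as a function of the space variable t. Near t
    = r its derivative telescopes in n, since h (P1 u_n' + P0 u_n) = x_n - x_(n-1)
    and H x_n = u_n, up to a multiple of F_r and the sum of the |u_n - u_(n-1)|^2,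
    which implicit Euler dissipates; changing r costs at most the variation of H. A
    Gronwall argument over fine partitions thus bounds h sum_n |u_n(t)|^2, for every
    t, by its value at c, which the dissipation controls, plus C ||x_0||^2.
    Integrating in t, n h ||x_n||^2 <= C ||x_0||^2, so the norm of the semigroup
    drops below 1/2 at some time. *)

Require Import Defs.
From mathcomp Require Import all_boot all_order all_algebra.
From mathcomp Require Import ring lra.
From mathcomp.real_closed Require Import complex.
From mathcomp Require Import all_classical all_reals all_analysis.
From mathcomp Require Import measurable_realfun.

Set Implicit Arguments.
Unset Strict Implicit.
Unset Printing Implicit Defensive.

Import Order.TTheory GRing.Theory Num.Theory.
Import numFieldNormedType.Exports.

Local Open Scope classical_set_scope.
Local Open Scope ring_scope.

Local Notation mu := (@lebesgue_measure _).

(** The obstacle is that [H] is only of bounded variation: it may jump, it has no usable derivative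
    in space, and its self-adjointness and its lower bound hold only almost everywhere. The density
    <P1 u, H P1 u> is therefore not absolutely continuous in t, whereas the one with H(r) is, for
    any fixed r; hence the freezing, at points r where H(r) is self-adjoint and positive. The price
    is an error proportional to |H(r) - H(t)|, for which only a bound growing with the number of
    Euler steps is available. On a cell of a partition it is at most D times the length of the cell
    times the variation of H there, so it vanishes with the mesh, and D, however large, leaves no
    trace in the final constant. Discrete orbits are used because every x_n lies in D(A) when x_0
    does: all sums in time are finite, and no regularity in time has to be discussed. The
    differential equation serves only as an identity almost everywhere between representatives, and
    vectors are handled in real coordinates, which treats R and C alike. *)

Section ScalarFacts.
Context {k : scalar_kind} {R : realType}.
Local Notation K := (scalar_field k R).
Local Notation of_real := (@of_real k R).

Lemma mkscalarK (z : K) : mkscalar (re z) (im z) = z.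
Proof. by rewrite /mkscalar /re /im; case: k z => // -[x y]. Qed.

Lemma re_im_eq (z w : K) : re z = re w -> im z = im w -> z = w.
Proof. by move=> h1 h2; rewrite -(mkscalarK z) -(mkscalarK w) h1 h2. Qed.

Lemma re_of_real x : re (of_real x) = x.
Proof. by rewrite /of_real /mkscalar /re; case: k. Qed.

Lemma im_of_real x : im (of_real x) = 0.
Proof. by rewrite /of_real /mkscalar /im; case: k. Qed.

Lemma reN (z : K) : re (- z) = - re z.
Proof. by rewrite /re; case: k z => // -[]. Qed.

Lemma imN (z : K) : im (- z) = - im z.
Proof. by rewrite /im; case: k z => [z|[]]//; rewrite oppr0. Qed.

Lemma reB (z w : K) : re (z - w) = re z - re w.
Proof. by rewrite reD reN. Qed.

Lemma imB (z w : K) : im (z - w) = im z - im w.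
Proof. by rewrite imD imN. Qed.

Lemma re1 : re (1 : K) = 1. Proof. by rewrite /re; case: k. Qed.

Lemma im1 : im (1 : K) = 0. Proof. by rewrite /im; case: k. Qed.

Lemma re_cconj (z : K) : re (cconj z) = re z.
Proof. by rewrite /re /cconj; case: k z => // -[]. Qed.

Lemma im_cconj (z : K) : im (cconj z) = - im z.
Proof. by rewrite /im /cconj; case: k z => [z|[]]//; rewrite oppr0. Qed.

Lemma re_sum I (r : seq I) (P : pred I) (F : I -> K) :
  re (\sum_(i <- r | P i) F i) = \sum_(i <- r | P i) re (F i).
Proof. by apply: (big_morph re) => [x y|]; rewrite ?reD ?re0. Qed.

Lemma im_sum I (r : seq I) (P : pred I) (F : I -> K) :
  im (\sum_(i <- r | P i) F i) = \sum_(i <- r | P i) im (F i).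
Proof. by apply: (big_morph im) => [x y|]; rewrite ?imD ?im0. Qed.

Lemma of_realD x y : of_real (x + y) = of_real x + of_real y.
Proof. by apply: re_im_eq; rewrite ?reD ?imD ?re_of_real ?im_of_real ?addr0. Qed.

Lemma of_realM x y : of_real (x * y) = of_real x * of_real y.
Proof.
by apply: re_im_eq; rewrite ?reM ?imM ?re_of_real ?im_of_real ?mulr0 ?mul0r
  ?subr0 ?addr0.
Qed.

Lemma of_realN x : of_real (- x) = - of_real x.
Proof. by apply: re_im_eq; rewrite ?reN ?imN ?re_of_real ?im_of_real ?oppr0. Qed.

Lemma of_realB x y : of_real (x - y) = of_real x - of_real y.
Proof. by rewrite of_realD of_realN. Qed.

Lemma of_real0 : of_real 0 = 0.
Proof. by apply: re_im_eq; rewrite ?re_of_real ?im_of_real ?re0 ?im0. Qed.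

Lemma of_real1 : of_real 1 = 1.
Proof. by apply: re_im_eq; rewrite ?re_of_real ?im_of_real ?re1 ?im1. Qed.

Definition modulus (c : K) : R := Num.sqrt (re c ^+ 2 + im c ^+ 2).

Lemma modulus_of_real x : modulus (of_real x) = `|x|.
Proof.
by rewrite /modulus re_of_real im_of_real expr0n addr0 sqrtr_sqr.
Qed.

End ScalarFacts.

Lemma subrACA (V : zmodType) (x y z t : V) : x - y - (z - t) = x - z - (y - t).
Proof. by rewrite !opprB addrACA [RHS]addrACA; congr (_ + _); exact: addrC. Qed.

(** * Contraction semigroups from resolvents *)

Section Norm.
Context {k : scalar_kind} {R : realType} {V : lmodType (scalar_field k R)}.
Variable N : V -> R.
Local Notation K := (scalar_field k R).
Local Notation of_real := (@of_real k R).
Implicit Types (h s t r : R) (x y z : V).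

Definition is_norm :=
  [/\ forall x y, N (x + y) <= N x + N y,
      forall c x, N (c *: x) = modulus c * N x &
      forall x, N x = 0 -> x = 0].

Definition ncvg (u : nat -> V) (x : V) := N (u n - x) @[n --> \oo] --> 0.

(** Only sequences with geometrically decaying increments are asked to converge: the limits built
    from completeness below have this rate, and it lets [riesz_fischer] conclude without passing to
    subsequences. *)
Definition norm_complete := forall (u : nat -> V) (C : R),
  (forall n, N (u n.+1 - u n) <= C * 2 ^- n) -> exists x, ncvg u x.

Hypothesis Nnorm : is_norm.

Lemma normD x y : N (x + y) <= N x + N y.
Proof. by case: Nnorm. Qed.

Lemma normZ c x : N (c *: x) = modulus c * N x.
Proof. by case: Nnorm. Qed.

Lemma normZr r x : N (of_real r *: x) = `|r| * N x.
Proof. by rewrite normZ modulus_of_real. Qed.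

Lemma norm_eq0 x : N x = 0 -> x = 0.
Proof. by case: Nnorm => _ _; exact. Qed.

Lemma norm0 : N 0 = 0.
Proof. by rewrite -(scale0r (0 : V)) -of_real0 normZr normr0 mul0r. Qed.

Lemma normN x : N (- x) = N x.
Proof. by rewrite -scaleN1r -of_real1 -of_realN normZr normrN1 mul1r. Qed.

Lemma norm_ge0 x : 0 <= N x.
Proof. by have := normD x (- x); rewrite subrr norm0 normN; lra. Qed.

Lemma normB x y : N (x - y) <= N x + N y.
Proof. by rewrite (le_trans (normD _ _))// normN. Qed.

Lemma distC x y : N (x - y) = N (y - x).
Proof. by rewrite -normN opprB. Qed.

Lemma dist_triangle z x y : N (x - y) <= N (x - z) + N (z - y).
Proof. by rewrite -[x - y](subrKA z) normD. Qed.

Lemma norm_le_dist x y : N x <= N (x - y) + N y.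
Proof. by rewrite -{1}[x](subrK y) normD. Qed.

Lemma ncvgP u x :
  ncvg u x <-> forall e, 0 < e -> \forall n \near \oo, N (u n - x) <= e.
Proof.
split=> [/cvgr0Pnorm_le h e e0|h].
  by have := h e e0; apply: filterS => n; rewrite ger0_norm ?norm_ge0.
by apply/cvgr0Pnorm_le => e /h; apply: filterS => n; rewrite ger0_norm ?norm_ge0.
Qed.

Lemma squeeze0 (f g : nat -> R) : (forall n, 0 <= f n <= g n) ->
  g n @[n --> \oo] --> 0 -> f n @[n --> \oo] --> 0.
Proof.
move=> fg g0; apply: (@squeeze_cvgr _ _ _ _ (fun=> 0) g) => //; last exact: cvg_cst.
exact: nearW.
Qed.

Lemma ncvg_squeeze u x (g : nat -> R) : (forall n, N (u n - x) <= g n) ->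
  g n @[n --> \oo] --> 0 -> ncvg u x.
Proof. by move=> h; apply: squeeze0 => n; rewrite norm_ge0 h. Qed.

Lemma le0_of_cvg (r : R) (g : nat -> R) : (forall n, r <= g n) ->
  g n @[n --> \oo] --> 0 -> r <= 0.
Proof.
move=> h g0; rewrite leNgt; apply/negP => r0.
have r20 : 0 < r / 2 by rewrite divr_gt0.
have /cvgr0Pnorm_le/(_ _ r20)[n _ /(_ n (leqnn n))] := g0.
rewrite /= => gn; have := le_trans (ler_norm _) gn; have := h n; lra.
Qed.

Lemma ncvg_unique u x y : ncvg u x -> ncvg u y -> x = y.
Proof.
move=> ux uy; apply/eqP; rewrite -subr_eq0; apply/eqP/norm_eq0/eqP.
rewrite eq_le norm_ge0 andbT.
apply: (@le0_of_cvg _ (fun n => N (u n - x) + N (u n - y))).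
  by move=> n; rewrite (distC (u n)) dist_triangle.
by rewrite -[0](addr0 0); apply: cvgD.
Qed.

Lemma ncvg_lin c u v x y : ncvg u x -> ncvg v y ->
  ncvg (fun n => c *: u n + v n) (c *: x + y).
Proof.
move=> ux vy.
apply: (@ncvg_squeeze _ _ (fun n => modulus c * N (u n - x) + N (v n - y))).
  move=> n; rewrite opprD addrACA -scalerBr.
  by rewrite (le_trans (normD _ _))// normZ.
rewrite -[0](addr0 0) -{1}(mulr0 (modulus c)); apply: cvgD => //.
by apply: cvgM => //; exact: cvg_cst.
Qed.

Lemma ncvg_le u x C : ncvg u x -> (forall n, N (u n) <= C) -> N x <= C.
Proof.
move=> ux uC; rewrite -subr_le0; apply: (le0_of_cvg _ ux) => n.
have := norm_le_dist x (u n); rewrite distC; have := uC n; lra.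
Qed.

Lemma ncvg_shift m u x : ncvg u x -> ncvg (fun n => u (n + m)%N) x.
Proof. by move=> ux; rewrite /ncvg (cvg_shiftn m (fun n => N (u n - x))). Qed.

Lemma geom2S (C : R) n : C * 2 ^- n.+1 = C * 2 ^- n / 2.
Proof. by rewrite exprSr invfM mulrA mulrAC. Qed.

Lemma cvg_geom2 (C : R) : C * 2 ^- n @[n --> \oo] --> 0.
Proof.
rewrite -[0](mulr0 C); apply: cvgM; first exact: cvg_cst.
rewrite (_ : (fun n => _) = GRing.exp (2^-1 : R)); last first.
  by apply/funext => n; rewrite exprVn.
by apply: cvg_expr; rewrite ger0_norm; lra.
Qed.

Lemma ncvg_const (u : nat -> V) x : (forall n, u n = x) -> ncvg u x.
Proof.
move=> h; apply: (@ncvg_squeeze _ _ (fun=> 0)); last exact: cvg_cst.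
by move=> n; rewrite h subrr norm0.
Qed.

Definition linear_on (D : set V) (S : V -> V) :=
  forall c x y, D x -> D y -> S (c *: x + y) = c *: S x + S y.

Definition is_subspace (D : set V) :=
  D 0 /\ forall c x y, D x -> D y -> D (c *: x + y).

Lemma is_subspaceB D x y : is_subspace D -> D x -> D y -> D (x - y).
Proof. by move=> [_ h] Dx Dy; rewrite addrC -scaleN1r; exact: h. Qed.

Lemma linear_onB D S x y : linear_on D S -> D x -> D y -> S (x - y) = S x - S y.
Proof. by move=> h Dx Dy; rewrite addrC -scaleN1r h// scaleN1r addrC. Qed.

(** With [I] a right inverse of [S], the equation becomes the fixed-point problem z = y - B (I z).
    The relative bound makes B o I a contraction of ratio 1/2, so the Picard iterates have the
    increments that [norm_complete] requires. *)
Lemma surj_perturb (D : set V) (S B : V -> V) :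
  norm_complete -> is_subspace D -> linear_on D S -> linear_on D B ->
  (forall x, D x -> N (B x) <= N (S x) / 2) ->
  (forall y, exists2 x, D x & S x = y) ->
  forall y, exists2 x, D x & S x + B x = y.
Proof.
move=> cpl subD linS linB hB surjS y.
have [I I_D IS] : exists2 I : V -> V, forall z, D (I z) & forall z, S (I z) = z.
  have /choice[I HI] : forall z, exists x, D x /\ S x = z.
    by move=> z; have [x] := surjS z; exists x.
  by exists I => z; have [] := HI z.
pose z := fix z n := if n is n'.+1 then y - B (I (z n')) else 0.
have hBI u v : N (B (I u) - B (I v)) <= N (u - v) / 2.
  rewrite -(linear_onB linB)// (le_trans (hB _ (is_subspaceB subD _ _)))//.
  by rewrite (linear_onB linS)// !IS.
have [w zw] : exists w, ncvg z w.
  apply: (cpl z (N (z 1%N - z 0%N))); elim=> [|n IH].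
    by rewrite expr0 invr1 mulr1.
  have -> : z n.+2 - z n.+1 = B (I (z n)) - B (I (z n.+1)).
    by rewrite /= opprB addrC subrKA.
  rewrite (le_trans (hBI _ _))// geom2S.
  by rewrite ler_wpM2r ?invr_ge0 ?ler0n// distC.
exists (I w) => //; rewrite IS.
suff {1}-> : w = y - B (I w) by rewrite subrK.
have zw1 : ncvg (fun n => z n.+1) w.
  by have := ncvg_shift 1 zw; under [X in ncvg X]eq_fun do rewrite addn1.
apply: (ncvg_unique zw1).
apply: (@ncvg_squeeze _ _ (fun n => N (z n - w) / 2)) => [n|]; last first.
  by rewrite -[0](mul0r 2^-1); apply: cvgM => //; exact: cvg_cst.
rewrite /= opprD addrACA subrr add0r opprK addrC.
by rewrite distC hBI.
Qed.

(** The segment from theta = 0 to theta = 1 is cut into n > 2 c beta steps. Coercivity, uniform in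
    theta, bounds [B] by beta c times S + theta B, so that adding B / n is a perturbation of
    relative size at most 1/2, and surjectivity passes from each step to the next. *)
Lemma continuity_method (D : set V) (S B : V -> V) (c beta : R) :
  norm_complete -> is_subspace D -> linear_on D S -> linear_on D B ->
  (forall x, D x -> N (B x) <= beta * N x) ->
  (forall theta x, 0 <= theta <= 1 -> D x ->
     N x <= c * N (S x + of_real theta *: B x)) ->
  (forall y, exists2 x, D x & S x = y) ->
  forall y, exists2 x, D x & S x + B x = y.
Proof.
move=> cpl subD linS linB bB coer surjS.
pose beta' := Num.max beta 0.
have b0 : 0 <= beta' by rewrite le_max lexx orbT.
have {}bB x : D x -> N (B x) <= beta' * N x.
  by move=> /bB h; rewrite (le_trans h)// ler_wpM2r ?norm_ge0// le_max lexx.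
pose c' := Num.max c 0.
have c0 : 0 <= c' by rewrite le_max lexx orbT.
have {}coer theta x : 0 <= theta <= 1 -> D x ->
    N x <= c' * N (S x + of_real theta *: B x).
  move=> th Dx; rewrite (le_trans (coer _ _ th Dx))//.
  by rewrite ler_wpM2r ?norm_ge0// le_max lexx.
pose n := (Num.truncn (2 * (c' * beta'))).+1.
have nq : 2 * (c' * beta') < n%:R by exact: truncnS_gt.
have n0 : 0 < n%:R :> R by rewrite ltr0n.
pose Sth (i : nat) x := S x + of_real (i%:R / n%:R) *: B x.
have H i : (i <= n)%N -> forall y, exists2 x, D x & Sth i x = y.
  elim: i => [_ y|i IH lin y].
    have [x Dx Sx] := surjS y; exists x => //.
    by rewrite /Sth mul0r of_real0 scale0r addr0.
  have linZB : linear_on D (fun x => of_real n%:R^-1 *: B x).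
    move=> d x x' Dx Dx'; rewrite linB// scalerDr !scalerA.
    by rewrite [_ * d]mulrC.
  have linSi : linear_on D (Sth i).
    move=> d x x' Dx Dx'; rewrite /Sth linS// linB// !scalerDr !scalerA.
    by rewrite [_ * d]mulrC addrACA.
  have [x Dx <-] : exists2 x, D x & Sth i x + of_real n%:R^-1 *: B x = y.
    apply: (surj_perturb cpl subD linSi linZB) => [x Dx|]; last first.
      exact/IH/ltnW.
    rewrite normZr ger0_norm ?invr_ge0 ?ler0n// mulrC ler_pdivrMr//.
    have th : 0 <= (i%:R / n%:R : R) <= 1.
      by rewrite divr_ge0 ?ler0n//= ler_pdivrMr// mul1r ler_nat ltnW.
    have := coer _ _ th Dx; rewrite -/(Sth i x) => hx.
    rewrite (le_trans (bB _ Dx))// (le_trans (ler_wpM2l b0 hx))//.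
    by have := norm_ge0 (Sth i x); nra.
  exists x => //; rewrite /Sth -addrA -scalerDl -of_realD; congr (_ + of_real _ *: _).
  by rewrite -natr1 mulrDl mul1r.
move=> y; have [x Dx <-] := H n (leqnn n) y; exists x => //.
by rewrite /Sth divff ?gt_eqF// of_real1 scale1r.
Qed.

Section Resolvent.
Variables (D : set V) (A : V -> V).
Hypothesis subD : is_subspace D.
Hypothesis linA : linear_on D A.
Hypothesis dissA : forall (h : R) x, 0 < h -> D x -> N x <= N (x - of_real h *: A x).
Hypothesis rangeA : forall (h : R) y, 0 < h -> exists2 x, D x & x - of_real h *: A x = y.

Definition resolvent h y := xget 0 [set x | D x /\ x - of_real h *: A x = y].

Lemma resolventP h y : 0 < h ->
  D (resolvent h y) /\ resolvent h y - of_real h *: A (resolvent h y) = y.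
Proof.
move=> h0; rewrite /resolvent; case: xgetP => [x -> //|/= none].
by have [x Dx hx] := rangeA y h0; case: (none x).
Qed.

Lemma shifted_linear h : linear_on D (fun x => x - of_real h *: A x).
Proof.
move=> c x y Dx Dy; rewrite linA// scalerBr [of_real h *: (_ + _)]scalerDr !scalerA.
by rewrite [_ * c]mulrC opprD addrACA.
Qed.

Lemma resolvent_unique h x y : 0 < h -> D x -> x - of_real h *: A x = y ->
  resolvent h y = x.
Proof.
move=> h0 Dx xy; have [Dz zy] := resolventP y h0.
apply/eqP; rewrite -subr_eq0; apply/eqP/norm_eq0/eqP.
rewrite eq_le norm_ge0 andbT (le_trans (dissA h0 (is_subspaceB subD Dz Dx)))//.
by rewrite (linear_onB (@shifted_linear h))// zy xy subrr norm0.
Qed.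

Lemma resolvent_in h y : 0 < h -> D (resolvent h y).
Proof. by move=> h0; have [] := resolventP y h0. Qed.

Lemma resolvent_lin h c x y : 0 < h ->
  resolvent h (c *: x + y) = c *: resolvent h x + resolvent h y.
Proof.
move=> h0; have [Dx hx] := resolventP x h0; have [Dy hy] := resolventP y h0.
apply: resolvent_unique => //; first by case: subD => _; exact.
by rewrite (@shifted_linear h)// hx hy.
Qed.

Lemma resolventB h x y : 0 < h ->
  resolvent h (x - y) = resolvent h x - resolvent h y.
Proof.
by move=> h0; rewrite addrC -scaleN1r resolvent_lin// scaleN1r addrC.
Qed.

Lemma resolvent_le h y : 0 < h -> N (resolvent h y) <= N y.
Proof.
by move=> h0; have [Dx hx] := resolventP y h0; rewrite (le_trans (dissA h0 Dx))// hx.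
Qed.

Lemma resolvent_sub h y : 0 < h -> resolvent h y - y = of_real h *: A (resolvent h y).
Proof.
move=> h0; have [_ hx] := resolventP y h0.
by rewrite -{2}hx opprB addrC subrK.
Qed.

(** Applying J = [resolvent h] to x - h A x gives J x - x = h J (A x); by [resolvent_sub] the left
    side is also h A (J x). *)
Lemma resolvent_comm h x : 0 < h -> D x -> A (resolvent h x) = resolvent h (A x).
Proof.
move=> h0 Dx; have e := @resolvent_unique h x _ h0 Dx erefl.
move: e; rewrite resolventB// -[of_real h *: A x]addr0 resolvent_lin//.
have -> : resolvent h 0 = 0.
  apply: resolvent_unique => //; first by case: subD.
  have -> : A 0 = 0 by have := linear_onB linA subD.1 subD.1; rewrite !subrr.
  by rewrite scaler0 subr0.
rewrite addr0 => e; have := resolvent_sub x h0.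
rewrite -{2}e opprB addrC subrK => /esym e2.
have hne : of_real h != 0 :> K.
  apply/eqP => /(congr1 re); rewrite re_of_real re0 => h'.
  by rewrite h' ltxx in h0.
by apply: (scalerI hne).
Qed.

Lemma resolvent_step h x : 0 < h -> D x -> N (resolvent h x - x) <= h * N (A x).
Proof.
move=> h0 Dx; rewrite resolvent_sub// normZr gtr0_norm// ler_pM2l//.
by rewrite resolvent_comm// resolvent_le.
Qed.

Definition domain2 : set V := [set x | D x /\ D (A x)].

Lemma resolvent_domain2 h x : 0 < h -> D x -> domain2 (resolvent h x).
Proof.
by move=> h0 Dx; split; rewrite ?resolvent_comm//; exact: resolvent_in.
Qed.

Lemma iter_resolvent_in h n x : 0 < h -> D x -> D (iter n (resolvent h) x).
Proof. by move=> h0 Dx; case: n => //= n; exact: resolvent_in. Qed.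

Lemma iter_resolvent_le h n x : 0 < h -> N (iter n (resolvent h) x) <= N x.
Proof.
by move=> h0; elim: n => //= n IH; rewrite (le_trans (resolvent_le _ h0)).
Qed.

Lemma iter_resolvent_lin h n c x y : 0 < h ->
  iter n (resolvent h) (c *: x + y) =
  c *: iter n (resolvent h) x + iter n (resolvent h) y.
Proof. by move=> h0; elim: n => //= n ->; rewrite resolvent_lin. Qed.

Lemma iter_resolventB h n x y : 0 < h ->
  iter n (resolvent h) (x - y) = iter n (resolvent h) x - iter n (resolvent h) y.
Proof.
by move=> h0; rewrite addrC -scaleN1r iter_resolvent_lin// scaleN1r addrC.
Qed.

Lemma iter_resolvent_comm h n x : 0 < h -> D x ->
  A (iter n (resolvent h) x) = iter n (resolvent h) (A x).
Proof.
move=> h0 Dx; elim: n => //= n IH.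
by rewrite resolvent_comm ?IH//; exact: iter_resolvent_in.
Qed.

Lemma iter_resolvent_step h n x : 0 < h -> D x ->
  N (iter n (resolvent h) x - x) <= n%:R * h * N (A x).
Proof.
move=> h0 Dx; elim: n => [|n IH]; first by rewrite subrr norm0 !mul0r.
rewrite iterSr (le_trans (dist_triangle (iter n (resolvent h) x) _ _))//.
rewrite -iter_resolventB// -natr1 2!mulrDl mul1r [leRHS]addrC lerD//.
by rewrite (le_trans (iter_resolvent_le _ _ h0))// resolvent_step.
Qed.

(* (I - hA)^2 = (I - 2hA) + h^2 A^2 *)
Lemma resolvent_halving h x : 0 < h -> domain2 x ->
  N (resolvent (2 * h) x - resolvent h (resolvent h x)) <= h ^+ 2 * N (A (A x)).
Proof.
move=> h0 [Dx DAx]; have h20 : 0 < 2 * h by rewrite mulr_gt0.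
set p := resolvent _ x.
have [Dp hp] := resolventP x h20; rewrite -/p in Dp hp.
have Ap : A p = resolvent (2 * h) (A x) by rewrite resolvent_comm.
have DAp : D (A p) by rewrite Ap; exact: resolvent_in.
have AAp : A (A p) = resolvent (2 * h) (A (A x)) by rewrite Ap resolvent_comm.
have DB : D (p - of_real h *: A p).
  by rewrite addrC -scaleNr; apply: subD.2.
have e : resolvent h (resolvent h (x + of_real (h ^+ 2) *: A (A p))) = p.
  apply: (@resolvent_unique h) => //.
  apply/esym/resolvent_unique => //.
  have -> : A (p - of_real h *: A p) = A p - of_real h *: A (A p).
    by rewrite addrC -scaleNr linA// scaleNr addrC.
  rewrite scalerBr scalerA -of_realM -expr2 opprB -{1}hp mulr_natl mulr2n.
  by rewrite of_realD scalerDl opprD !addrA addrAC.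
rewrite -{1}e -!resolventB// addrAC subrr add0r.
rewrite (le_trans (resolvent_le _ h0))// (le_trans (resolvent_le _ h0))//.
rewrite normZr ger0_norm ?sqr_ge0// ler_wpM2l ?sqr_ge0// AAp.
exact: resolvent_le.
Qed.

(** Telescoping: trading one step of length 2 h for two of length h costs [h ^+ 2 * N (A (A x))].
    The resolvents are contractions commuting with A, so this same quantity controls each of the n
    trades. *)
Lemma iter_resolvent_halving h n x : 0 < h -> domain2 x ->
  N (iter n (resolvent (2 * h)) x - iter (2 * n) (resolvent h) x) <=
  n%:R * h ^+ 2 * N (A (A x)).
Proof.
move=> h0; have h20 : 0 < 2 * h by rewrite mulr_gt0.
elim: n x => [|n IH] x Dx; first by rewrite subrr norm0 !mul0r.
rewrite mulnS 2!iterSr.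
rewrite iterSr (le_trans (dist_triangle (iter (2 * n) (resolvent h)
  (resolvent (2 * h) x)) _ _))//.
have -> : n.+1%:R * h ^+ 2 * N (A (A x)) =
    n%:R * h ^+ 2 * N (A (A x)) + h ^+ 2 * N (A (A x)) by rewrite -natr1; ring.
rewrite -iter_resolventB// lerD//.
  rewrite (le_trans (IH _ (resolvent_domain2 h20 Dx.1)))//.
  rewrite ler_wpM2l ?mulr_ge0 ?sqr_ge0 ?ler0n ?(ltW h0)//.
  rewrite (resolvent_comm h20 Dx.1) (resolvent_comm h20 Dx.2).
  exact: resolvent_le.
by rewrite (le_trans (iter_resolvent_le _ _ h0))// resolvent_halving.
Qed.

Lemma iter_resolvent_close h m n x : 0 < h -> D x -> (m <= n)%N ->
  N (iter n (resolvent h) x - iter m (resolvent h) x) <=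
  (n%:R - m%:R) * h * N (A x).
Proof.
move=> h0 Dx mn; rewrite -{1}(subnKC mn) iterD -iter_resolventB//.
by rewrite (le_trans (iter_resolvent_le _ _ h0))// -natrB// iter_resolvent_step.
Qed.

Hypothesis cplN : norm_complete.
Hypothesis denseD : norm_dense N D.

Lemma mesh_gt0 j : 0 < 2 ^- j :> R.
Proof. by rewrite invr_gt0 exprn_gt0. Qed.

Definition steps j (t : R) := Num.truncn (t * 2 ^+ j).

Definition approx j t x := iter (steps j t) (resolvent (2 ^- j)) x.

Definition semigroup t x := xget 0 [set z | ncvg (fun j => approx j t x) z].

Lemma steps_itv j t : 0 <= t ->
  (steps j t)%:R * 2 ^- j <= t < (steps j t)%:R * 2 ^- j + 2 ^- j.
Proof.
move=> t0; have p0 : 0 < 2 ^+ j :> R by rewrite exprn_gt0.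
have /truncn_itv : 0 <= t * 2 ^+ j by rewrite mulr_ge0// ltW.
rewrite -/(steps j t) ler_pdivrMr// => /andP[-> h] /=.
have -> : (steps j t)%:R / 2 ^+ j + 2 ^- j = (steps j t).+1%:R / 2 ^+ j :> R.
  by rewrite -[(steps j t).+1%:R]natr1 mulrDl mul1r.
by rewrite ltr_pdivlMr.
Qed.

Lemma approx_le j t x : N (approx j t x) <= N x.
Proof. exact/iter_resolvent_le/mesh_gt0. Qed.

Lemma approx_lin j t c x y : approx j t (c *: x + y) = c *: approx j t x + approx j t y.
Proof. exact/iter_resolvent_lin/mesh_gt0. Qed.

Lemma approxB j t x y : approx j t (x - y) = approx j t x - approx j t y.
Proof. exact/iter_resolventB/mesh_gt0. Qed.

(** Halving the mesh turns n steps into 2 n or 2 n + 1. The doubling costs n h^2 N (A (A x)), where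
    n h <= t, and the possible extra step costs h N (A x). Both are of order 2^-j, as completeness
    asks. *)
Lemma approx_fast t x j : 0 <= t -> domain2 x ->
  N (approx j.+1 t x - approx j t x) <= (t * N (A (A x)) + N (A x)) * 2 ^- j.
Proof.
move=> t0 Dx; rewrite /approx; set h : R := 2 ^- j.+1; set n := steps j t.
have h0 : 0 < h by exact: mesh_gt0.
have hh : 2 ^- j = 2 * h by rewrite /h exprS invfM mulrA divff ?mul1r.
have /andP[n1 n2] := steps_itv j t0; have /andP[m1 m2] := steps_itv j.+1 t0.
rewrite -/n -/h hh in n1 n2 m1 m2 *; set n' := steps j.+1 t in m1 m2 *.
have nn' : (2 * n <= n')%N.
  rewrite -ltnS -(ltr_nat R) -(ltr_pM2r h0) -natr1 natrM; lra.
have n'n : (n' <= (2 * n).+1)%N.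
  rewrite -ltnS -(ltr_nat R) -(ltr_pM2r h0) -natr1 -natr1 natrM; lra.
rewrite (le_trans (dist_triangle (iter (2 * n) (resolvent h) x) _ _))//.
have := iter_resolvent_close h0 Dx.1 nn'.
have : N (iter (2 * n) (resolvent h) x - iter n (resolvent (2 * h)) x) <=
    n%:R * h ^+ 2 * N (A (A x)).
  by rewrite distC; exact: iter_resolvent_halving.
have : n'%:R - (2 * n)%:R <= 1 :> R by rewrite lerBlDr nat1r ler_nat.
have := norm_ge0 (A x); have := norm_ge0 (A (A x)).
set a := N (A _); set b := N (A _); set c := N (_ - _); set d := N (_ - _).
set e := n'%:R - _ => b0 a0 e1 hc hd.
have : e * h * b <= h * b by rewrite -mulrA ler_piMl// mulr_ge0// ltW.
have : n%:R * h ^+ 2 * a <= t * h * a.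
  rewrite ler_wpM2r// expr2 mulrA ler_wpM2r ?(ltW h0)//.
  have : 0 <= n%:R * h :> R by rewrite mulr_ge0 ?ler0n// ltW.
  lra.
have : 0 <= t * h * a by rewrite !mulr_ge0// ltW.
have : 0 <= h * b by rewrite !mulr_ge0// ltW.
lra.
Qed.

(** [resolvent h] maps D into D(A^2) and moves y in D by at most h N (A y). *)
Lemma domain2_dense x (e : R) : 0 < e -> exists2 y, domain2 y & N (x - y) < e.
Proof.
move=> e0; have e20 : 0 < e / 2 by rewrite divr_gt0.
have [y Dy xy] := denseD x e20.
have a0 := norm_ge0 (A y); have a1 : 0 < 1 + N (A y) by lra.
pose h := e / 2 / (1 + N (A y)).
have h0 : 0 < h by rewrite divr_gt0.
exists (resolvent h y); first exact: resolvent_domain2.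
rewrite (le_lt_trans (dist_triangle y _ _))//.
have := resolvent_step h0 Dy; rewrite (distC (resolvent h y)).
have : h * N (A y) <= e / 2.
  by rewrite /h mulrAC ler_pdivrMr// ler_wpM2l ?ltW//; lra.
lra.
Qed.

(** On D(A^2) this is [approx_fast]. In general take u n in D(A^2) within 2^-n of x: the
    approximations are contractions, so the limits z n along u n are again geometrically Cauchy, and
    a three-term comparison gives convergence at x. *)
Lemma approx_cvg t x : 0 <= t -> ncvg (fun j => approx j t x) (semigroup t x).
Proof.
move=> t0; rewrite /semigroup; case: xgetP => [z -> //|/= none].
suff [w hw] : exists w, ncvg (fun j => approx j t x) w by have := none w.
have /choice[u hu] : forall n, exists y, domain2 y /\ N (x - y) < 2 ^- n.
  by move=> n; have [y] := domain2_dense x (mesh_gt0 n); exists y.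
have /choice[z hz] : forall n, exists z, ncvg (fun j => approx j t (u n)) z.
  move=> n; have [Du _] := hu n; apply: cplN => j; exact: approx_fast.
have zcau n : N (z n.+1 - z n) <= 2 * 2 ^- n.
  apply: (@ncvg_le (fun j => -1 *: approx j t (u n) + approx j t (u n.+1))).
    by have := ncvg_lin (-1) (hz n) (hz n.+1); rewrite scaleN1r addrC.
  move=> j; rewrite -approx_lin (le_trans (approx_le _ _ _))// scaleN1r addrC.
  rewrite (le_trans (dist_triangle x _ _))// distC.
  have [_] := hu n; have [_] := hu n.+1; have := geom2S 1 n; rewrite !mul1r.
  have := mesh_gt0 n; lra.
have [w zw] := cplN zcau; exists w.
apply/ncvgP => e e0; have e30 : 0 < e / 3 by rewrite divr_gt0.
have [n [hn1 hn2]] : exists n, 2 ^- n <= e / 3 /\ N (z n - w) <= e / 3.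
  have /ncvgP/(_ _ e30)[n1 _ H1] := zw.
  have /cvgr0Pnorm_le/(_ _ e30)[n2 _ H2] := cvg_geom2 1.
  exists (maxn n1 n2); split; last by apply: H1; rewrite /= leq_maxl.
  have := H2 (maxn n1 n2) (leq_maxr _ _).
  by rewrite /= mul1r ger0_norm// ltW// mesh_gt0.
have /ncvgP/(_ _ e30) := hz n; apply: filterS => j hj.
have h1 : N (approx j t x - approx j t (u n)) <= e / 3.
  rewrite -approxB (le_trans (approx_le _ _ _))// (le_trans _ hn1)// ltW//.
  by have [_] := hu n.
have := dist_triangle (approx j t (u n)) (approx j t x) w.
have := dist_triangle (z n) (approx j t (u n)) w.
lra.
Qed.

Lemma semigroup_le t x : 0 <= t -> N (semigroup t x) <= N x.
Proof. by move=> t0; apply: (ncvg_le (approx_cvg x t0)) => j; exact: approx_le. Qed.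

Lemma semigroup_lin t c x y : 0 <= t ->
  semigroup t (c *: x + y) = c *: semigroup t x + semigroup t y.
Proof.
move=> t0; apply: (ncvg_unique (approx_cvg _ t0)).
have := ncvg_lin c (approx_cvg x t0) (approx_cvg y t0).
by congr ncvg; apply/funext => j; rewrite approx_lin.
Qed.

Lemma semigroupB t x y : 0 <= t ->
  semigroup t (x - y) = semigroup t x - semigroup t y.
Proof.
by move=> t0; rewrite addrC -scaleN1r semigroup_lin// scaleN1r addrC.
Qed.

Lemma semigroup0 x : semigroup 0 x = x.
Proof.
apply: (ncvg_unique (approx_cvg _ (lexx 0))).
by apply: ncvg_const => j; rewrite /approx /steps mul0r truncn0.
Qed.

(** Carries to the whole space an estimate verified on the dense domain; the semigroup law and the
    decay by half are obtained in this way. *)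
Lemma dense_le (F : V -> R) (c : R) : (forall x, D x -> F x <= 0) ->
  (forall x y, F x <= F y + c * N (x - y)) -> forall x, F x <= 0.
Proof.
move=> FD Fc x; apply/ler_addgt0Pl => e e0; rewrite addr0.
have c1 : 0 < 1 + `|c| by have := normr_ge0 c; lra.
have e1 : 0 < e / (1 + `|c|) by rewrite divr_gt0.
have [y Dy xy] := denseD x e1.
have := Fc x y; have := FD y Dy.
have : c * N (x - y) <= e.
  rewrite ltr_pdivlMr// in xy; have := norm_ge0 (x - y); have := ler_norm c.
  nra.
lra.
Qed.

(** Rounding s and t down separately loses at most one step compared with rounding s + t, and on D
    one step moves a point by at most 2^-j N (A x). The rest is convergence of [approx j s] and
    [approx j t]. *)
Lemma semigroupD s t x : 0 <= s -> 0 <= t ->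
  semigroup (s + t) x = semigroup s (semigroup t x).
Proof.
move=> s0 t0; have st0 := addr_ge0 s0 t0.
apply/eqP; rewrite -subr_eq0; apply/eqP/norm_eq0/eqP.
rewrite eq_le norm_ge0 andbT; move: x.
pose L z := semigroup (s + t) z - semigroup s (semigroup t z).
have LB y z : L (y - z) = L y - L z.
  rewrite /L !semigroupB// !opprB addrACA [RHS]addrACA; congr (_ + _).
  exact: addrC.
apply: (@dense_le (N \o L) 2) => /= [y Dy|y z]; last first.
  have := norm_le_dist (L y) (L z); rewrite -LB.
  have := normB (semigroup (s + t) (y - z)) (semigroup s (semigroup t (y - z))).
  rewrite -/(L (y - z)); have := semigroup_le (y - z) st0.
  have := semigroup_le (semigroup t (y - z)) s0; have := semigroup_le (y - z) t0.
  lra.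
suff -> : L y = 0 by rewrite norm0.
move: y Dy => x Dx.
suff e : semigroup (s + t) x = semigroup s (semigroup t x) by rewrite /L e subrr.
apply: (ncvg_unique (approx_cvg _ st0)).
apply: (@ncvg_squeeze _ _ (fun j => N (A x) * 2 ^- j +
   (N (approx j t x - semigroup t x) +
    N (approx j s (semigroup t x) - semigroup s (semigroup t x))))); last first.
  rewrite -[0](addr0 0) -{2}[0](addr0 0); apply: cvgD; first exact: cvg_geom2.
  by apply: cvgD; apply: approx_cvg.
move=> j; rewrite (le_trans (dist_triangle (approx j s (approx j t x)) _ _))// lerD//.
  have p0 := mesh_gt0 j.
  have /andP[s1 s2] := steps_itv j s0; have /andP[t1 t2] := steps_itv j t0.
  have /andP[u1 u2] := steps_itv j st0.
  rewrite /approx -iterD; set a := steps j s in s1 s2 *; set b := steps j t in t1 t2 *.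
  set c := steps j (s + t) in u1 u2 *.
  have abc : (a + b <= c)%N.
    rewrite -ltnS -(ltr_nat R) -(ltr_pM2r p0) -natr1 natrD; lra.
  have cab : (c <= (a + b).+1)%N.
    rewrite -ltnS -(ltr_nat R) -(ltr_pM2r p0).
    have -> : (a + b).+2%:R = a%:R + b%:R + 2 :> R by rewrite -addn2 !natrD.
    lra.
  rewrite (le_trans (iter_resolvent_close p0 Dx abc))//.
  rewrite -mulrA [N _ * _]mulrC ler_piMl ?mulr_ge0 ?norm_ge0// ?(ltW p0)//.
  by rewrite lerBlDr nat1r ler_nat.
rewrite (le_trans (dist_triangle (approx j s (semigroup t x)) _ _))// lerD//.
by rewrite -approxB approx_le.
Qed.

Lemma semigroup_step t x : 0 <= t -> D x -> N (semigroup t x - x) <= t * N (A x).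
Proof.
move=> t0 Dx.
apply: (@ncvg_le (fun j => -1 *: x + approx j t x)).
  have := ncvg_lin (-1) (ncvg_const (fun=> erefl x)) (approx_cvg x t0).
  by rewrite scaleN1r addrC.
move=> j; rewrite scaleN1r addrC (le_trans (iter_resolvent_step _ (mesh_gt0 j) Dx))//.
by rewrite ler_wpM2r ?norm_ge0//; have /andP[] := steps_itv j t0.
Qed.

Lemma semigroup_continuous x : N (semigroup t x - x) @[t --> 0^'+] --> 0.
Proof.
apply/cvgr0Pnorm_le => e e0; have e30 : 0 < e / 3 by rewrite divr_gt0.
have [y Dy xy] := denseD x e30.
have a1 : 0 < 1 + N (A y) by have := norm_ge0 (A y); lra.
have d0 : 0 < e / 3 / (1 + N (A y)) by rewrite divr_gt0.
near=> t; rewrite ger0_norm ?norm_ge0//.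
have t0 : 0 < t by near: t; exact: nbhs_right_gt.
have : t <= e / 3 / (1 + N (A y)) by near: t; exact: nbhs_right_le.
rewrite ler_pdivlMr// => te.
have := dist_triangle (semigroup t y) (semigroup t x) x.
have := dist_triangle y (semigroup t y) x.
have := semigroup_step (ltW t0) Dy.
have := semigroup_le (x - y) (ltW t0); rewrite semigroupB ?(ltW t0)// (distC y).
lra.
Unshelve. all: by end_near. Qed.

(** J^n x - x is h times the sum of J^i (A x) for 1 <= i <= n. Since A x need not lie in D, its
    displacement under J^i is estimated through an auxiliary [z] in D, later chosen close to A x. *)
Lemma iter_resolvent_deriv h n x z : 0 < h -> D x -> D z ->
  N (iter n (resolvent h) x - x - of_real (n%:R * h) *: A x) <=
  n%:R * h * (2 * N (A x - z) + n%:R * h * N (A z)).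
Proof.
move=> h0 Dx Dz; elim: n => [|n IH].
  by rewrite /= !mul0r of_real0 scale0r subrr subr0 norm0.
set y := A x in IH *; set u := iter n _ x in IH *.
have Du : D u by exact: iter_resolvent_in.
have e1 : iter n.+1 (resolvent h) x - u = of_real h *: iter n.+1 (resolvent h) y.
  rewrite iterS -/u resolvent_sub// resolvent_comm//.
  by rewrite iter_resolvent_comm.
have -> : iter n.+1 (resolvent h) x - x - of_real (n.+1%:R * h) *: y =
   (u - x - of_real (n%:R * h) *: y) +
   of_real h *: (iter n.+1 (resolvent h) y - y).
  rewrite scalerBr -e1 -natr1 mulrDl mul1r of_realD scalerDl opprD.
  by rewrite -[_ - x](subrKA u) [X in X + _]addrC addrACA.
rewrite (le_trans (normD _ _))// normZr gtr0_norm//.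
have hz : N (iter n.+1 (resolvent h) y - y) <= 2 * N (y - z) + n.+1%:R * h * N (A z).
  have := dist_triangle (iter n.+1 (resolvent h) z) (iter n.+1 (resolvent h) y) y.
  have := dist_triangle z (iter n.+1 (resolvent h) z) y.
  have := iter_resolvent_step n.+1 h0 Dz; rewrite -iter_resolventB//.
  have := iter_resolvent_le n.+1 (y - z) h0; rewrite (distC z y).
  lra.
move: IH (ler_wpM2l (ltW h0) hz); rewrite -natr1.
set a := n%:R; set b := N (y - z); set c := N (A z).
have a0 : 0 <= a by rewrite ler0n.
have c0 : 0 <= c by exact: norm_ge0.
have : 0 <= a * h * (h * c) by rewrite !mulr_ge0// ltW.
move: (N _) (N (_ - _)) => d e; nra.
Qed.

Lemma semigroup_deriv t x z : 0 <= t -> D x -> D z ->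
  N (semigroup t x - x - of_real t *: A x) <=
  t * (2 * N (A x - z) + t * N (A z)).
Proof.
move=> t0 Dx Dz; pose h (j : nat) : R := 2 ^- j; pose n j := steps j t.
have cvgr : ncvg (fun j => of_real ((n j)%:R * h j) *: A x) (of_real t *: A x).
  apply: (@ncvg_squeeze _ _ (fun j => N (A x) * 2 ^- j)); last exact: cvg_geom2.
  move=> j; rewrite -scalerBl -of_realB normZr mulrC ler_wpM2l ?norm_ge0//.
  have /andP[] := steps_itv j t0; rewrite -/(n j) -/(h j) => h1 h2.
  by rewrite ler_norml; apply/andP; split; lra.
apply: (@ncvg_le (fun j => -1 *: (of_real ((n j)%:R * h j) *: A x) +
                            (-1 *: x + approx j t x))).
  have := ncvg_lin (-1) cvgr (ncvg_lin (-1) (ncvg_const (fun=> erefl x)) (approx_cvg x t0)).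
  by rewrite !scaleN1r [- x + _]addrC [X in ncvg _ X]addrC.
move=> j; rewrite !scaleN1r [- x + _]addrC [X in N X]addrC.
rewrite (le_trans (iter_resolvent_deriv _ (mesh_gt0 j) Dx Dz))//.
have /andP[h1 _] := steps_itv j t0.
apply: ler_pM => //.
- by rewrite addr_ge0// !mulr_ge0 ?norm_ge0// ltW// mesh_gt0.
- by rewrite lerD2l ler_wpM2r ?norm_ge0.
Qed.

Lemma semigroup_deriv_cvg x : D x ->
  N (of_real t^-1 *: (semigroup t x - x) - A x) @[t --> 0^'+] --> 0.
Proof.
move=> Dx; apply/cvgr0Pnorm_le => e e0; have e30 : 0 < e / 3 by rewrite divr_gt0.
have [z Dz xz] := denseD (A x) e30.
have a1 : 0 < 1 + N (A z) by have := norm_ge0 (A z); lra.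
have d0 : 0 < e / 3 / (1 + N (A z)) by rewrite divr_gt0.
near=> t; rewrite ger0_norm ?norm_ge0//.
have t0 : 0 < t by near: t; exact: nbhs_right_gt.
have : t <= e / 3 / (1 + N (A z)) by near: t; exact: nbhs_right_le.
rewrite ler_pdivlMr// => te.
have := semigroup_deriv (ltW t0) Dx Dz.
have -> : semigroup t x - x - of_real t *: A x =
    of_real t *: (of_real t^-1 *: (semigroup t x - x) - A x).
  by rewrite scalerBr scalerA -of_realM divff ?gt_eqF// of_real1 scale1r.
rewrite normZr gtr0_norm// ler_pM2l// => /le_trans; apply.
lra.
Unshelve. all: by end_near. Qed.

(** For the converse, let x' solve x' - A x' = x - y. Then z = x - x' equals y - A x', and the
    difference quotients of the semigroup at z converge to z itself. So the norm of z would grow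
    like 1 + t for small t, which contradicts contractivity unless z = 0. *)
Lemma semigroup_generator : is_generator N D A semigroup.
Proof.
move=> x y; split=> [[Dx <-]|xy]; first exact: semigroup_deriv_cvg.
have [x' Dx' hx'] := rangeA (x - y) ltr01; rewrite of_real1 scale1r in hx'.
have xy' := semigroup_deriv_cvg Dx'.
pose z := x - x'.
have zE : z = y - A x'.
  by apply/eqP; rewrite subr_eq -addrA [- _ + _]addrC hx' addrC subrK.
have z0 : z = 0.
  apply: norm_eq0; apply/eqP; rewrite eq_le norm_ge0 andbT.
  apply/ler_addgt0Pl => e e0; rewrite addr0.
  have e20 : 0 < e / 2 by rewrite divr_gt0.
  move/cvgr0Pnorm_le: xy => /(_ _ e20) xy.
  move/cvgr0Pnorm_le: xy' => /(_ _ e20) xy'.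
  near (0 : R)^'+ => t.
  have t0 : 0 < t by near: t; exact: nbhs_right_gt.
  have : `|N (of_real t^-1 *: (semigroup t x - x) - y)| <= e / 2.
    by near: t.
  have : `|N (of_real t^-1 *: (semigroup t x' - x') - A x')| <= e / 2.
    by near: t.
  rewrite !ger0_norm ?norm_ge0// => h1 h2.
  have h3 : N (of_real t^-1 *: (semigroup t z - z) - z) <= e.
    have -> : of_real t^-1 *: (semigroup t z - z) - z =
      (of_real t^-1 *: (semigroup t x - x) - y) -
      (of_real t^-1 *: (semigroup t x' - x') - A x').
      rewrite [in X in X - z]/z semigroupB ?(ltW t0)// subrACA scalerBr zE.
      exact: subrACA.
    by rewrite (le_trans (normB _ _))//; lra.
  have h4 : N (semigroup t z - (z + of_real t *: z)) <= t * e.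
    rewrite -[t in leRHS]gtr0_norm// -ler_pdivrMl ?gtr0_norm//.
    rewrite -{1}[t]gtr0_norm// -normfV -normZr.
    rewrite scalerBr scalerDr scalerA -of_realM mulVf ?gt_eqF// of_real1 scale1r.
    by rewrite opprD addrA -scalerBr.
  have := norm_le_dist (z + of_real t *: z) (semigroup t z); rewrite distC.
  rewrite -{1}[z]scale1r -{1}of_real1 -scalerDl -of_realD normZr.
  rewrite gtr0_norm ?addr_gt0//.
  have := semigroup_le z (ltW t0) => h5 h6.
  by rewrite -(ler_pM2l t0); lra.
have xx' : x = x' by apply/eqP; rewrite -subr_eq0 -/z z0.
split; rewrite xx'//; apply/eqP; rewrite eq_sym -subr_eq0 -zE z0//.
Unshelve. all: by end_near. Qed.

Lemma opnorm_le S c : (forall x, N (S x) <= c * N x) -> 0 <= c ->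
  (opnorm N N S <= c%:E)%E.
Proof.
move=> hS c0; apply: ge_ereal_sup => _ [x /= x1 <-].
by rewrite lee_fin (le_trans (hS x))// ler_piMr.
Qed.

Lemma semigroup_contraction : contraction_semigroup N semigroup.
Proof.
have le1 t : 0 <= t -> (opnorm N N (semigroup t) <= 1)%E.
  by move=> t0; apply: opnorm_le => // x; rewrite mul1r semigroup_le.
split=> //; split.
- move=> t t0; split; last by rewrite (le_lt_trans (le1 t t0))// ltry.
  by move=> c x y; exact: semigroup_lin.
- exact: semigroup0.
- by move=> s t x s0 t0; exact: semigroupD.
- exact: semigroup_continuous.
Qed.

Lemma semigroup_stable C :
  (forall j n x, D x ->
     n%:R * 2 ^- j * N (iter n (resolvent (2 ^- j)) x) ^+ 2 <= C * N x ^+ 2) ->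
  exponentially_stable N semigroup.
Proof.
move=> hC; pose C' := Num.max C 1.
have C1 : 1 <= C' by rewrite le_max lexx orbT.
have {}hC j n x : D x ->
     n%:R * 2 ^- j * N (iter n (resolvent (2 ^- j)) x) ^+ 2 <= C' * N x ^+ 2.
  by move=> /hC/le_trans; apply; rewrite ler_wpM2r ?sqr_ge0// le_max lexx.
(* The final 1 absorbs the rounding in [steps]: as 2^-j <= 1, at least time 4 C' is covered, so that
   [hC] bounds the squared norm at time t0 by a quarter of the initial one. *)
pose t0 : R := 4 * C' + 1.
have t00 : 0 < t0 by rewrite /t0; lra.
have half x : N (semigroup t0 x) <= N x / 2.
  rewrite -subr_le0; move: x.
  apply: (@dense_le (fun x => N (semigroup t0 x) - N x / 2) 2) => [x Dx|x y].
    rewrite subr_le0; apply: (ncvg_le (approx_cvg x (ltW t00))) => j.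
    have := hC j (steps j t0) x Dx; rewrite -/(approx j t0 x).
    have /andP[_ h1] := steps_itv j (ltW t00).
    have h2 : 2 ^- j <= 1 :> R by rewrite invf_le1 ?exprn_gt0// exprn_ege1// ler1n.
    have h3 : 4 * C' <= (steps j t0)%:R * 2 ^- j by rewrite /t0 in h1; lra.
    move=> h4; rewrite -ler_sqr ?nnegrE ?divr_ge0 ?norm_ge0//.
    rewrite -(ler_pM2l (_ : 0 < 4 * C')); last by lra.
    rewrite (le_trans (ler_wpM2r (sqr_ge0 _) h3))// (le_trans h4)//.
    by rewrite expr_div_n; lra.
  have := norm_le_dist (semigroup t0 x) (semigroup t0 y).
  rewrite -semigroupB ?(ltW t00)//; have := semigroup_le (x - y) (ltW t00).
  by have := norm_le_dist y x; rewrite distC; have := norm_ge0 (x - y); lra.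
have halfn n x : N (semigroup (n%:R * t0) x) <= 2 ^- n * N x.
  elim: n x => [|n IH] x.
    by rewrite mul0r semigroup0 expr0 invr1 mul1r.
  rewrite -natr1 mulrDl mul1r semigroupD ?(ltW t00)// ?mulr_ge0 ?(ltW t00)//.
  rewrite (le_trans (IH _))// exprSr invfM -mulrA ler_wpM2l ?(ltW (mesh_gt0 n))//.
  by rewrite mulrC.
have ln20 : 0 < ln 2 :> R by rewrite ln_gt0// ltr1n.
(* For n t0 <= t < (n + 1) t0 the bound 2^-n is at most 2 exp (- t ln 2 / t0); the factor 2 pays for
   the incomplete last period. *)
exists 2, (- (ln 2 / t0)); split; first by rewrite ler1n.
  by rewrite oppr_lt0 divr_gt0.
move=> t tge0; apply: opnorm_le; last by rewrite mulr_ge0// expR_ge0.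
move=> x; pose n := Num.truncn (t / t0).
have /truncn_itv/andP[n1 n2] : 0 <= t / t0 by rewrite divr_ge0// ltW.
rewrite -/n in n1 n2; rewrite ler_pdivlMr// in n1.
have r0 : 0 <= t - n%:R * t0 by rewrite subr_ge0.
rewrite -[t in leLHS](subrKC (n%:R * t0)) semigroupD// ?mulr_ge0 ?(ltW t00)//.
rewrite (le_trans (halfn _ _))// ler_pM ?norm_ge0 ?semigroup_le//.
rewrite -ler_pdivrMl//.
have -> : 2^-1 / 2 ^+ n = expR (- (ln 2 * n.+1%:R)) :> R.
  by rewrite expRN expRM_natr lnK ?posrE// exprS invfM.
rewrite ler_expR mulNr lerN2 mulrAC -mulrA ler_wpM2l ?(ltW ln20)//.
by rewrite ltW.
Qed.

End Resolvent.
End Norm.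

(** * Integration, absolute continuity and weak derivatives *)

Lemma aeF (R : realType) : Filter (almost_everywhere (@lebesgue_measure R)).
Proof. exact: ae_filter_ringOfSetsType. Qed.
#[local] Existing Instance aeF.

Section RealIntegral.
Context {R : realType}.
Implicit Types (a b s t r c e : R) (f g : R -> R).

Definition intg a b f := mu.-integrable `[a, b] (EFin \o f).

Definition rint a b f := \int[mu]_(t in `[a, b]) f t.

Lemma intgD a b f g : intg a b f -> intg a b g -> intg a b (fun t => f t + g t).
Proof.
move=> hf hg; rewrite /intg (_ : EFin \o _ = (EFin \o f) \+ (EFin \o g))//.
exact: integrableD.
Qed.

Lemma intgZ a b c f : intg a b f -> intg a b (fun t => c * f t).
Proof.
move=> hf; rewrite /intg (_ : EFin \o _ = (fun t => c%:E * (EFin \o f) t)%E)//.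
exact: integrableZl.
Qed.

Lemma intgN a b f : intg a b f -> intg a b (fun t => - f t).
Proof.
move=> hf; rewrite /intg (_ : EFin \o _ = -%E \o (EFin \o f))//.
exact: integrableN.
Qed.

Lemma intgB a b f g : intg a b f -> intg a b g -> intg a b (fun t => f t - g t).
Proof. by move=> hf hg; exact/intgD/intgN. Qed.

Lemma intg_cst a b c : intg a b (fun=> c).
Proof.
apply: measurable_bounded_integrable => //.
  by rewrite /= lebesgue_measure_itv/=; case: ifP => _; rewrite ltry.
exists `|c|; split; first exact: num_real.
by move=> M cM t _; exact: ltW.
Qed.

Lemma intg_sum I (r : seq I) (P : pred I) a b (F : I -> R -> R) :
  (forall i, P i -> intg a b (F i)) -> intg a b (fun t => \sum_(i <- r | P i) F i t).
Proof.
move=> hF; elim: r => [|i r IH].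
  by under [X in intg _ _ X]eq_fun do rewrite big_nil; exact: intg_cst.
under [X in intg _ _ X]eq_fun do rewrite big_cons.
by have [Pi|//] := boolP (P i); apply: intgD => //; exact: hF.
Qed.

Lemma intg_norm a b f : intg a b f -> intg a b (fun t => `|f t|).
Proof. exact: integrable_norm. Qed.

Lemma intgW a b s t f : a <= s -> t <= b -> intg a b f -> intg s t f.
Proof.
move=> as_ tb; apply: integrableS => //.
by apply: subset_itv; rewrite bnd_simp.
Qed.

Lemma intg_meas a b f : intg a b f -> measurable_fun `[a, b] f.
Proof. by move=> /measurable_int/measurable_EFinP. Qed.

Lemma intg_bounded_mul a b M f g : measurable_fun `[a, b] f ->
  (forall t, a <= t <= b -> `|f t| <= M) -> intg a b g ->
  intg a b (fun t => f t * g t).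
Proof.
move=> mf fM hg.
suff bf : [bounded f x | x in `[a, b] : set R].
  rewrite /intg (_ : EFin \o _ = ((EFin \o f) \* (EFin \o g))%E)//.
  exact: integrableMr.
exists M; split; first exact: num_real.
by move=> x Mx t /=; rewrite in_itv/= => /fM/le_trans; apply; exact: ltW.
Qed.

Lemma intg_bounded a b M f : measurable_fun `[a, b] f ->
  (forall t, a <= t <= b -> `|f t| <= M) -> intg a b f.
Proof.
move=> mf fM; have := intg_bounded_mul mf fM (intg_cst a b 1).
by under [X in intg _ _ X]eq_fun do rewrite mulr1.
Qed.

Lemma rintD a b f g : intg a b f -> intg a b g ->
  rint a b (fun t => f t + g t) = rint a b f + rint a b g.
Proof. exact: RintegralD. Qed.

Lemma rintB a b f g : intg a b f -> intg a b g ->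
  rint a b (fun t => f t - g t) = rint a b f - rint a b g.
Proof. exact: RintegralB. Qed.

Lemma rintZ a b c f : intg a b f -> rint a b (fun t => c * f t) = c * rint a b f.
Proof. exact: RintegralZl. Qed.

Lemma rint_cst a b c : a <= b -> rint a b (fun=> c) = c * (b - a).
Proof.
move=> ab; rewrite /rint Rintegral_cst//=; congr (_ * _).
rewrite lebesgue_measure_itv/= lte_fin; case: ltP => // ba.
by rewrite (le_anti (introT andP (conj ab ba))) subrr.
Qed.

Lemma rint_sum I (r : seq I) (P : pred I) a b (F : I -> R -> R) :
  (forall i, P i -> intg a b (F i)) ->
  rint a b (fun t => \sum_(i <- r | P i) F i t) = \sum_(i <- r | P i) rint a b (F i).
Proof.
move=> hF; elim: r => [|i r IH].
  rewrite big_nil (_ : (fun t => _) = fun=> 0); last first.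
    by apply/funext => t; rewrite big_nil.
  by rewrite /rint Rintegral_cst// mul0r.
rewrite big_cons (_ : (fun t => _) =
    fun t => if P i then F i t + \sum_(j <- r | P j) F j t
             else \sum_(j <- r | P j) F j t); last first.
  by apply/funext => t; rewrite big_cons.
by have [Pi|//] := boolP (P i); rewrite -IH rintD//; [exact: hF|exact: intg_sum].
Qed.

Lemma rint_le a b f g : intg a b f -> intg a b g ->
  (forall t, a <= t <= b -> f t <= g t) -> rint a b f <= rint a b g.
Proof.
by move=> hf hg fg; apply: le_Rintegral => // t /=; rewrite in_itv/=; exact: fg.
Qed.

Lemma rint_ge0 a b f : (forall t, a <= t <= b -> 0 <= f t) -> 0 <= rint a b f.
Proof. by move=> f0; apply: Rintegral_ge0 => t /=; rewrite in_itv/=; exact: f0. Qed.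

Lemma rint_norm a b f : intg a b f -> `|rint a b f| <= rint a b (fun t => `|f t|).
Proof. exact: le_normr_Rintegral. Qed.

Lemma eq_rint a b f g : (forall t, a <= t <= b -> f t = g t) -> rint a b f = rint a b g.
Proof. by move=> fg; apply: eq_Rintegral => t; rewrite inE/= in_itv/=; exact: fg. Qed.

Lemma eq_intg a b f g : (forall t, a <= t <= b -> f t = g t) -> intg a b f -> intg a b g.
Proof.
move=> fg; apply: eq_integrable => // t; rewrite inE/= in_itv/= => tab.
by rewrite fg.
Qed.

Lemma rint_split a s b f : a <= s -> s <= b -> intg a b f ->
  rint a b f = rint a s f + rint s b f.
Proof.
move=> as_ sb hf; apply/eqP; rewrite [X in _ == X]addrC -subr_eq; apply/eqP.
have := @Rintegral_itvB R f (BLeft a) (BRight b) s hf.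
rewrite !bnd_simp => /(_ as_ sb); rewrite -/(rint a s f) -/(rint a b f).
rewrite -/(rint s b f) Rintegral_itv_obnd_cbnd//.
apply: integrableS hf => //.
by apply: subset_itv; rewrite bnd_simp.
Qed.

Lemma rint_set1 a f : rint a a f = 0.
Proof. by rewrite /rint set_itv1 Rintegral_set1. Qed.

Lemma rint_nonneg_mono a b s t f : a <= s -> s <= t -> t <= b -> intg a b f ->
  (forall r, a <= r <= b -> 0 <= f r) -> rint s t f <= rint a b f.
Proof.
move=> as_ st tb hf f0; have at_ := le_trans as_ st; have sb := le_trans st tb.
rewrite (rint_split as_ sb hf) (rint_split st tb (intgW as_ (lexx b) hf)).
have h1 : 0 <= rint a s f.
  by apply: rint_ge0 => r /andP[ar rs]; rewrite f0// ar (le_trans rs).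
have h2 : 0 <= rint t b f.
  by apply: rint_ge0 => r /andP[tr rb]; rewrite f0// rb (le_trans at_).
lra.
Qed.

Lemma ae_eq_rint a b f g : intg a b f -> intg a b g ->
  {ae mu, forall t, `[a, b]%classic t -> f t = g t} -> rint a b f = rint a b g.
Proof.
move=> hf hg fg; rewrite /rint /Rintegral; congr fine.
apply: ae_eq_integral => //.
- by apply/measurable_EFinP; exact: intg_meas.
- by apply/measurable_EFinP; exact: intg_meas.
by apply: filterS fg => t h /h ->.
Qed.

(** Almost everywhere g coincides with max f g, which dominates f at every point; writing the
    maximum with an absolute value shows that it is integrable. *)
Lemma ae_le_rint a b f g : intg a b f -> intg a b g ->
  {ae mu, forall t, `[a, b]%classic t -> f t <= g t} -> rint a b f <= rint a b g.
Proof.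
move=> hf hg fg; have mf := intg_meas hf; have mg := intg_meas hg.
have hm : intg a b (fun t => Num.max (f t) (g t)).
  apply: (@eq_intg _ _ (fun t => 2^-1 * (f t + g t + `|f t - g t|))).
    by move=> t _; rewrite maxr_absE mulrC.
  by apply: intgZ; apply: intgD; [exact: intgD|apply: intg_norm; exact: intgB].
rewrite (@ae_eq_rint a b g (fun t => Num.max (f t) (g t)))//; last first.
  by apply: filterS fg => t h /h fgt; rewrite max_r.
by apply: rint_le => // t _; rewrite le_max lexx.
Qed.

(** Summing over a partition finer than [d] bounds |F b - F a| by e (V b - V a), and e is arbitrary.
    This gives the product rule [ac_mul] without pointwise differentiation. *)
Lemma const_of_small_increments a b (F V : R -> R) : a <= b ->
  (forall e, 0 < e -> exists2 d, 0 < d & forall s t, a <= s -> s <= t -> t <= b ->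
     t - s < d -> `|F t - F s| <= e * (V t - V s)) ->
  F b = F a.
Proof.
move=> ab H.
suff K e : 0 < e -> `|F b - F a| <= e * (V b - V a).
  apply/eqP; rewrite -subr_eq0 -normr_le0; apply/ler_addgt0Pl => e e0.
  rewrite addr0; have c0 : 0 < 1 + `|V b - V a| by have := normr_ge0 (V b - V a); lra.
  have := K _ (divr_gt0 e0 c0) => /le_trans; apply.
  by rewrite mulrAC ler_pdivrMr// ler_pM2l//; have := ler_norm (V b - V a); lra.
move=> e0; have [d d0 Hd] := H e e0.
pose n := (Num.truncn ((b - a) / d)).+1.
have n0 : 0 < n%:R :> R by rewrite ltr0n.
have dn : (b - a) / n%:R < d.
  rewrite ltr_pdivrMr// mulrC -ltr_pdivrMr//; exact: truncnS_gt.
pose p i := a + i%:R * ((b - a) / n%:R).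
have w0 : 0 <= (b - a) / n%:R by rewrite divr_ge0 ?subr_ge0// ltW.
have pS i : p i.+1 = p i + (b - a) / n%:R.
  by rewrite /p -natr1 mulrDl mul1r addrA.
have pn : p n = b by rewrite /p mulrC divfK ?gt_eqF// addrC subrK.
have ple i : (i <= n)%N -> p i <= b.
  by move=> lin; rewrite -pn /p lerD2l ler_wpM2r// ler_nat.
have pge i : a <= p i by rewrite /p lerDl mulr_ge0.
suff : forall i, (i <= n)%N -> `|F (p i) - F a| <= e * (V (p i) - V a).
  by move=> /(_ n (leqnn n)); rewrite pn.
elim=> [_|i IH lin]; first by rewrite /p mul0r addr0 !subrr normr0 mulr0.
have := IH (ltnW lin).
have := Hd (p i) (p i.+1) (pge i) _ (ple _ lin); rewrite pS lerDl => /(_ w0).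
rewrite addrAC subrr add0r => /(_ dn).
have := ler_normD (F (p i + (b - a) / n%:R) - F (p i)) (F (p i) - F a).
rewrite subrKA; lra.
Qed.

End RealIntegral.

Section AbsCont.
Context {R : realType}.
Implicit Types (a b s t r c e : R) (f g : R -> R).

(** Absolute continuity in integral form, with the density as an explicit argument: [f] is pinned
    down at every point of [a, b], [f'] only up to a null set. *)
Definition ac a b f f' :=
  intg a b f' /\ forall t, a <= t <= b -> f t = f a + rint a t f'.

Lemma ac_diff a b f f' s t : ac a b f f' -> a <= s -> s <= t -> t <= b ->
  f t - f s = rint s t f'.
Proof.
move=> [hf fE] as_ st tb; rewrite (fE t) ?(le_trans as_ st)// (fE s); last first.
  by rewrite as_ (le_trans st).
rewrite (rint_split as_ st (intgW (lexx a) tb hf)).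
by rewrite opprD addrACA subrr add0r addrAC subrr add0r.
Qed.

Lemma ac_cst a b c : ac a b (fun=> c) (fun=> 0).
Proof.
split; first exact: intg_cst.
by move=> t /andP[at_ _]; rewrite rint_cst// mul0r addr0.
Qed.

Lemma acD a b f f' g g' : ac a b f f' -> ac a b g g' ->
  ac a b (fun t => f t + g t) (fun t => f' t + g' t).
Proof.
move=> [hf fE] [hg gE]; split; first exact: intgD.
move=> t tab; have tb : t <= b by case/andP: tab.
by rewrite (fE t tab) (gE t tab) rintD; [exact: addrACA|exact: intgW (lexx _) tb hf|
  exact: intgW (lexx _) tb hg].
Qed.

Lemma acZ a b c f f' : ac a b f f' -> ac a b (fun t => c * f t) (fun t => c * f' t).
Proof.
move=> [hf fE]; split; first exact: intgZ.
move=> t tab; have tb : t <= b by case/andP: tab.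
by rewrite (fE t tab) mulrDr rintZ//; exact: intgW (lexx _) tb hf.
Qed.

Lemma acB a b f f' g g' : ac a b f f' -> ac a b g g' ->
  ac a b (fun t => f t - g t) (fun t => f' t - g' t).
Proof.
move=> hf /(acZ (-1)) hg; have := acD hf hg.
by under eq_fun do rewrite mulN1r; under [X in ac _ _ _ X]eq_fun do rewrite mulN1r.
Qed.

Lemma ac_sum I (r : seq I) (P : pred I) a b (F F' : I -> R -> R) :
  (forall i, P i -> ac a b (F i) (F' i)) ->
  ac a b (fun t => \sum_(i <- r | P i) F i t) (fun t => \sum_(i <- r | P i) F' i t).
Proof.
move=> hF; split; first by apply: intg_sum => i /hF[].
move=> t tab; have tb : t <= b by case/andP: tab.
rewrite rint_sum => [|i /hF[hi _]]; last exact: intgW (lexx _) tb hi.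
by rewrite -big_split; apply: eq_bigr => i /hF[_ ->].
Qed.

Lemma ac_primitive a b f : intg a b f -> ac a b (rint a ^~ f) f.
Proof. by move=> hf; split=> // t _; rewrite rint_set1 add0r. Qed.

Lemma ac_continuous a b f f' : a <= b -> ac a b f f' ->
  {within `[a, b], continuous f}.
Proof.
move=> ab [hf fE].
apply: (@subspace_eq_continuous _ _ _ (fun t => f a + rint a t f')).
  by move=> t; rewrite inE/= in_itv/= => /fE.
move=> t; apply: cvgD; first exact: cvg_cst.
exact: (parameterized_integral_continuous ab hf).
Qed.

Lemma ac_meas a b f f' : a <= b -> ac a b f f' -> measurable_fun `[a, b] f.
Proof.
move=> ab h; apply: subspace_continuous_measurable_fun => //.
exact: ac_continuous h.
Qed.

Lemma ac_bounded a b f f' : ac a b f f' ->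
  exists2 M, 0 <= M & forall t, a <= t <= b -> `|f t| <= M.
Proof.
move=> [hf fE]; have hn := intg_norm hf.
exists (`|f a| + rint a b (fun t => `|f' t|)); first by rewrite addr_ge0// rint_ge0.
move=> t tab; have /andP[at_ tb] := tab; rewrite (fE t)//.
rewrite (le_trans (ler_normD _ _))// lerD2l.
rewrite (le_trans (rint_norm (intgW (lexx a) tb hf)))//.
exact: rint_nonneg_mono.
Qed.

Lemma ac_intg a b f f' : a <= b -> ac a b f f' -> intg a b f.
Proof.
move=> ab h; have [M _ fM] := ac_bounded h.
exact: intg_bounded (ac_meas ab h) fM.
Qed.

Lemma ac_intg_mul a b f f' g : a <= b -> ac a b f f' -> intg a b g ->
  intg a b (fun t => f t * g t).
Proof.
move=> ab h; have [M _ fM] := ac_bounded h.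
exact: intg_bounded_mul (ac_meas ab h) fM.
Qed.

Lemma ac_unif a b f f' e : ac a b f f' -> 0 < e ->
  exists2 d, 0 < d & forall s t, a <= s -> s <= t -> t <= b -> t - s < d ->
    `|f t - f s| <= e.
Proof.
move=> h e0; have [hf fE] := h.
have hi : mu.-integrable setT (EFin \o (f' \_ `[a, b])).
  by rewrite -restrict_EFin; apply/integrable_restrict => //=; rewrite setTI.
have [d [d0 hd]] := integral_normr_continuous hi e0.
exists d => // s t as_ st tb std.
rewrite (ac_diff h)// (le_trans (rint_norm (intgW as_ tb hf)))//.
rewrite ltW// (le_lt_trans _ (hd [set` `[s, t]] _ _))//=.
  rewrite le_eqVlt; apply/orP; left; apply/eqP; apply: eq_rint => r /andP[sr rt].
  by rewrite patchE ifT// inE/= in_itv/= (le_trans as_ sr) (le_trans rt tb).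
by rewrite lebesgue_measure_itv/= lte_fin; case: ifP => _; rewrite -?EFinD lte_fin.
Qed.

(** Over [s, r] the increment of f g minus the integral of the claimed density is the integral of (f
    r - f x) g' x - (g x - g s) f' x. Uniform continuity makes it at most e times the integral of
    |f'| + |g'|. *)
Lemma ac_mul a b f f' g g' : a <= b -> ac a b f f' -> ac a b g g' ->
  ac a b (fun t => f t * g t) (fun t => f t * g' t + f' t * g t).
Proof.
move=> ab hf hg.
have h1 : intg a b (fun t => f t * g' t) by apply: ac_intg_mul hf hg.1.
have h2 : intg a b (fun t => f' t * g t).
  by under [X in intg _ _ X]eq_fun do rewrite mulrC; apply: ac_intg_mul hg hf.1.
split; first exact: intgD.
move=> t /andP[at_ tb].
pose w r := f r * g' r + f' r * g r.
pose n r := `|f' r| + `|g' r|.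
have hw : intg a b w by exact: intgD.
have hn : intg a b n by apply: intgD; apply: intg_norm; [exact: hf.1|exact: hg.1].
suff : f t * g t - rint a t w = f a * g a - rint a a w.
  by rewrite rint_set1 subr0 => <-; rewrite subrK.
apply: (@const_of_small_increments _ a t (fun t => f t * g t - rint a t w)
  (rint a ^~ n)) => // e e0.
have [d1 d10 H1] := ac_unif hf e0; have [d2 d20 H2] := ac_unif hg e0.
exists (Num.min d1 d2); first by rewrite lt_min d10.
move=> s r as_ sr rt; rewrite lt_min => /andP[rd1 rd2].
have rb := le_trans rt tb; have ar := le_trans as_ sr; have sb := le_trans sr rb.
have hws := intgW as_ rb hw.
have hf's := intgW as_ rb hf.1; have hg's := intgW as_ rb hg.1.
rewrite !(rint_split as_ sr (intgW (lexx a) rb _))//.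
have -> : f r * g r - (rint a s w + rint s r w) - (f s * g s - rint a s w) =
    rint s r (fun x => f r * g' x) + rint s r (fun x => g s * f' x) - rint s r w.
  rewrite rintZ// rintZ// -(ac_diff hf)// -(ac_diff hg)//; ring.
rewrite [rint a s n + _]addrC addrK.
have i1 := intgZ (f r) hg's; have i2 := intgZ (g s) hf's.
rewrite -rintD// -rintB//; last exact: intgD.
rewrite (le_trans (rint_norm _))//; first by apply: intgB => //; exact: intgD.
rewrite -rintZ; last exact: intgW as_ rb hn.
apply: rint_le; first by apply: intg_norm; apply: intgB => //; exact: intgD.
  by apply: intgZ; exact: intgW as_ rb hn.
move=> x /andP[sx xr].
have ax := le_trans as_ sx; have xb := le_trans xr rb.
have -> : f r * g' x + g s * f' x - w x =
  (f r - f x) * g' x - (g x - g s) * f' x by rewrite /w; ring.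
rewrite (le_trans (ler_normB _ _))// !normrM /n mulrDr addrC lerD// ler_wpM2r//.
  by apply: H2 => //; lra.
by apply: H1 => //; lra.
Qed.

Lemma ac_deriv a b f f' : a <= b -> (forall t, is_derive t 1 f (f' t)) ->
  continuous f' -> ac a b f f'.
Proof.
move=> ab df cf'; have df' t : derivable f t 1 by have := df t => -[].
have cf : continuous f by move=> t; apply/differentiable_continuous/derivable1_diffP.
split.
  apply: continuous_compact_integrable; first exact: segment_compact.
  exact: continuous_subspaceT.
move=> t /andP[]; rewrite le_eqVlt => /predU1P[<- _|at_ tb].
  by rewrite rint_set1 addr0.
rewrite /rint /Rintegral (@continuous_FTC2 _ f' f a t at_)/=.
- by rewrite subrKC.
- exact: continuous_subspaceT.
- split=> //.
  + exact/cvg_at_right_filter/cf.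
  + exact/cvg_at_left_filter/cf.
- by move=> x _; rewrite derive1E; have := df x => -[].
Qed.

End AbsCont.

(** * Smooth test functions built from exp (- 1/x) *)

Section FlatFunctions.
Context {R : realType}.
Implicit Types (x t c d : R) (f g : R -> R).

(** The powers of 1/x are kept because differentiating exp (- 1/x) produces them: derivatives of
    this family are linear combinations of its members, see [flat_deriv]. *)
Definition flat (n : nat) x : R :=
  if 0 < x then x^-1 ^+ n * expR (- x^-1) else 0.

Lemma flat_ge0 n x : 0 <= flat n x.
Proof.
rewrite /flat; case: ifP => // x0.
by rewrite mulr_ge0 ?expR_ge0// exprn_ge0// invr_ge0 ltW.
Qed.

(** From exp y >= y^(n+1) / (n+1)! at y = 1/x. As flat n h / h = flat (n+1) h, the linear bound
    yields differentiability at 0. *)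
Lemma flat_le n x : flat n x <= n.+1`!%:R * `|x|.
Proof.
rewrite /flat; case: ifPn => [x0|_]; last by rewrite mulr_ge0.
have y0 : 0 < x^-1 by rewrite invr_gt0.
rewrite gtr0_norm// expRN ler_pdivrMr ?expR_gt0//.
have := expR_ge1Dxn n (ltW y0); have := fact_gt0 n.+1.
rewrite -(ltr_nat R) => f0 h.
have : x^-1 ^+ n.+1 <= n.+1`!%:R * expR x^-1.
  rewrite mulrC -ler_pdivrMr//; lra.
rewrite exprS mulrC -ler_pdivlMr// invrK => /le_trans; apply.
by rewrite mulrAC.
Qed.

Lemma flat_deriv n x : is_derive x 1 (flat n) (- n%:R * flat n.+1 x + flat n.+2 x).
Proof.
have [x0|x0|->] := ltgtP x 0.
- rewrite /flat ltNge (ltW x0)/= mulr0 addr0.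
  suff d0 : is_derive x 1 (fun=> 0 : R) (0 : R).
    apply: near_eq_is_derive d0; near=> y; rewrite ltNge ltW//.
    by near: y; exact: lt_nbhsl.
  exact: is_derive_cst.
- rewrite /flat x0.
  suff dx : is_derive x 1 (fun y : R => y^-1 ^+ n * expR (- y^-1))
      (- n%:R * (x^-1 ^+ n.+1 * expR (- x^-1)) + x^-1 ^+ n.+2 * expR (- x^-1)).
    apply: near_eq_is_derive dx; near=> y; rewrite ifT//.
    by near: y; exact: lt_nbhsr.
  have dV : is_derive x 1 (fun y : R => y^-1) (- x ^- 2).
    have := @is_deriveV R id x 1 1 (lt0r_neq0 x0) (is_derive_id _ _).
    by rewrite [_ *: 1]mulr1.
  have dX := is_deriveX n dV.
  have dE : is_derive x 1 (expR \o (fun y : R => - y^-1)) (expR (- x^-1) * x ^- 2).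
    have dN : is_derive x 1 (fun y : R => - y^-1) (x ^- 2).
      by have := is_deriveN dV; rewrite opprK.
    exact: (is_derive1_comp (is_derive_expR _) dN).
  have eX y : ((fun y : R => y^-1) ^+ n) y = y^-1 ^+ n by rewrite exprfctE.
  have -> : (fun y : R => y^-1 ^+ n * expR (- y^-1)) =
      ((fun y : R => y^-1) ^+ n) * (expR \o (fun y : R => - y^-1)).
    by apply/funext => y; rewrite -eX.
  apply: (is_derive_eq (is_deriveM dX dE)).
  rewrite eX /GRing.scale/= -exprVn.
  set y := x^-1; set e := expR _.
  case: n {dX eX} => [|n]; first by rewrite /= !expr0 mulr0n; ring.
  by rewrite succnK !exprS; ring.
- have flat0 j : flat j 0 = 0 by rewrite /flat ltxx.
  rewrite !flat0 mulr0 addr0.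
  have cv : h^-1 *: (flat n (h *: 1 + 0) - flat n 0) @[h --> 0^'] --> 0.
    apply/cvgr0Pnorm_le => e e0.
    have c0 : 0 < n.+2`!%:R :> R by rewrite ltr0n fact_gt0.
    near=> h.
    have h0 : h != 0 by near: h; exact: nbhs_dnbhs_neq.
    rewrite flat0 subr0 addr0 [h *: 1]mulr1 /GRing.scale/=.
    have -> : h^-1 * flat n h = flat n.+1 h.
      by rewrite /flat; case: ifP => _; rewrite ?mulr0// exprS mulrA.
    rewrite ger0_norm ?flat_ge0// (le_trans (flat_le _ _))//.
    rewrite mulrC -ler_pdivlMr//.
    by near: h; apply: dnbhs0_le; rewrite divr_gt0.
  apply: DeriveDef; first by apply/cvg_ex; exists 0.
  by apply/cvg_lim.
Unshelve. all: by end_near. Qed.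

(** A class closed under derivation, so that smoothness to all orders follows by induction on the
    order instead of by computing derivatives. *)
Inductive elementary : (R -> R) -> Prop :=
| elementary_flat n c d : elementary (fun t => flat n (c * t + d))
| elementary_cst c : elementary (fun=> c)
| elementaryD f g : elementary f -> elementary g -> elementary (fun t => f t + g t)
| elementaryM f g : elementary f -> elementary g -> elementary (fun t => f t * g t).

Lemma elementary_deriv f : elementary f ->
  exists2 f', elementary f' & forall t, is_derive t 1 f (f' t).
Proof.
elim=> [n c d|c|{}f g _ [f' ef' df] _ [g' eg' dg]|{}f g ef [f' ef' df] eg [g' eg' dg]].
- exists (fun t => (- n%:R * flat n.+1 (c * t + d) + flat n.+2 (c * t + d)) * c).
    apply: elementaryM; last exact: elementary_cst.
    apply: elementaryD; last exact: elementary_flat.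
    by apply: elementaryM; [exact: elementary_cst|exact: elementary_flat].
  move=> t; apply: (@is_derive1_comp _ (flat n) (fun t => c * t + d)).
    exact: flat_deriv.
  have := is_deriveD (is_deriveZ c (is_derive_id t 1)) (is_derive_cst d t 1).
  by rewrite addr0 [c *: 1]mulr1.
- exists (fun=> 0); first exact: elementary_cst.
  by move=> t; exact: is_derive_cst.
- exists (fun t => f' t + g' t); first exact: elementaryD.
  by move=> t; apply: is_deriveD.
- exists (fun t => f t * g' t + g t * f' t).
    by apply: elementaryD; exact: elementaryM.
  by move=> t; apply: is_deriveM.
Qed.

Lemma elementary_smooth f : elementary f -> forall n t, derivable (derive1n n f) t 1.
Proof.
move=> ef n; suff : elementary (derive1n n f).
  by move=> /elementary_deriv[f' _ df] t; have [] := df t.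
elim: n => // n /elementary_deriv[g eg dg]; rewrite derive1nS.
suff -> : derive1 (derive1n n f) = g by [].
by apply/funext => t; rewrite derive1E; have [] := dg t.
Qed.

Lemma elementary_continuous f : elementary f -> continuous f.
Proof.
move=> /elementary_smooth/(_ 0%N) df t.
exact/differentiable_continuous/derivable1_diffP/df.
Qed.

(* smooth approximations of the indicator function of ]s, t[ *)
Definition smooth_bump n s t x : R := flat 0 (n * x - n * s) * flat 0 (n * t - n * x).

Lemma elementary_smooth_bump n s t : elementary (smooth_bump n s t).
Proof.
apply: elementaryM; first exact: elementary_flat.
have -> : (fun x => flat 0 (n * t - n * x)) = (fun x => flat 0 ((- n) * x + n * t)).
  by apply/funext => x; rewrite mulNr addrC.
exact: elementary_flat.
Qed.

Lemma flat0_gt0 x : 0 < x -> 0 < flat 0 x <= 1.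
Proof.
move=> x0; rewrite /flat x0 expr0 mul1r expR_gt0/= -expR0 ler_expR oppr_le0.
by rewrite invr_ge0 ltW.
Qed.

Lemma flat0_itv x : 0 <= flat 0 x <= 1.
Proof.
have [x0|x0] := ltP 0 x; first by have /andP[/ltW-> ->] := flat0_gt0 x0.
by rewrite /flat ltNge x0/= lexx ler01.
Qed.

Lemma smooth_bump_itv n s t x : 0 <= smooth_bump n s t x <= 1.
Proof.
have /andP[h1 h2] := flat0_itv (n * x - n * s).
have /andP[h3 h4] := flat0_itv (n * t - n * x).
by rewrite mulr_ge0//= mulr_ile1.
Qed.

Lemma smooth_bump_eq0 n s t x : 0 < n -> (x <= s) || (t <= x) -> smooth_bump n s t x = 0.
Proof.
move=> n0 /orP[h|h]; rewrite /smooth_bump /flat.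
  by rewrite ltNge subr_le0 ler_pM2l// h mul0r.
by rewrite [X in _ * (if X then _ else _)]ltNge subr_le0 ler_pM2l// h mulr0.
Qed.

Lemma flat0_cvg x : 0 < x -> flat 0 (n.+1%:R * x) @[n --> \oo] --> (1 : R).
Proof.
move=> x0.
have -> : (fun n : nat => flat 0 (n.+1%:R * x)) = (fun n => expR (- (x^-1 * n.+1%:R^-1))).
  by apply/funext => n; rewrite /flat mulr_gt0// expr0 mul1r invfM mulrC.
have : - (x^-1 * n.+1%:R^-1) @[n --> \oo] --> (0 : R).
  rewrite -oppr0 -(mulr0 x^-1); apply: cvgN; apply: cvgM; first exact: cvg_cst.
  exact: cvg_harmonic.
by move=> h; rewrite -[X in _ --> X]expR0; apply: continuous_cvg; [exact: continuous_expR|exact: h].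
Qed.

Lemma smooth_bump_cvg s t x : smooth_bump n.+1%:R s t x @[n --> \oo] -->
  (if s < x < t then 1 else 0 : R).
Proof.
case: ifPn => [/andP[sx xt]|].
  rewrite /smooth_bump -[X in _ --> X](mulr1 1); apply: cvgM.
    under eq_cvg do rewrite -mulrBr; apply: flat0_cvg; by rewrite subr_gt0.
  under eq_cvg do rewrite -mulrBr; apply: flat0_cvg; by rewrite subr_gt0.
rewrite negb_and -!leNgt => h.
under eq_cvg do rewrite smooth_bump_eq0//; exact: cvg_cst.
Qed.

Lemma test_function_support (a b s t : R) f : a < s -> t < b ->
  (forall n x, derivable (derive1n n f) x 1) ->
  (forall x, (x <= s) || (t <= x) -> f x = 0) -> test_function a b f.
Proof.
move=> as_ tb sf f0.
have sub : closure [set x | f x != 0] `<=` `[s, t].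
  rewrite closureE; apply: smallest_sub; first exact: interval_closed.
  move=> x /=; apply: contraR; rewrite in_itv/= negb_and -!ltNge => h.
  by rewrite f0//; case/orP: h => /ltW ->; rewrite ?orbT.
split=> //.
  apply: (@subclosed_compact _ _ `[s, t]) => //; first exact: closed_closure.
  exact: segment_compact.
move=> x /sub /=; rewrite !in_itv/= => /andP[sx xt].
by rewrite (lt_le_trans as_ sx) (le_lt_trans xt tb).
Qed.

End FlatFunctions.

(** * Weak derivatives in one variable *)

Section WeakDerivative.
Context {R : realType}.
Implicit Types (a b s t c x y : R) (f g u w phi : R -> R).

Lemma ae_neq c : {ae mu, forall x, x != c}.
Proof.
apply: (@negligibleS _ _ _ mu [set c]) => [x /= /negP/negPn/eqP//|].
by apply/negligibleP => //; exact: lebesgue_measure_set1.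
Qed.

(** By Lebesgue differentiation the primitive of [f] has derivative f x at almost every x, while the
    hypothesis makes it constant inside ]a, b[. Cutting [f] off outside [a, b] makes it integrable
    on the line. *)
Lemma ae_zero_of_interval_integrals a b f : a < b -> intg a b f ->
  (forall s t, a < s -> s < t -> t < b -> rint s t f = 0) ->
  {ae mu, forall x, `[a, b]%classic x -> f x = 0}.
Proof.
move=> ab hf h0; pose fab := f \_ `[a, b].
have hfab : mu.-integrable setT (EFin \o fab).
  by rewrite -restrict_EFin; apply/integrable_restrict => //=; rewrite setTI.
have hfc : intg a b fab by apply: integrableS hfab.
have loc : locally_integrable setT fab.
  by apply: open_integrable_locally => //; exact: openT.
have h1 := ae_neq a; have h2 := ae_neq b.
apply: filterS3 h1 h2 (lebesgue_differentiation loc).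
move=> x xa xb lx /=; rewrite in_itv/= => /andP[ax xb'].
have {xa}ax : a < x by rewrite lt_neqAle eq_sym xa.
have {xb xb'}xb : x < b by rewrite lt_neqAle xb.
have [_ dF] := @FTC1_lebesgue_pt R fab (BLeft a) x b xb hfc ax lx.
have <- : fab x = f x by rewrite /fab patchE ifT// inE/= in_itv/= !ltW.
rewrite -dF derive1E.
pose F y := rint a y fab.
have FE s t : a < s -> s <= t -> t < b -> F t = F s.
  move=> as_; rewrite le_eqVlt => /predU1P[->//|st] tb.
  have e : rint s t fab = rint s t f.
    apply: eq_rint => r /andP[sr rt]; rewrite /fab patchE ifT// inE/= in_itv/=.
    by rewrite (le_trans (ltW as_) sr) (le_trans rt (ltW tb)).
  rewrite /F (@rint_split _ a s t) ?ltW//; last exact: intgW (lexx a) (ltW tb) hfc.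
  by rewrite e h0// addr0.
rewrite (@near_eq_derive _ _ _ _ (cst (F x))) ?derive_cst//.
near=> y.
have ay : a < y by near: y; exact: lt_nbhsr.
have yb : y < b by near: y; exact: lt_nbhsl.
by have [xy|/ltW yx] := leP x y; [exact: (FE x y)|rewrite -[LHS]/(F y) -(FE y x)].
Unshelve. all: by end_near. Qed.

Lemma rint_dominated a b (F : nat -> R -> R) f g :
  (forall n, measurable_fun `[a, b] (F n)) -> measurable_fun `[a, b] f ->
  (forall x, a <= x <= b -> F n x @[n --> \oo] --> f x) -> intg a b g ->
  (forall n x, a <= x <= b -> `|F n x| <= g x) ->
  rint a b (F n) @[n --> \oo] --> rint a b f.
Proof.
move=> mF mf Ff hg Fg.
have [] := @dominated_convergence _ _ _ mu `[a, b]%classic (measurable_itv _)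
  (fun n => EFin \o F n) (EFin \o f) (EFin \o g).
- by move=> n; apply/measurable_EFinP; exact: mF.
- exact/measurable_EFinP.
- apply: aeW => x /=; rewrite in_itv/= => xab.
  by apply: cvg_EFin; [exact: nearW|exact: Ff].
- exact: hg.
- by apply: aeW => x n /=; rewrite in_itv/= => xab; rewrite lee_fin Fg.
move=> hf _ h; apply: fine_cvg; rewrite fineK//; exact: integrable_fin_num.
Qed.

Lemma smooth_bump_meas n s t a b : measurable_fun `[a, b] (smooth_bump n s t).
Proof.
apply: measurable_funTS; apply: continuous_measurable_fun.
exact/elementary_continuous/elementary_smooth_bump.
Qed.

Lemma smooth_bump_norm n s t x : `|smooth_bump n s t x| <= 1.
Proof. by have /andP[h1 h2] := smooth_bump_itv n s t x; rewrite ger0_norm. Qed.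

Lemma intg_smooth_bump_mul n s t a b f : intg a b f -> intg a b (fun x => smooth_bump n s t x * f x).
Proof.
apply: (@intg_bounded_mul _ a b 1); first exact: smooth_bump_meas.
by move=> x _; exact: smooth_bump_norm.
Qed.

Lemma intg_smooth_bump n s t a b : intg a b (smooth_bump n s t).
Proof.
apply: (@intg_bounded _ a b 1); first exact: smooth_bump_meas.
by move=> x _; exact: smooth_bump_norm.
Qed.

Lemma smooth_bump_test n s t a b : 0 < n -> a < s -> t < b -> test_function a b (smooth_bump n s t).
Proof.
move=> n0 as_ tb; apply: (test_function_support as_ tb).
  exact/elementary_smooth/elementary_smooth_bump.
by move=> x; exact: smooth_bump_eq0.
Qed.

(** The bumps converge pointwise to the indicator of ]s, t[ and are bounded by 1, so dominated
    convergence turns the hypothesis into vanishing integrals over intervals. *)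
Lemma fundamental_lemma a b f : a < b -> intg a b f ->
  (forall n s t, a < s -> s < t -> t < b ->
     rint a b (fun x => smooth_bump n.+1%:R s t x * f x) = 0) ->
  {ae mu, forall x, `[a, b]%classic x -> f x = 0}.
Proof.
move=> ab hf h0; apply: ae_zero_of_interval_integrals => // s t as_ st tb.
pose chi x : R := if s < x < t then 1 else 0.
have mchi : measurable_fun `[a, b] chi.
  have -> : chi = \1_(`]s, t[).
    by apply/funext => x; rewrite /chi indicE mem_setE in_itv/=; case: ifP.
  exact: measurable_indic.
have mcf : measurable_fun `[a, b] (fun x => chi x * f x).
  by apply: measurable_funM => //; exact: intg_meas.
have hcf : intg a b (fun x => chi x * f x).
  apply: (@intg_bounded_mul _ _ _ 1) => // x _; rewrite /chi.
  by case: ifP; rewrite ?normr1 ?normr0.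
have := @rint_dominated a b (fun n x => smooth_bump n.+1%:R s t x * f x)
  (fun x => chi x * f x) (fun x => `|f x|).
have -> : (fun n : nat => rint a b (fun x => smooth_bump n.+1%:R s t x * f x)) = fun=> 0.
  by apply/funext => n; exact: h0.
move=> dc; have {dc}h : rint a b (fun x => chi x * f x) = 0.
  have h : (fun=> 0 : R) @ \oo --> rint a b (fun x => chi x * f x).
    apply: dc => [n||x _||n x _] //.
    - exact: (intg_meas (intg_smooth_bump_mul _ _ _ hf)).
    - by apply: cvgM; [exact: smooth_bump_cvg|exact: cvg_cst].
    - exact: intg_norm.
    - by rewrite normrM ler_piMl// smooth_bump_norm.
  by apply/esym; apply: (cvg_unique _ (cvg_cst (0 : R)) h).
have [sb at_] := (lt_trans st tb, lt_trans as_ st).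
have hs := intgW (ltW as_) (lexx b) hcf.
rewrite (@rint_split _ a s b) ?ltW// (@rint_split _ s t b) ?ltW// in h.
have e1 : rint a s (fun x => chi x * f x) = 0.
  rewrite (@eq_rint _ a s _ (fun=> 0)) ?rint_cst ?ltW ?mul0r// => x /andP[ax xs].
  by rewrite /chi ltNge xs/= mul0r.
have e2 : rint t b (fun x => chi x * f x) = 0.
  rewrite (@eq_rint _ t b _ (fun=> 0)) ?rint_cst ?ltW ?mul0r// => x /andP[tx xb].
  by rewrite /chi [x < t]ltNge tx andbF mul0r.
rewrite e1 e2 add0r addr0 in h; rewrite -h; apply: ae_eq_rint.
- exact: intgW (ltW as_) (ltW tb) hf.
- exact: intgW (ltW as_) (ltW tb) hcf.
- have h1 := ae_neq s; have h2 := ae_neq t.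
  apply: filterS2 h1 h2 => x xs xt /=.
  rewrite in_itv/= => /andP[sx xt'].
  by rewrite /chi !lt_neqAle eq_sym xs sx xt xt' mul1r.
Qed.

Lemma flat0_mono x y : 0 < x -> x <= y -> flat 0 x <= flat 0 y.
Proof.
move=> x0 xy; have y0 := lt_le_trans x0 xy.
by rewrite /flat x0 y0 !expr0 !mul1r ler_expR lerN2 lef_pV2.
Qed.

Lemma rint_smooth_bump_gt0 a b s t : a <= s -> s < t -> t <= b -> 0 < rint a b (smooth_bump 1 s t).
Proof.
move=> as_ st tb; pose d := (t - s) / 3.
have d0 : 0 < d by rewrite divr_gt0// subr_gt0.
have hb c d' : intg c d' (smooth_bump 1 s t) by exact: intg_smooth_bump.
rewrite (lt_le_trans _ (@rint_nonneg_mono _ a b (s + d) (t - d) _ _ _ _ (hb _ _) _))//.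
- have h : s + d < t - d by rewrite /d; lra.
  have m0 : 0 < flat 0 d ^+ 2 by have /andP[fd _] := flat0_gt0 d0; rewrite exprn_gt0.
  rewrite (lt_le_trans _ (@rint_le _ _ _ (fun=> flat 0 d ^+ 2) _ _ _ _))//.
  + by rewrite rint_cst ?ltW// mulr_gt0// subr_gt0.
  + exact: intg_cst.
  + move=> x /andP[h1 h2]; rewrite /smooth_bump !mul1r expr2.
    by rewrite ler_pM ?flat_ge0// flat0_mono//; lra.
- lra.
- by rewrite /d; lra.
- lra.
- by move=> x _; have /andP[] := smooth_bump_itv 1 s t x.
Qed.

Lemma rint_gt a s f : s < a -> rint a s f = 0.
Proof.
move=> sa; rewrite /rint set_itv_ge ?Rintegral_set0//.
by rewrite bnd_simp -ltNge.
Qed.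

(** Subtracting from a bump [psi] the multiple of a fixed bump [eta] with the same integral leaves a
    function of zero mean, whose primitive [phi] is a test function. The hypothesis on phi then says
    that w - c is orthogonal to psi, where c is the mean of w weighted by eta. *)
Lemma du_bois_reymond a b w : a < b -> intg a b w ->
  (forall phi, test_function a b phi -> rint a b (fun x => derive1 phi x * w x) = 0) ->
  exists c, {ae mu, forall x, `[a, b]%classic x -> w x = c}.
Proof.
move=> ab hw H; pose d := (b - a) / 3; pose s0 := a + d; pose t0 := b - d.
have d0 : 0 < d by rewrite divr_gt0// subr_gt0.
have [as0 st0 t0b] : [/\ a < s0, s0 < t0 & t0 < b].
  by rewrite /s0 /t0 /d; split; lra.
pose eta := smooth_bump 1 s0 t0; pose I0 := rint a b eta.
have I00 : 0 < I0 by apply: rint_smooth_bump_gt0; rewrite ?ltW.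
exists (rint a b (fun x => eta x * w x) / I0).
set c := _ / I0.
suff : {ae mu, forall x, `[a, b]%classic x -> w x - c = 0}.
  apply: filterS => x h xab.
  by apply/eqP; rewrite -subr_eq0; apply/eqP; exact: h.
apply: fundamental_lemma => //; first by apply: intgB => //; exact: intg_cst.
move=> n s t as_ st tb; pose psi := smooth_bump n.+1%:R s t.
pose c' := rint a b psi / I0.
pose theta x := psi x + - c' * eta x.
have etheta : elementary theta.
  apply: elementaryD; first exact: elementary_smooth_bump.
  by apply: elementaryM; [exact: elementary_cst|exact: elementary_smooth_bump].
have htheta p q : intg p q theta by apply: intgD; [|apply: intgZ]; exact: intg_smooth_bump.
pose sg := Num.min s s0; pose tu := Num.max t t0.
have asg : a < sg by rewrite lt_min as_.
have tub : tu < b by rewrite gt_max tb.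
have sgtu : sg < tu by rewrite lt_max !gt_min st.
have theta0 x : (x <= sg) || (tu <= x) -> theta x = 0.
  rewrite /theta /psi /eta => /orP[].
    by rewrite le_min => /andP[xs xs0]; rewrite !smooth_bump_eq0 ?xs ?xs0// mulr0 addr0.
  by rewrite ge_max => /andP[xs xs0]; rewrite !smooth_bump_eq0 ?xs ?xs0 ?orbT// mulr0 addr0.
have Itheta : rint a b theta = 0.
  rewrite rintD; [|exact: intg_smooth_bump|by apply: intgZ; exact: intg_smooth_bump].
  rewrite rintZ; last exact: intg_smooth_bump.
  by rewrite -/I0 /c' mulNr divfK ?gt_eqF// subrr.
pose phi y := rint a y theta.
have phi_left y : y <= sg -> phi y = 0.
  move=> ys; have [ay|ya] := leP a y; last exact: rint_gt.
  rewrite /phi (@eq_rint _ a y _ (fun=> 0)) ?rint_cst ?mul0r// => x /andP[_ xy].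
  by rewrite theta0// (le_trans xy ys).
have phi_right y : tu <= y -> phi y = 0.
  have K z : tu <= z -> phi z = phi tu.
    move=> tz; rewrite /phi (@rint_split _ a tu z)//; last first.
      by rewrite ltW// (lt_trans asg).
    rewrite [X in _ + X](_ : _ = 0) ?addr0//.
    rewrite (@eq_rint _ tu z _ (fun=> 0)) ?rint_cst ?mul0r// => x /andP[tx _].
    by rewrite theta0// tx orbT.
  by move=> /K ->; rewrite -(K b) ?ltW.
have dphi x : is_derive x 1 phi (theta x).
  have [xs|sx] := ltP x sg.
    suff d0x : is_derive x 1 (fun=> 0 : R) (theta x).
      apply: near_eq_is_derive d0x; near=> y; rewrite phi_left// ltW//.
      by near: y; exact: lt_nbhsl.
    by rewrite theta0 ?(ltW xs)//; exact: is_derive_cst.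
  have xx : x < x + 1 by rewrite ltrDl.
  have [dF FE] := continuous_FTC1_closed xx (htheta a (x + 1)) (lt_le_trans asg sx)
    (@elementary_continuous _ _ etheta x).
  by apply: DeriveDef; [exact: dF|rewrite -[RHS]FE derive1E].
have phi'E : derive1 phi = theta.
  by apply/funext => x; rewrite derive1E; have [] := dphi x.
have tphi : test_function a b phi.
  apply: (test_function_support asg tub) => [[|m] x|x /orP[/phi_left|/phi_right]//].
    by have [] := dphi x.
  by rewrite /derive1n iterSr phi'E; exact: elementary_smooth.
have := H phi tphi; rewrite phi'E.
have hp : intg a b (fun x => psi x * w x) by exact: intg_smooth_bump_mul.
have he : intg a b (fun x => eta x * w x) by exact: intg_smooth_bump_mul.
rewrite (@eq_rint _ _ _ _ (fun x => psi x * w x - c' * (eta x * w x))); last first.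
  by move=> x _; rewrite /theta; ring.
rewrite rintB//; last exact: intgZ.
rewrite rintZ// => e.
rewrite (@eq_rint _ _ _ _ (fun x => psi x * w x - c * psi x)); last first.
  by move=> x _; rewrite mulrBr [psi x * c]mulrC.
rewrite rintB//; last by apply: intgZ; exact: intg_smooth_bump.
rewrite rintZ; last exact: intg_smooth_bump.
by move: e; rewrite /c' /c mulrAC [rint a b psi * _]mulrC mulrAC.
Unshelve. all: by end_near. Qed.

Lemma test_function_ac a b phi : a <= b -> test_function a b phi ->
  [/\ ac a b phi (derive1 phi), phi a = 0 & phi b = 0].
Proof.
move=> ab [sm _ sub]; split.
- apply: ac_deriv => // [t|t].
    by rewrite derive1E; apply: derivableP; exact: (sm 0%N).
  exact/differentiable_continuous/derivable1_diffP/(sm 1%N).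
- apply/eqP; apply: contraT => h; have /sub : closure [set t | phi t != 0] a.
    exact: subset_closure.
  by rewrite /= in_itv/= ltxx.
- apply/eqP; apply: contraT => h; have /sub : closure [set t | phi t != 0] b.
    exact: subset_closure.
  by rewrite /= in_itv/= ltxx andbF.
Qed.

Lemma ac_weak_derivative a b f g phi : a <= b -> ac a b f g -> test_function a b phi ->
  rint a b (fun t => derive1 phi t * f t) = - rint a b (fun t => phi t * g t).
Proof.
move=> ab hf /(test_function_ac ab)[hphi pa pb].
have [_ /(_ b)] := ac_mul ab hphi hf.
rewrite ab lexx pa pb !mul0r add0r => /(_ isT).
have h1 : intg a b (fun t => phi t * g t) by exact: ac_intg_mul hphi hf.1.
have h2 : intg a b (fun t => derive1 phi t * f t).
  by under [X in intg _ _ X]eq_fun do rewrite mulrC; exact: ac_intg_mul hf hphi.1.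
by rewrite rintD// => /esym/eqP; rewrite addrC addr_eq0 => /eqP.
Qed.

(** By integration by parts, u minus the primitive of g has weak derivative zero, hence is constant
    by [du_bois_reymond]. *)
Lemma weak_derivative_ac a b u g : a < b -> intg a b u -> intg a b g ->
  (forall phi, test_function a b phi ->
     rint a b (fun t => derive1 phi t * u t) = - rint a b (fun t => phi t * g t)) ->
  exists2 f, ac a b f g & {ae mu, forall t, `[a, b]%classic t -> f t = u t}.
Proof.
move=> ab hu hg H; have hv := ac_primitive hg.
have [c hc] : exists c, {ae mu, forall x, `[a, b]%classic x -> u x - rint a x g = c}.
  apply: du_bois_reymond => //.
    by apply: intgB => //; exact: ac_intg (ltW ab) hv.
  move=> phi tphi; have [hphi _ _] := test_function_ac (ltW ab) tphi.
  rewrite (@eq_rint _ _ _ _ (fun x => derive1 phi x * u x - derive1 phi x * rint a x g));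
    last by move=> x _; rewrite mulrBr.
  have [phis _ _] := tphi.
  have cphi' : continuous (derive1 phi).
    by move=> t; exact/differentiable_continuous/derivable1_diffP/(phis 1%N).
  have [M [_ HM]] : bounded_set (derive1 phi @` `[a, b]).
    apply: compact_bounded; apply: continuous_compact; last exact: segment_compact.
    exact: continuous_subspaceT.
  have ip f : intg a b f -> intg a b (fun x => derive1 phi x * f x).
    apply: (@intg_bounded_mul _ _ _ (M + 1)).
      by apply: measurable_funTS; exact: continuous_measurable_fun.
    move=> t tab; apply: (HM (M + 1)); first by rewrite ltrDl.
    by exists t => //=; rewrite in_itv.
  rewrite rintB; [|exact: ip|by apply: ip; exact: ac_intg (ltW ab) hv].
  by rewrite H// (ac_weak_derivative (ltW ab) hv tphi) subrr.
exists (fun t => c + rint a t g).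
  by have := acD (ac_cst a b c) hv; under [X in ac _ _ _ X]eq_fun do rewrite add0r.
by apply: filterS hc => t h /h <-; rewrite subrK.
Qed.

Lemma weak_derivative_unique a b g g' : a < b -> intg a b g -> intg a b g' ->
  (forall phi, test_function a b phi ->
     rint a b (fun t => phi t * g t) = rint a b (fun t => phi t * g' t)) ->
  {ae mu, forall t, `[a, b]%classic t -> g t = g' t}.
Proof.
move=> ab hg hg' H.
suff : {ae mu, forall t, `[a, b]%classic t -> g t - g' t = 0}.
  apply: filterS => x h xab.
  by apply/eqP; rewrite -subr_eq0; apply/eqP; exact: h.
apply: fundamental_lemma => //; first exact: intgB.
move=> n s t as_ st tb.
rewrite (@eq_rint _ _ _ _ (fun x => smooth_bump n.+1%:R s t x * g x - smooth_bump n.+1%:R s t x * g' x));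
    last by move=> x _; rewrite mulrBr.
rewrite rintB; [|exact: intg_smooth_bump_mul..].
by rewrite H ?subrr//; exact: smooth_bump_test.
Qed.

End WeakDerivative.

(** * Vectors and square-integrable functions *)

Section Coordinates.
Context {k : scalar_kind} {R : realType}.
Local Notation K := (scalar_field k R).

(* p = (false, i) and p = (true, i) index the real and the imaginary part of the
   i-th component. *)
Definition co m (p : bool * 'I_m) (v : 'cV[K]_m) : R :=
  if p.1 then im (v p.2 0) else re (v p.2 0).

(** The real matrix with rows of blocks (Re M, - Im M) and (Im M, Re M), through which M acts on the
    coordinates [co]. *)
Definition mc m n (M : 'M[K]_(m, n)) (p : bool * 'I_m) (q : bool * 'I_n) : R :=
  if p.1 (+) q.1 then (if p.1 then im (M p.2 q.2) else - im (M p.2 q.2))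
  else re (M p.2 q.2).

Definition dot m (u v : 'cV[K]_m) : R := \sum_p co p u * co p v.

(** An entrywise norm: its increments along [H] are controlled by the scalar variation functions of
    the entries. *)
Definition mnorm m n (M : 'M[K]_(m, n)) : R := \sum_p \sum_q `|mc M p q|.

Lemma sum_pairE m (F : bool * 'I_m -> R) :
  \sum_p F p = \sum_i F (false, i) + \sum_i F (true, i).
Proof.
rewrite (eq_bigr (fun p => F (p.1, p.2))); last by case.
rewrite -(pair_bigA _ (fun x i => F (x, i)))/=.
by rewrite big_bool addrC.
Qed.

Section Vectors.
Context {m : nat}.
Implicit Types (u v w : 'cV[K]_m) (p : bool * 'I_m) (c r : R).

Lemma co0 p : co p (0 : 'cV[K]_m) = 0.
Proof. by rewrite /co !mxE re0 im0; case: ifP. Qed.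

Lemma coD p u v : co p (u + v) = co p u + co p v.
Proof. by rewrite /co !mxE; case: ifP => _; rewrite ?reD ?imD. Qed.

Lemma coN p v : co p (- v) = - co p v.
Proof. by rewrite /co !mxE; case: ifP => _; rewrite ?reN ?imN. Qed.

Lemma coB p u v : co p (u - v) = co p u - co p v.
Proof. by rewrite coD coN. Qed.

Lemma coZr p r v : co p (of_real r *: v) = r * co p v.
Proof.
rewrite /co !mxE; case: ifP => _; rewrite ?reM ?imM re_of_real im_of_real mul0r.
  by rewrite addr0.
by rewrite subr0.
Qed.

Lemma co_inj u v : (forall p, co p u = co p v) -> u = v.
Proof.
move=> h; apply/matrixP => i j; rewrite (ord1 j); apply: re_im_eq.
  exact: (h (false, i)).
exact: (h (true, i)).
Qed.

Lemma sqnorm_dot v : sqnorm v = dot v v.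
Proof.
rewrite /sqnorm /dot big_split/= sum_pairE.
by congr (_ + _); apply: eq_bigr => i _; rewrite expr2.
Qed.

Lemma vnorm_dot v : vnorm v ^+ 2 = dot v v.
Proof. by rewrite vnorm_sqr sqnorm_dot. Qed.

Lemma vnorm_ge0 v : 0 <= vnorm v.
Proof. exact: sqrtr_ge0. Qed.

Lemma dot_ge0 v : 0 <= dot v v.
Proof. by rewrite -sqnorm_dot sqnorm_ge0. Qed.

Lemma dotC u v : dot u v = dot v u.
Proof. by apply: eq_bigr => p _; rewrite mulrC. Qed.

Lemma dotDl u v w : dot (u + v) w = dot u w + dot v w.
Proof. by rewrite -big_split; apply: eq_bigr => p _; rewrite coD mulrDl. Qed.

Lemma dotDr u v w : dot w (u + v) = dot w u + dot w v.
Proof. by rewrite dotC dotDl !(dotC w). Qed.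

Lemma dotNl u v : dot (- u) v = - dot u v.
Proof. by rewrite /dot -sumrN; apply: eq_bigr => p _; rewrite coN mulNr. Qed.

Lemma dotNr u v : dot u (- v) = - dot u v.
Proof. by rewrite dotC dotNl dotC. Qed.

Lemma dotBl u v w : dot (u - v) w = dot u w - dot v w.
Proof. by rewrite dotDl dotNl. Qed.

Lemma dotBr u v w : dot w (u - v) = dot w u - dot w v.
Proof. by rewrite dotDr dotNr. Qed.

Lemma dotZl r u v : dot (of_real r *: u) v = r * dot u v.
Proof. by rewrite /dot mulr_sumr; apply: eq_bigr => p _; rewrite coZr mulrA. Qed.

Lemma dotZr r u v : dot u (of_real r *: v) = r * dot u v.
Proof. by rewrite dotC dotZl dotC. Qed.

Lemma dot_scale (c : K) u v :
  dot (c *: u) (c *: v) = (re c ^+ 2 + im c ^+ 2) * dot u v.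
Proof.
rewrite /dot !sum_pairE mulrDr !mulr_sumr -!big_split; apply: eq_bigr => i _.
by rewrite /co/= !mxE !reM !imM; ring.
Qed.

Lemma co_le_vnorm p v : `|co p v| <= vnorm v.
Proof.
rewrite -sqrtr_sqr ler_wsqrtr// sqnorm_dot /dot (bigD1 p)//= expr2 lerDl.
by apply: sumr_ge0 => q _; rewrite -expr2 sqr_ge0.
Qed.

Lemma vnorm_eq0 v : vnorm v = 0 -> v = 0.
Proof.
move=> v0; apply: co_inj => p; rewrite co0; apply/eqP.
by rewrite -normr_le0 (le_trans (co_le_vnorm p v))// v0.
Qed.

Lemma sqr_vnormB u v : dot (u - v) (u - v) = dot u u - 2 * dot u v + dot v v.
Proof. by rewrite dotBl !dotBr (dotC v u); ring. Qed.

End Vectors.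

Lemma co_mulmx m n (M : 'M[K]_(m, n)) (v : 'cV[K]_n) p :
  co p (M *m v) = \sum_q mc M p q * co q v.
Proof.
case: p => x i; rewrite sum_pairE -big_split/= /co !mxE/=.
case: x; rewrite ?re_sum ?im_sum; apply: eq_bigr => j _; rewrite /mc/=.
  by rewrite imM addrC.
by rewrite reM mulNr.
Qed.

Lemma mcB m n (M M' : 'M[K]_(m, n)) p q : mc (M - M') p q = mc M p q - mc M' p q.
Proof.
rewrite /mc !mxE; case: p q => [[] i] [[] j]/=; rewrite ?reB ?imB//.
by rewrite opprB addrC opprK.
Qed.

Lemma dot_mulmxE m n (u : 'cV[K]_m) (M : 'M[K]_(m, n)) (v : 'cV[K]_n) :
  dot u (M *m v) = \sum_p \sum_q mc M p q * (co p u * co q v).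
Proof.
apply: eq_bigr => p _; rewrite co_mulmx mulr_sumr; apply: eq_bigr => q _.
by rewrite mulrCA.
Qed.

Lemma mnorm_ge0 m n (M : 'M[K]_(m, n)) : 0 <= mnorm M.
Proof. by apply: sumr_ge0 => p _; apply: sumr_ge0. Qed.

Lemma dot_mulmx_le m n (u : 'cV[K]_m) (M : 'M[K]_(m, n)) (v : 'cV[K]_n) :
  `|dot u (M *m v)| <= mnorm M * (vnorm u * vnorm v).
Proof.
rewrite dot_mulmxE (le_trans (ler_norm_sum _ _ _))// /mnorm mulr_suml.
apply: ler_sum => p _; rewrite (le_trans (ler_norm_sum _ _ _))// mulr_suml.
apply: ler_sum => q _; rewrite !normrM ler_wpM2l//.
by rewrite ler_pM// co_le_vnorm.
Qed.

Lemma vnorm_mulmx_le m n (M : 'M[K]_(m, n)) (v : 'cV[K]_n) :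
  vnorm (M *m v) <= mnorm M * vnorm v.
Proof.
have [->|/eqP n0] := eqVneq (vnorm (M *m v)) 0.
  by rewrite mulr_ge0 ?mnorm_ge0 ?vnorm_ge0.
have n0' : 0 < vnorm (M *m v) by rewrite lt_neqAle vnorm_ge0 eq_sym andbT; exact/eqP.
rewrite -(ler_pM2l n0') -expr2 vnorm_dot.
have := dot_mulmx_le (M *m v) M v.
by move=> /(le_trans (ler_norm _)); rewrite mulrCA.
Qed.

Lemma cconjM (z w : K) : cconj (z * w) = cconj z * cconj w.
Proof. by apply: re_im_eq; rewrite ?re_cconj ?im_cconj ?reM ?imM ?re_cconj ?im_cconj; ring. Qed.

Lemma cconj_sum I (r : seq I) (P : pred I) (F : I -> K) :
  cconj (\sum_(i <- r | P i) F i) = \sum_(i <- r | P i) cconj (F i).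
Proof.
apply: re_im_eq; rewrite ?re_cconj ?im_cconj ?re_sum ?im_sum.
  by apply: eq_bigr => i _; rewrite re_cconj.
by rewrite -sumrN; apply: eq_bigr => i _; rewrite im_cconj.
Qed.

Lemma adjmx_mul m n l (M : 'M[K]_(m, n)) (M' : 'M[K]_(n, l)) :
  adjmx (M *m M') = adjmx M' *m adjmx M.
Proof.
apply/matrixP => i j; rewrite !mxE cconj_sum; apply: eq_bigr => q _.
by rewrite !mxE cconjM mulrC.
Qed.

Lemma dotE m (u v : 'cV[K]_m) : re ((adjmx u *m v) 0 0) = dot u v.
Proof.
rewrite mxE re_sum /dot sum_pairE -big_split; apply: eq_bigr => i _.
by rewrite !mxE reM re_cconj im_cconj /co/= mulNr opprK.
Qed.

Lemma dot_adj m n (u : 'cV[K]_m) (M : 'M[K]_(m, n)) (v : 'cV[K]_n) :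
  dot u (M *m v) = dot (adjmx M *m u) v.
Proof.
suff adjK : adjmx (adjmx M) = M by rewrite -!dotE adjmx_mul adjK mulmxA.
apply/matrixP => i j; rewrite !mxE; apply: re_im_eq.
  by rewrite !re_cconj.
by rewrite !im_cconj opprK.
Qed.

Lemma dot_selfadj m (M : 'M[K]_m) (u v : 'cV[K]_m) : adjmx M = M ->
  dot u (M *m v) = dot (M *m u) v.
Proof. by move=> h; rewrite dot_adj h. Qed.

Lemma dot_skew m (M : 'M[K]_m) (u : 'cV[K]_m) : adjmx M = - M ->
  dot u (M *m u) = 0.
Proof.
move=> h; have := dot_adj u M u; rewrite h mulNmx dotNl (dotC (M *m u)); lra.
Qed.

Definition mkvec m (f : bool * 'I_m -> R) : 'cV[K]_m :=
  \col_i mkscalar (f (false, i)) (f (true, i)).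

(** For real scalars [mkscalar] discards its second argument, hence the condition on the imaginary
    coordinates. *)
Lemma co_mkvec m (f : bool * 'I_m -> R) p :
  (forall i, f (true, i) = 0) \/ k = ComplexScalars -> co p (mkvec f) = f p.
Proof.
rewrite /co /mkvec !mxE /re /im /mkscalar; case: p => x i.
case: k => -[f0//|//]; case: x => //=; by rewrite f0.
Qed.

Lemma co_real m (v : 'cV[K]_m) i : k = RealScalars -> co (true, i) v = 0.
Proof. by rewrite /co/= /im; case: k v. Qed.

Lemma co_mkvec_of m (f : bool * 'I_m -> R) p :
  (k = RealScalars -> forall i, f (true, i) = 0) -> co p (mkvec f) = f p.
Proof.
move=> h; apply: co_mkvec; case: k h => h; last by right.
by left; exact: h.
Qed.

Lemma co_mxintegral m (D : set R) (F : R -> 'cV[K]_m) p :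
  co p (mxintegral D F) = \int[lebesgue_measure]_(t in D) co p (F t).
Proof.
rewrite (_ : mxintegral D F =
    mkvec (fun q => \int[lebesgue_measure]_(t in D) co q (F t))); last first.
  by apply/matrixP => i j; rewrite !mxE (ord1 j).
rewrite co_mkvec_of// => kR i.
under eq_Rintegral do rewrite co_real//.
by rewrite /Rintegral integral0.
Qed.

End Coordinates.

Lemma half_of_real (k : scalar_kind) (R : realType) : 2^-1 = of_real 2^-1 :> scalar_field k R.
Proof.
have h : of_real 2 = 2 :> scalar_field k R.
  by rewrite -[2 in LHS](_ : 1 + 1 = _)// of_realD of_real1.
apply: (@mulfI (scalar_field k R) 2); first by rewrite pnatr_eq0.
by rewrite divff ?pnatr_eq0// -{1}h -of_realM divff ?pnatr_eq0// of_real1.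
Qed.

(** * Square-integrable functions and the Riesz-Fischer theorem *)

Section ScalarL2.
Context {R : realType}.
Implicit Types (a b s t c x y : R) (f g u w : R -> R).

Definition l2 a b f := measurable_fun `[a, b] f /\ intg a b (fun t => f t ^+ 2).

Lemma intg_le a b f g : measurable_fun `[a, b] f ->
  (forall t, a <= t <= b -> `|f t| <= g t) -> intg a b g -> intg a b f.
Proof.
move=> mf fg hg; apply: le_integrable hg => //.
  exact/measurable_EFinP.
move=> t /=; rewrite in_itv/= => tab; rewrite lee_fin (le_trans (fg t tab))//.
exact: ler_norm.
Qed.

Lemma l2_mul a b f g : l2 a b f -> l2 a b g -> intg a b (fun t => f t * g t).
Proof.
move=> [mf hf] [mg hg].
apply: (@intg_le _ _ _ (fun t => f t ^+ 2 + g t ^+ 2)).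
- exact: measurable_funM.
- move=> t _; rewrite normrM; have := sqr_ge0 (`|f t| - `|g t|).
  have := sqr_ge0 (`|f t|); have := sqr_ge0 (`|g t|).
  rewrite -(real_normK (num_real (f t))) -(real_normK (num_real (g t))).
  set p := `|f t|; set q := `|g t|; nra.
- exact: intgD.
Qed.

Lemma l2_cst a b c : l2 a b (fun=> c).
Proof. by split; [exact: measurable_cst|exact: intg_cst]. Qed.

Lemma l2_intg a b f : l2 a b f -> intg a b f.
Proof.
move=> hf; have := l2_mul hf (l2_cst a b 1).
by under [X in intg _ _ X]eq_fun do rewrite mulr1.
Qed.

Lemma l2D a b f g : l2 a b f -> l2 a b g -> l2 a b (fun t => f t + g t).
Proof.
move=> hf hg; split; first by apply: measurable_funD; [exact: hf.1|exact: hg.1].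
under [X in intg _ _ X]eq_fun do rewrite sqrrD -mulr_natl.
apply: intgD; last exact: hg.2.
by apply: intgD; [exact: hf.2|apply: intgZ; exact: l2_mul].
Qed.

Lemma l2Z a b c f : l2 a b f -> l2 a b (fun t => c * f t).
Proof.
move=> hf; split; first by apply: measurable_funM; [exact: measurable_cst|exact: hf.1].
under [X in intg _ _ X]eq_fun do rewrite exprMn.
by apply: intgZ; exact: hf.2.
Qed.

Lemma l2B a b f g : l2 a b f -> l2 a b g -> l2 a b (fun t => f t - g t).
Proof.
move=> hf /(l2Z (-1)) hg; have := l2D hf hg.
by under eq_fun do rewrite mulN1r.
Qed.

Lemma l2_sum I (r : seq I) (P : pred I) a b (F : I -> R -> R) :
  (forall i, P i -> l2 a b (F i)) -> l2 a b (fun t => \sum_(i <- r | P i) F i t).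
Proof.
move=> hF; elim: r => [|i r IH].
  by under [X in l2 _ _ X]eq_fun do rewrite big_nil; exact: l2_cst.
under [X in l2 _ _ X]eq_fun do rewrite big_cons.
by have [Pi|//] := boolP (P i); apply: l2D => //; exact: hF.
Qed.

Lemma l2_bounded_mul a b M f g : measurable_fun `[a, b] f ->
  (forall t, a <= t <= b -> `|f t| <= M) -> l2 a b g -> l2 a b (fun t => f t * g t).
Proof.
move=> mf fM [mg hg]; split; first exact: measurable_funM.
under [X in intg _ _ X]eq_fun do rewrite exprMn.
apply: (@intg_bounded_mul _ _ _ (M ^+ 2)) => //; first exact: measurable_funX.
by move=> t tab; rewrite normrX lerXn2r// ?nnegrE ?fM// (le_trans _ (fM t tab)).
Qed.

Lemma eq_l2 a b f g : (forall t, a <= t <= b -> f t = g t) -> l2 a b f -> l2 a b g.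
Proof.
move=> fg [mf hf]; split.
  apply: eq_measurable_fun mf => t; rewrite inE/= in_itv/=; exact: fg.
by apply: eq_intg hf => t tab; rewrite fg.
Qed.

Lemma l2_ac a b f f' : a <= b -> ac a b f f' -> l2 a b f.
Proof.
move=> ab hf; have [M _ fM] := ac_bounded hf.
have := l2_bounded_mul (ac_meas ab hf) fM (l2_cst a b 1).
by under [X in l2 _ _ X]eq_fun do rewrite mulr1.
Qed.

Lemma rint_eq0_ae a b f : intg a b f -> (forall t, a <= t <= b -> 0 <= f t) ->
  rint a b f = 0 -> {ae mu, forall t, `[a, b]%classic t -> f t = 0}.
Proof.
move=> hf f0 i0.
have mf : measurable_fun `[a, b] (EFin \o f) by exact: measurable_int hf.
have : (\int[mu]_(x in `[a, b]) `|(EFin \o f) x|)%E = 0%E.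
  transitivity (\int[mu]_(x in `[a, b]) (f x)%:E)%E.
    apply: eq_integral => x; rewrite inE/= in_itv/= => xab.
    by rewrite ger0_norm// f0.
  rewrite -[LHS]fineK ?(integrable_fin_num _ hf)//.
  by rewrite -[fine _]/(rint a b f) i0.
move=> /(ae_eq_integral_abs mu (measurable_itv _) mf).
apply: filterS => t h /h.
by move=> /= [].
Qed.

Lemma intg_ae_le a b f g : measurable_fun `[a, b] f ->
  {ae mu, forall t, `[a, b]%classic t -> `|f t| <= g t} -> intg a b g -> intg a b f.
Proof.
move=> mf fg hg; apply/integrableP; split; first exact/measurable_EFinP.
have /integrableP[mg] := intg_norm hg; apply: le_lt_trans.
apply: ae_ge0_le_integral => //.
- by apply: measurableT_comp => //; exact/measurable_EFinP.
- by apply: measurableT_comp.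
- apply: filterS fg => t h /h fgt /=.
  by rewrite lee_fin normr_id (le_trans fgt)// ler_norm.
Qed.

(** Cauchy-Schwarz with the weights 2^i, whose inverses sum to at most 2. *)
Lemma telescope_sqr_le (u : nat -> R) n m :
  (u (n + m)%N - u n) ^+ 2 <=
  2 * \sum_(0 <= i < m) 2 ^+ i * (u (n + i).+1 - u (n + i)%N) ^+ 2.
Proof.
elim: m n => [|m IH] n; first by rewrite big_nil mulr0 addn0 subrr expr0n.
have := IH n.+1; rewrite addSnnS big_nat_recl//= expr0 mul1r addn0.
under [X in _ -> _ <= _ * (_ + X)]eq_bigr do rewrite exprS addnS -mulrA.
rewrite -mulr_sumr; set s := \sum_(0 <= i < m) _.
set x := u (n + m.+1)%N; set y := u n.+1; set z := u n => h.
have : 0 <= (x - y - (y - z)) ^+ 2 by exact: sqr_ge0.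
nra.
Qed.

Lemma geometric_cauchy_bound (u : nat -> R) c :
  (forall n, \sum_(0 <= j < n) 2 ^+ j * (u j.+1 - u j) ^+ 2 <= c) ->
  forall n m, (u (n + m)%N - u n) ^+ 2 <= 2 * 2 ^- n * c.
Proof.
move=> ug n m; rewrite (le_trans (telescope_sqr_le u n m))// -mulrA ler_pM2l//.
rewrite mulrC ler_pdivlMr ?exprn_gt0// mulrC.
rewrite (le_trans _ (ug (n + m)%N))// mulr_sumr.
rewrite [leRHS](@big_cat_nat _ _ _ n)//= ?leq_addr// -[leLHS]add0r lerD//.
  by apply: sumr_ge0 => j _; rewrite mulr_ge0 ?sqr_ge0// exprn_ge0.
rewrite -[in leRHS](add0n n) big_addn add0n addKn le_eqVlt; apply/orP; left; apply/eqP.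
by apply: eq_bigr => i _; rewrite [(i + n)%N]addnC exprD mulrA.
Qed.

Lemma cvg_of_cauchy_bound (u : nat -> R) c :
  (forall n m, (u (n + m)%N - u n) ^+ 2 <= 2 * 2 ^- n * c) -> cvg (u @ \oo).
Proof.
move=> ug; apply: R_complete; apply: cauchy_exP => e e0.
have := @cvg_geom2 R (2 * c); move/cvgr0Pnorm_lt => /(_ (e ^+ 2)).
rewrite exprn_gt0// => /(_ isT)[n _ /(_ n (leqnn n))/= hn].
exists (u n); exists n => // k /= nk; rewrite /ball/= distrC -(subnKC nk).
rewrite -ltr_sqr ?nnegrE ?(ltW e0)// real_normK ?num_real//.
rewrite (le_lt_trans (ug _ _))// (le_lt_trans _ hn)// mulrAC.
exact: ler_norm.
Qed.

(** The sum G of the 2^j (f_(j+1) - f_j)^2 has integral at most 2 C, since the weights 2^j leave a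
    factor 2^-j of the rate 4^-j. Where G is finite, [geometric_cauchy_bound] gives convergence with
    squared error at most 2 2^-n G, and integrating this yields the estimate. *)
Lemma riesz_fischer a b (f : nat -> R -> R) (C : R) :
  (forall n, l2 a b (f n)) ->
  (forall n, rint a b (fun t => (f n.+1 t - f n t) ^+ 2) <= C * 4 ^- n) ->
  exists2 F, l2 a b F & exists C' : R, forall n,
    rint a b (fun t => (f n t - F t) ^+ 2) <= C' * 2 ^- n.
Proof.
move=> hf hC.
pose w j t := 2 ^+ j * (f j.+1 t - f j t) ^+ 2.
have w0 j t : 0 <= w j t by rewrite mulr_ge0 ?sqr_ge0// exprn_ge0.
have hw j : intg a b (w j) by apply: intgZ; exact: (l2B (hf _) (hf _)).2.
have mw j : measurable_fun `[a, b] (EFin \o w j) by exact: measurable_int (hw j).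
pose G t : \bar R := (\sum_(0 <= j <oo) (EFin \o w j) t)%E.
have G0 t : (0 <= G t)%E by apply: nneseries_ge0 => j _ _; rewrite lee_fin.
have iw j : (\int[mu]_(t in `[a, b]) (EFin \o w j) t)%E = (rint a b (w j))%:E.
  rewrite /rint /Rintegral fineK//; apply: integrable_fin_num => //; exact: hw.
have iG : (\int[mu]_(t in `[a, b]) G t <= (2 * C)%:E)%E.
  rewrite integral_nneseries//; last by move=> j t _; rewrite lee_fin.
  apply: lime_le.
    by apply: is_cvg_nneseries => j _ _; apply: integral_ge0 => t _; rewrite lee_fin.
  apply: nearW => n.
  rewrite (eq_bigr (fun j => (rint a b (w j))%:E)); last by move=> j _; exact: iw.
  rewrite sumEFin lee_fin (@le_trans _ _ (2 * C * (1 - 2 ^- n)))//; last first.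
    have : 0 <= C.
      have := hC 0%N; rewrite expr0 invr1 mulr1; apply: le_trans.
      by apply: rint_ge0 => t _; exact: sqr_ge0.
    have : 0 < 2 ^- n :> R by rewrite invr_gt0 exprn_gt0.
    nra.
  elim: n => [|n IH]; first by rewrite big_nil expr0 invr1 subrr mulr0.
  rewrite big_nat_recr//= (le_trans (lerD IH (_ : _ <= C * 2 ^- n)))//.
    rewrite /w rintZ; last exact: (l2B (hf _) (hf _)).2.
    rewrite (le_trans (ler_wpM2l _ (hC n)))// ?exprn_ge0//.
    rewrite (_ : 4 = 2 * 2) ?exprMn ?invfM; last by ring.
    have xn0 : 2 ^+ n != 0 :> R by rewrite expf_neq0.
    by have -> : 2 ^+ n * (C * (2 ^- n / 2 ^+ n)) = C / 2 ^+ n by field.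
  by rewrite exprS invfM; lra.
have mG : measurable_fun `[a, b] G.
  have := @ge0_emeasurable_sum _ _ R `[a, b]%classic (fun j => EFin \o w j) xpredT.
  by apply => // j t _ _; rewrite lee_fin.
have hG : mu.-integrable `[a, b] G.
  apply/integrableP; split => //.
  under eq_integral do rewrite gee0_abs//.
  by rewrite (le_lt_trans iG)// ltry.
pose g t := fine (G t).
have g0 t : 0 <= g t by rewrite fine_ge0.
have mg : measurable_fun `[a, b] g.
  by apply: (@measurableT_comp _ _ _ _ _ _ fine) => //; exact: fine_measurable.
have hg : intg a b g.
  apply: le_integrable hG => //; first exact/measurable_EFinP.
  move=> t _ /=; rewrite ger0_norm// gee0_abs// /g.
  by have := G0 t; case: (G t) => //= r; rewrite leey.
(* A limit superior, so that F is measurable without restricting to the set of convergence; almost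
   everywhere it is the limit. *)
pose F t := fine (limn_esup (fun n => (f n t)%:E)).
have mF : measurable_fun `[a, b] F.
  apply: (@measurableT_comp _ _ _ _ _ _ fine); first exact: fine_measurable.
  by apply: measurable_fun_limn_esup => n; apply/measurable_EFinP; exact: (hf n).1.
have Fae : {ae mu, forall t, `[a, b]%classic t ->
    forall n, (f n t - F t) ^+ 2 <= 2 * 2 ^- n * g t}.
  have Gae : {ae mu, forall t, `[a, b]%classic t -> G t \is a fin_num}.
    by apply: integrable_ae => //; exact: measurable_itv.
  apply: filterS Gae => t h tab n.
  have Gfin := h tab.
  have bound : forall n m, (f (n + m)%N t - f n t) ^+ 2 <= 2 * 2 ^- n * g t.
    apply: (@geometric_cauchy_bound (f^~ t)) => j; rewrite -lee_fin fineK//.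
    rewrite -sumEFin; apply: (@nneseries_lim_ge _ _ xpredT 0 j) => i _ _.
    by rewrite lee_fin; exact: w0.
  have /cvg_ex[l fl] := cvg_of_cauchy_bound bound.
  have -> : F t = l.
    have fl' : (f n t)%:E @[n --> \oo] --> l%:E by apply: cvg_EFin => //; exact: nearW.
    by rewrite /F (cvg_limn_einf_sup fl').2.
  rewrite -subr_le0.
  have : (f n t - f (m + n)%N t) ^+ 2 - 2 * 2 ^- n * g t @[m --> \oo] -->
      (f n t - l) ^+ 2 - 2 * 2 ^- n * g t.
    apply: cvgB; last exact: cvg_cst.
    have d : f n t - f (m + n)%N t @[m --> \oo] --> f n t - l.
      by apply: cvgB; [exact: cvg_cst|rewrite (cvg_shiftn n (f^~ t))].
    by rewrite expr2; under eq_cvg do rewrite expr2; exact: cvgM.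
  move=> h'; rewrite -(cvg_lim _ h')//; apply: limr_le.
    by apply/cvg_ex; eexists; exact: h'.
  apply: nearW => m; rewrite subr_le0 -sqrrN opprB addnC; exact: bound.
have lF : l2 a b F.
  split=> //; apply: (@intg_ae_le _ _ _ (fun t => 2 * f 0%N t ^+ 2 + 4 * g t)).
  - exact: measurable_funX.
  - apply: filterS Fae => t h tab; have := h tab 0%N.
    rewrite expr0 invr1 mulr1 ger0_norm ?sqr_ge0// => h1.
    have := sqr_ge0 (f 0%N t - (f 0%N t - F t)); have := sqr_ge0 (f 0%N t + (f 0%N t - F t)).
    nra.
  - by apply: intgD; apply: intgZ => //; exact: (hf 0%N).2.
exists F => //; exists (2 * rint a b g) => n.
rewrite (@le_trans _ _ (rint a b (fun t => 2 * 2 ^- n * g t)))//; last first.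
  by rewrite rintZ// mulrAC.
apply: ae_le_rint; [exact: (l2B (hf n) lF).2|exact: intgZ|].
by apply: filterS Fae => t h /h.
Qed.

End ScalarL2.

Section VectorL2.
Context {k : scalar_kind} {R : realType} {m : nat}.
Local Notation K := (scalar_field k R).
Implicit Types (a b : R) (u v w : R -> 'cV[K]_m).

Definition vl2 a b u := forall p, l2 a b (fun t => co p (u t)).

Lemma vl2_square_integrable a b u : square_integrable a b u <-> vl2 a b u.
Proof.
split=> [[mu_ fu] p|hu].
  have mp : measurable_fun `[a, b] (fun t => co p (u t)).
    by case: p => -[] i; have [] := mu_ i 0.
  split=> //.
  have hs : intg a b (fun t => sqnorm (u t)).
    apply/integrableP; split.
      by apply/measurable_EFinP; exact: measurable_sqnorm.
    apply: le_lt_trans fu; apply: ge0_le_integral => //=.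
    - by apply/measurable_EFinP; apply: measurableT_comp => //; exact: measurable_sqnorm.
    - apply/measurable_EFinP.
      apply: (@eq_measurable_fun _ _ _ _ _ (fun t => sqnorm (u t))).
        by move=> t _; rewrite vnorm_sqr.
      exact: measurable_sqnorm.
    - by move=> t _; rewrite ger0_norm ?sqnorm_ge0// vnorm_sqr.
  apply: intg_le hs; first exact: measurable_funX.
  move=> t _; rewrite ger0_norm ?sqr_ge0// -vnorm_sqr.
  rewrite -(real_normK (num_real (co p (u t)))).
  by rewrite lerXn2r ?nnegrE ?vnorm_ge0// co_le_vnorm.
have mu_ : measurable_mx `[a, b] u.
  move=> i j; rewrite (ord1 j); split; first exact: (hu (false, i)).1.
  exact: (hu (true, i)).1.
split=> //.
have hs : intg a b (fun t => sqnorm (u t)).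
  under [X in intg _ _ X]eq_fun do rewrite sqnorm_dot /dot.
  by apply: intg_sum => p _; exact: (hu p).2.
under eq_integral do rewrite vnorm_sqr.
by apply: integrable_lty.
Qed.

Lemma vl2D a b u v : vl2 a b u -> vl2 a b v -> vl2 a b (fun t => u t + v t).
Proof.
by move=> hu hv p; under [X in l2 _ _ X]eq_fun do rewrite coD; exact: l2D.
Qed.

Lemma vl2B a b u v : vl2 a b u -> vl2 a b v -> vl2 a b (fun t => u t - v t).
Proof.
by move=> hu hv p; under [X in l2 _ _ X]eq_fun do rewrite coB; exact: l2B.
Qed.

Lemma vl2_mulmx a b (M : R -> 'M[K]_m) B u : measurable_mx `[a, b] M ->
  (forall t p q, a <= t <= b -> `|mc (M t) p q| <= B) ->
  vl2 a b u -> vl2 a b (fun t => M t *m u t).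
Proof.
move=> mM MB hu p; under [X in l2 _ _ X]eq_fun do rewrite co_mulmx.
apply: l2_sum => q _; apply: (@l2_bounded_mul _ _ _ B) (hu q).
  have [h1 h2] := mM p.2 q.2; case: p q h1 h2 => [] [] i [] [] j //= h1 h2.
  exact: measurableT_comp.
by move=> t; exact: MB.
Qed.

Lemma vl2_cmulmx a b (M : 'M[K]_m) u : vl2 a b u -> vl2 a b (fun t => M *m u t).
Proof.
move=> hu p; under [X in l2 _ _ X]eq_fun do rewrite co_mulmx.
by apply: l2_sum => q _; exact: l2Z.
Qed.

Lemma intg_dot a b u v : vl2 a b u -> vl2 a b v -> intg a b (fun t => dot (u t) (v t)).
Proof. by move=> hu hv; apply: intg_sum => p _; exact: l2_mul. Qed.

Lemma rint_dot_ae a b u u' v v' : vl2 a b u -> vl2 a b u' -> vl2 a b v -> vl2 a b v' ->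
  ae_equal a b u u' -> ae_equal a b v v' ->
  rint a b (fun t => dot (u t) (v t)) = rint a b (fun t => dot (u' t) (v' t)).
Proof.
move=> hu hu' hv hv' uu' vv'; apply: ae_eq_rint; [exact: intg_dot..|].
by apply: filterS2 uu' vv' => t h1 h2 tab; rewrite h1// h2.
Qed.

Lemma L2_vl2 a b (x : L2 k a b m) : vl2 a b x.
Proof. by apply/vl2_square_integrable; have := valP (repr x); rewrite inE. Qed.

Lemma L2_ext a b (x y : L2 k a b m) : ae_equal a b x y -> x = y.
Proof. by move=> h; rewrite -(reprK x) -(reprK y); apply/L2_piP. Qed.

Lemma L2_of a b u : vl2 a b u -> exists x : L2 k a b m, ae_equal a b x u.
Proof.
move=> /vl2_square_integrable hu.
have hu' : u \in @L2pred k R a b m by rewrite inE.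
by exists (\pi_(L2 k a b m)%qT (Sub u hu' : L2fun k a b m)); exact: repr_pi.
Qed.

Lemma L2_linE a b (c : K) (x y : L2 k a b m) :
  ae_equal a b (L2_to_fun (c *: x + y)) (fun t => c *: x t + y t).
Proof.
have h1 : ae_equal a b (L2_to_fun (c *: x + y))
    (val (repr (L2_scale c x) + repr y)) by exact: repr_pi.
have h2 : ae_equal a b (L2_to_fun (L2_scale c x)) (val (c *: repr x)) by exact: repr_pi.
apply: filterS2 h1 h2 => t h1 h2 tab; rewrite [LHS](h1 tab).
rewrite -[LHS]/(L2_to_fun (L2_scale c x) t + L2_to_fun y t).
by rewrite [X in X + _](h2 tab).
Qed.

Lemma L2_DE a b (x y : L2 k a b m) : ae_equal a b (L2_to_fun (x + y)) (fun t => x t + y t).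
Proof. by have := L2_linE 1 x y; rewrite scale1r; under eq_fun do rewrite scale1r. Qed.

Lemma L2_ZE a b (c : K) (x : L2 k a b m) : ae_equal a b (L2_to_fun (c *: x)) (fun t => c *: x t).
Proof.
have h0 : ae_equal a b (0 : L2 k a b m) (fun=> 0).
  exact: (repr_pi (0 : L2fun k a b m)).
have := L2_linE c x 0; rewrite addr0 => h.
by apply: filterS2 h h0 => t h1 h2 tab; rewrite h1// h2// addr0.
Qed.

Lemma L2_BE a b (x y : L2 k a b m) : ae_equal a b (L2_to_fun (x - y)) (fun t => x t - y t).
Proof.
rewrite -scaleN1r addrC.
apply: filterS (L2_linE (-1) y x) => t h tab.
by rewrite h// scaleN1r addrC.
Qed.

Lemma L2_0E a b : ae_equal a b (0 : L2 k a b m) (fun=> 0).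
Proof. exact: (repr_pi (0 : L2fun k a b m)). Qed.

Lemma vl2_scale a b c u : vl2 a b u -> vl2 a b (fun t => c *: u t).
Proof.
move=> hu; have := vl2_cmulmx (c%:M) hu.
by under [X in vl2 _ _ X]eq_fun do rewrite mul_scalar_mx.
Qed.

End VectorL2.

(** * Continuous representatives and Sobolev functions *)

Section Continuity.
Context {k : scalar_kind} {R : realType}.
Local Notation K := (scalar_field k R).

Lemma norm_scalarE (z : K) : `|z| = of_real (modulus z).
Proof.
rewrite /modulus /of_real /mkscalar /re /im; case: k z => [z|z].
  by rewrite expr0n/= addr0 sqrtr_sqr.
by rewrite normc_def.
Qed.

Lemma lt_of_real (x y : R) : (of_real x < of_real y :> K) = (x < y).
Proof.
rewrite /of_real /mkscalar; case: k => //.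
by rewrite ltcE/= eqxx.
Qed.

Lemma gt0_of_real (e : K) : 0 < e -> exists2 x : R, 0 < x & e = of_real x.
Proof.
rewrite /of_real /mkscalar; case: k e => [e e0|[x y]]; first by exists e.
by rewrite ltcE/= => /andP[/eqP -> x0]; exists x.
Qed.

Lemma cvg_scalarP (T : Type) (F : set_system T) (FF : Filter F) (g : T -> K) (z : K) :
  g x @[x --> F] --> z <->
  re (g x) @[x --> F] --> re z /\ im (g x) @[x --> F] --> im z.
Proof.
split=> [/cvgrPdist_lt h|[/cvgrPdist_lt h1 /cvgrPdist_lt h2]].
  have h' e : 0 < e -> \forall x \near F, modulus (z - g x) < e.
    move=> e0; have /h : 0 < of_real e :> K by rewrite -(@of_real0 k R) lt_of_real.
    by apply: filterS => x; rewrite norm_scalarE lt_of_real.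
  split; apply/cvgrPdist_lt => e /h'; apply: filterS => x; apply: le_lt_trans.
    by rewrite -reB -sqrtr_sqr ler_wsqrtr// lerDl sqr_ge0.
  by rewrite -imB -sqrtr_sqr ler_wsqrtr// lerDr sqr_ge0.
apply/cvgrPdist_lt => e /gt0_of_real[d d0 ->].
have d20 : 0 < d / 2 by rewrite divr_gt0.
apply: filterS2 (h1 _ d20) (h2 _ d20) => x; rewrite -reB -imB => h3 h4.
rewrite norm_scalarE lt_of_real /modulus.
have : `|re (z - g x)| + `|im (z - g x)| < d by lra.
apply: le_lt_trans; rewrite -ler_sqr ?nnegrE ?sqrtr_ge0 ?addr_ge0//.
rewrite sqr_sqrtr ?addr_ge0 ?sqr_ge0// sqrrD !real_normK ?num_real//.
by rewrite lerD2r lerDl mulrn_wge0// mulr_ge0.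
Qed.

Lemma cvg_cVP m (T : Type) (F : set_system T) (FF : Filter F) (g : T -> 'cV[K]_m) v :
  g x @[x --> F] --> v <-> forall p, co p (g x) @[x --> F] --> co p v.
Proof.
split=> [h p|h A [P vP PA]].
  have : g x p.2 0 @[x --> F] --> v p.2 0.
    move=> U vU; apply: (h (fun M : 'cV[K]_m => U (M p.2 0))).
    exact: (@coord_continuous _ m 1 p.2 0 v U vU).
  by move=> /cvg_scalarP[h1 h2]; rewrite /co; case: p.1.
have K1 i : \forall x \near F, P i 0 (g x i 0).
  have : g x i 0 @[x --> F] --> v i 0.
    by apply/cvg_scalarP; split; [exact: (h (false, i))|exact: (h (true, i))].
  by apply; exact: vP.
have := filter_forall FF K1; apply: filterS => x hx.
by apply: PA => i j; rewrite (ord1 j).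
Qed.

Lemma continuous_within_cVP m (A : set R) (f : R -> 'cV[K]_m) :
  {within A, continuous f} <-> forall p, {within A, continuous (fun t => co p (f t))}.
Proof.
split=> [h p|h]; apply/subspace_continuousP => x Ax.
  by have /subspace_continuousP/(_ x Ax)/cvg_cVP := h; exact.
by apply/cvg_cVP => p; have /subspace_continuousP/(_ x Ax) := h p.
Qed.

Lemma ae_dense (a b s t : R) (P : R -> Prop) :
  {ae mu, forall r, `[a, b]%classic r -> P r} -> a <= s -> s < t -> t <= b ->
  exists2 r, s <= r <= t & P r.
Proof.
move=> [N [mN N0 sub]] as_ st tb; apply: contrapT => /forall2NP none.
have : (mu `[s, t] <= mu N)%E.
  apply: le_measure => //; rewrite ?inE//.
  move=> r /=; rewrite in_itv/= => /andP[sr rt]; apply: sub => /= h.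
  have [|nP] := none r; first by rewrite sr rt.
  by apply: nP; apply: h; rewrite in_itv/= (le_trans as_ sr) (le_trans rt tb).
rewrite N0 lebesgue_measure_itv/= lte_fin st -EFinD lee_fin; lra.
Qed.

Lemma continuous_ae_eq (a b : R) (f g : R -> R) : a < b ->
  {within `[a, b], continuous f} -> {within `[a, b], continuous g} ->
  {ae mu, forall t, `[a, b]%classic t -> f t = g t} ->
  forall t, a <= t <= b -> f t = g t.
Proof.
move=> ab cf cg fg t tab; apply/eqP; rewrite -subr_eq0 -normr_le0.
apply/ler_addgt0Pl => e e0; rewrite addr0.
have tab' : `[a, b]%classic t by rewrite /= in_itv.
have e20 : 0 < e / 2 by rewrite divr_gt0.
have /subspace_continuousP/(_ t tab')/cvgrPdist_le/(_ _ e20) := cf.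
have /subspace_continuousP/(_ t tab')/cvgrPdist_le/(_ _ e20) := cg.
rewrite !near_withinE => -[d1 /= d10 hg] -[d2 /= d20 hf].
pose d := Num.min d1 d2; have d0 : 0 < d by rewrite lt_min d10.
have hd r : `|t - r| < d -> a <= r <= b ->
    `|f t - f r| <= e / 2 /\ `|g t - g r| <= e / 2.
  rewrite lt_min => /andP[h1 h2] h3.
  by split; [apply: (hf r); rewrite //= ?in_itv|apply: (hg r); rewrite //= ?in_itv].
have /andP[at_ tb] := tab.
pose s1 := Num.max a (t - d / 2); pose s2 := Num.min b (t + d / 2).
have s12 : s1 < s2 by rewrite /s1 /s2 lt_min !gt_max; lra.
have as1 : a <= s1 by rewrite le_max lexx.
have s2b : s2 <= b by rewrite ge_min lexx.
have [r /andP[r1 r2] frg] := ae_dense fg as1 s12 s2b.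
move: r1 r2; rewrite ge_max le_min => /andP[ar tr] /andP[rb rt].
have [||] := hd r; rewrite ?ar ?rb//.
  by rewrite ltr_distlC; apply/andP; split; lra.
rewrite frg => h1 h2; have := ler_distD (g r) (f t) (g t).
by rewrite (distrC (g r)); lra.
Qed.

End Continuity.

Section SobolevStructure.
Context {k : scalar_kind} {R : realType} {m : nat}.
Local Notation K := (scalar_field k R).
Implicit Types (a b : R) (u g f : R -> 'cV[K]_m).

Definition vac a b f g := forall p, ac a b (fun t => co p (f t)) (fun t => co p (g t)).

Lemma rint_oo a b (f : R -> R) : intg a b f ->
  \int[mu]_(t in `]a, b[) f t = rint a b f.
Proof.
move=> hf; rewrite Rintegral_itv_bndo_bndc; last first.
  by apply: integrableS hf => //; apply: subset_itv; rewrite bnd_simp.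
rewrite Rintegral_itv_obnd_cbnd//.
by apply: integrableS hf => //; apply: subset_itv; rewrite bnd_simp.
Qed.

Lemma test_function_l2 a b phi : a <= b -> test_function a b phi ->
  l2 a b phi /\ l2 a b (derive1 phi).
Proof.
move=> ab tphi; have [hphi _ _] := test_function_ac ab tphi.
split; first exact: l2_ac ab hphi.
have [sm _ _] := tphi.
have h : ac a b (derive1 phi) (derive1 (derive1 phi)).
  apply: (@ac_deriv _ a b (derive1 phi) (derive1 (derive1 phi)) ab) => t.
    by rewrite derive1E; apply: derivableP; exact: (sm 1%N t).
  exact/differentiable_continuous/derivable1_diffP/(sm 2%N).
exact: l2_ac ab h.
Qed.

Lemma is_weak_derivativeP a b u g : a <= b -> vl2 a b u -> vl2 a b g ->
  is_weak_derivative a b u g <->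
  forall p phi, test_function a b phi ->
    rint a b (fun t => derive1 phi t * co p (u t)) =
    - rint a b (fun t => phi t * co p (g t)).
Proof.
move=> ab hu hg.
have E p phi : test_function a b phi ->
  co p (mxintegral `]a, b[ (fun t => of_real (derive1 phi t) *: u t)) =
    rint a b (fun t => derive1 phi t * co p (u t)) /\
  co p (- mxintegral `]a, b[ (fun t => of_real (phi t) *: g t)) =
    - rint a b (fun t => phi t * co p (g t)).
  move=> /(test_function_l2 ab)[h1 h2]; rewrite coN !co_mxintegral.
  split; last congr (- _); rewrite -rint_oo; try exact: l2_mul.
    by apply: eq_Rintegral => t _; rewrite coZr.
  by apply: eq_Rintegral => t _; rewrite coZr.
split=> h => [p phi tphi|phi tphi].
  by have [<- <-] := E p phi tphi; rewrite h.
by apply: co_inj => p; have [-> ->] := E p phi tphi; exact: h.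
Qed.

Lemma W12P a b u : W12 a b u ->
  [/\ vl2 a b u, vl2 a b (weak_derivative a b u) &
      is_weak_derivative a b u (weak_derivative a b u)].
Proof.
move=> [hu [g hg]]; have := xgetPex 0 (ex_intro _ g hg : exists x, [set g |
  square_integrable a b g /\ is_weak_derivative a b u g] x).
by move=> [/vl2_square_integrable h1 h2]; split=> //; exact/vl2_square_integrable.
Qed.

Lemma W12_ac a b u : a < b -> W12 a b u ->
  exists2 f, vac a b f (weak_derivative a b u) & ae_equal a b f u.
Proof.
move=> ab /W12P[hu hg /(is_weak_derivativeP (ltW ab) hu hg) wd].
have /choice[f Hf] : forall p : bool * 'I_m, exists f : R -> R,
   [/\ ac a b f (fun t => co p (weak_derivative a b u t)),
       {ae mu, forall t, `[a, b]%classic t -> f t = co p (u t)} &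
       k = RealScalars -> p.1 -> f = (fun=> 0)].
  (* For real scalars the imaginary coordinates must be zero at every point, not only almost
     everywhere, for [mkvec] to reproduce the chosen family. *)
  move=> p; have [[kR p1]|np] := pselect (k = RealScalars /\ p.1).
    exists (fun=> 0); case: p p1 => -[]//= i _; split=> //.
      under [X in ac _ _ _ X]eq_fun do rewrite co_real//.
      exact: ac_cst.
    by apply: aeW => t _; rewrite co_real.
  have [f hf fu] := weak_derivative_ac ab (l2_intg (hu p)) (l2_intg (hg p)) (wd p).
  by exists f; split=> // kR p1; case: np.
have coF t p : co p (mkvec (fun q => f q t) : 'cV[K]_m) = f p t.
  by apply: co_mkvec_of => kR i; have [_ _ /(_ kR isT) ->] := Hf (true, i).
exists (fun t => mkvec (fun q => f q t)).
  by move=> p; under [X in ac _ _ X]eq_fun do rewrite coF; have [] := Hf p.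
have Hae p : {ae mu, forall t, `[a, b]%classic t -> f p t = co p (u t)}.
  by have [] := Hf p.
have := filter_forall (aeF _) Hae; apply: filterS => t h tab.
by apply: co_inj => p; rewrite coF h.
Qed.

Lemma vl2_vac a b f g : a <= b -> vac a b f g -> vl2 a b f.
Proof. by move=> ab h p; exact: l2_ac ab (h p). Qed.

Lemma vac_weak_derivative a b f g u : a < b -> vac a b f g -> vl2 a b g ->
  vl2 a b u -> ae_equal a b f u -> is_weak_derivative a b u g.
Proof.
move=> ab hf hg hu fu; apply/(is_weak_derivativeP (ltW ab) hu hg) => p phi tphi.
rewrite -(ac_weak_derivative (ltW ab) (hf p) tphi).
have [h1 h2] := test_function_l2 (ltW ab) tphi.
apply: ae_eq_rint; [exact: l2_mul|exact: l2_mul h2 (vl2_vac (ltW ab) hf p)|].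
by apply: filterS fu => t h tab; rewrite h.
Qed.

Lemma vac_W12 a b f g u : a < b -> vac a b f g -> vl2 a b g ->
  vl2 a b u -> ae_equal a b f u -> W12 a b u.
Proof.
move=> ab hf hg hu fu; split; first exact/vl2_square_integrable.
exists g; split; first exact/vl2_square_integrable.
exact: vac_weak_derivative fu.
Qed.

Lemma vac_weak_derivativeE a b f g u : a < b -> vac a b f g -> vl2 a b g ->
  vl2 a b u -> ae_equal a b f u -> ae_equal a b (weak_derivative a b u) g.
Proof.
move=> ab hf hg hu fu; have Wu := vac_W12 ab hf hg hu fu.
have [_ hg' /(is_weak_derivativeP (ltW ab) hu hg') wd'] := W12P Wu.
have /(is_weak_derivativeP (ltW ab) hu hg) wd := vac_weak_derivative ab hf hg hu fu.
have Hae p : {ae mu, forall t, `[a, b]%classic t ->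
    co p (weak_derivative a b u t) = co p (g t)}.
  apply: weak_derivative_unique => //; try exact: l2_intg.
  by move=> phi tphi; apply: oppr_inj; rewrite -wd// -wd'.
have := filter_forall (aeF _) Hae; apply: filterS => t h tab.
by apply: co_inj => p; rewrite h.
Qed.

Lemma vac_continuous a b f g : a <= b -> vac a b f g -> {within `[a, b], continuous f}.
Proof. by move=> ab h; apply/continuous_within_cVP => p; exact: ac_continuous (h p). Qed.

Lemma continuous_representativeE a b f g u : a < b -> vac a b f g ->
  ae_equal a b f u -> forall t, a <= t <= b -> continuous_representative a b u t = f t.
Proof.
move=> ab hf fu t tab; have cf := vac_continuous (ltW ab) hf.
have := xgetPex 0 (ex_intro _ f (conj cf fu) : exists x, [set f |
  {within `[a, b], continuous f} /\ ae_equal a b f u] x).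
rewrite -/(continuous_representative a b u); set f' := continuous_representative a b u.
move=> [cf' f'u]; apply: co_inj => p.
apply: (@continuous_ae_eq R a b (fun r => co p (f' r)) (fun r => co p (f r)) ab _ _ _ t tab).
- by move: p; apply/continuous_within_cVP.
- by move: p; apply/continuous_within_cVP.
by apply: filterS2 fu f'u => r h1 h2 rab; rewrite h1// h2.
Qed.

End SobolevStructure.

(** * Coefficients of bounded variation *)

Section BoundedVariation.
Context {k : scalar_kind} {R : realType} {m : nat}.
Local Notation K := (scalar_field k R).
Implicit Types (a b s t : R) (M : 'M[K]_m) (H : R -> 'M[K]_m).

Lemma mc_opnorm M p q : (`|mc M p q|%:E <=
  opnorm vnorm vnorm (mulmx M : 'cV[K]_m -> 'cV[K]_m))%E.
Proof.
pose e : 'cV[K]_m := delta_mx q.2 0.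
have Me i : (M *m e) i 0 = M i q.2 by rewrite -colE mxE.
have e1 : vnorm e <= 1.
  rewrite -(@expr_le1 _ 2)// ?vnorm_ge0// vnorm_sqr /sqnorm (bigD1 q.2)//= big1.
    by rewrite !mxE !eqxx/= re1 im1 expr1n expr0n addr0 addr0.
  by move=> i /negPf iq; rewrite !mxE iq/= re0 im0 expr0n addr0.
apply: (@le_trans _ _ (vnorm (M *m e))%:E); last first.
  by apply: ereal_sup_ubound; exists e.
rewrite lee_fin.
have h1 := co_le_vnorm (false, p.2) (M *m e).
have h2 := co_le_vnorm (true, p.2) (M *m e).
rewrite /co/= Me in h1; rewrite /co/= Me in h2.
by rewrite /mc; case: ifP => // _; case: ifP => // _; rewrite normrN.
Qed.

Lemma BV_mc a b H p q : a < b -> BV_mx a b H ->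
  bounded_variation a b (fun t => mc (H t) p q).
Proof.
move=> ab hH; exists (fine (total_variation_mx a b H)) => _ [s abs <-].
have h : ((variation a b (fun t => mc (H t) p q) s)%:E <= total_variation_mx a b H)%E.
  apply: (@le_trans _ _ (\sum_(0 <= l < size s)
      opnorm vnorm vnorm (mulmx (H (nth b (a :: s) l.+1) -
                 H (nth b (a :: s) l)) : 'cV[K]_m -> 'cV[K]_m))%E).
    rewrite /variation -sumEFin; apply: lee_sum => i _.
    by rewrite /= -mcB; exact: mc_opnorm.
  by apply: ereal_sup_ubound; exists s.
rewrite -lee_fin fineK// ge0_fin_numE//.
by apply: le_trans h; rewrite lee_fin variation_ge0.
Qed.

(** [v] sums over the entries the total variation on [a, t], which is additive over adjacent
    intervals and dominates increments. *)
Lemma BV_majorant a b H : a < b -> BV_mx a b H -> exists v : R -> R,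
  forall s t, a <= s -> s <= t -> t <= b -> mnorm (H t - H s) <= v t - v s.
Proof.
move=> ab hH.
exists (fun t => \sum_p \sum_q fine (total_variation a t (fun r => mc (H r) p q))).
move=> s t as_ st tb; rewrite /mnorm -sumrB; apply: ler_sum => p _.
rewrite -sumrB; apply: ler_sum => q _; rewrite mcB.
set f := fun r => mc (H r) p q.
have bv := BV_mc p q ab hH.
have fin c d : a <= c -> c <= d -> d <= b -> total_variation c d f \is a fin_num.
  move=> ac cd db; apply/bounded_variationP => //.
  exact: (bounded_variationl cd db (bounded_variationr ac (le_trans cd db) bv)).
rewrite (total_variationD f as_ st) fineD ?fin ?(le_trans st)//.
rewrite addrAC subrr add0r -lee_fin fineK ?fin//.
exact: (total_variation_ge f st).
Qed.

End BoundedVariation.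

(** * A Gronwall inequality for frozen energies *)

Section Gronwall.
Context {R : realType}.
Implicit Types (a b s t : R).

(** One cell of the partition: entering it multiplies by 1 + q, the growth within it by 1 + p, and
    [g] is the forcing. The bound 1 + s <= exp s collects all factors in one exponent. *)
Lemma gronwall_step (p q A B g z : R) : 0 <= p -> 0 <= q -> 0 <= A -> 0 <= g ->
  0 <= B -> z <= expR A * B ->
  (1 + p) * ((1 + q) * z) + g <= expR (A + p + q) * (B + g).
Proof.
move=> p0 q0 A0 g0 B0 zB.
have E0 : 0 <= expR A * B by rewrite mulr_ge0// expR_ge0.
rewrite mulrDr; apply: lerD; last first.
  by rewrite ler_peMl// -expR0 ler_expR !addr_ge0.
rewrite (_ : A + p + q = p + (q + A)); last by ring.
rewrite !expRD -!mulrA; apply: le_trans (_ : expR p * ((1 + q) * (expR A * B)) <= _).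
  apply: le_trans (_ : (1 + p) * ((1 + q) * (expR A * B)) <= _).
    by rewrite !ler_wpM2l// addr_ge0.
  by rewrite ler_wpM2r ?expR_ge1Dx// mulr_ge0// addr_ge0.
by rewrite ler_wpM2l ?expR_ge0// ler_wpM2r// expR_ge1Dx.
Qed.

(* The function F r freezes at r a coefficient of variation function v; it changes
   with t at a rate controlled by S and G, up to an error of second order. *)
Record frozen_energy a b (P : R -> Prop) (F : R -> R -> R) (S v G : R -> R)
    (lo up C c D : R) : Prop := FrozenEnergy {
  frozen_dense : forall s t, a <= s -> s < t -> t <= b -> exists2 r, s <= r <= t & P r;
  frozen_bounds : forall r t, P r -> a <= r <= b -> a <= t <= b ->
    lo * S t <= F r t <= up * S t;
  frozen_increment : forall r s t M, P r -> a <= s -> s <= r -> r <= t -> t <= b ->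
    (forall x, s <= x <= t -> S x <= M) ->
    `|F r t - F r s| <= C * M * (t - s) + (G t - G s) + D * (t - s) * (v t - v s);
  frozen_jump : forall r r' t, P r -> P r' -> a <= r -> r <= r' -> r' <= b ->
    a <= t <= b -> `|F r t - F r' t| <= c * (v r' - v r) * S t;
  frozen_var : forall s t, a <= s -> s <= t -> t <= b -> v s <= v t;
  frozen_forcing : forall s t, a <= s -> s <= t -> t <= b -> G s <= G t;
  frozen_unif : forall e : R, 0 < e -> exists2 d : R, 0 < d &
    forall s t, a <= s -> s <= t -> t <= b -> t - s < d -> `|S t - S s| <= e;
  frozen_ge0 : forall t, a <= t <= b -> 0 <= S t }.

Lemma bv_gronwall_left a b P F S v G lo up C c D t :
  a < b -> 0 < lo -> 0 <= up -> 0 <= C -> 0 <= c -> 0 <= D ->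
  frozen_energy a b P F S v G lo up C c D -> a <= t <= b ->
  lo * S t <= expR (lo^-1 * (C * (b - a) + 2 * c * (v b - v a))) *
    (up * S a + (G b - G a)).
Proof.
move=> ab lo0 up0 C0 c0 D0 [dense Fb Finc Fjump vm Gm Su S0] /andP[at_ tb].
have aab : a <= a <= b by rewrite lexx ltW.
set E := expR _; have Z1 : 0 <= lo^-1 * (C * (b - a) + 2 * c * (v b - v a)).
  have vab : 0 <= v b - v a by rewrite subr_ge0 vm// ltW.
  by rewrite mulr_ge0 ?invr_ge0 ?(ltW lo0)// addr_ge0 ?mulr_ge0// subr_ge0 ltW.
have E1 : 1 <= E by rewrite -[X in X <= _]expR0 ler_expR.
have Sa0 : 0 <= up * S a by rewrite mulr_ge0// S0.
have Gab : 0 <= G b - G a by rewrite subr_ge0 Gm// ltW.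
move: at_; rewrite le_eqVlt => /predU1P[<-|at_].
  have [r rab Pr] := dense _ _ (lexx a) ab (lexx b).
  have /andP[h1 h2] := Fb r a Pr rab aab.
  apply: (le_trans (le_trans h1 h2)).
  rewrite -[X in X <= _]mul1r; apply: (@ler_pM R) => //.
  by rewrite lerDl.
apply/ler_addgt0Pr => /= e; move: (e : R) => {}e e0.
pose Z := C * (b - a) + D * (v b - v a).
have Z0 : 0 <= Z.
  by rewrite addr_ge0 ?mulr_ge0// subr_ge0 ?(ltW ab)// vm// ltW.
have E0 : 0 < E by rewrite (lt_le_trans _ E1).
(* Chosen so that the accumulated second-order errors, at most [e1 * Z], remain below e after
   multiplication by E. *)
pose e1 := e / (E * (Z + 1)).
have e10 : 0 < e1 by rewrite divr_gt0// mulr_gt0// ltr_wpDl.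
have e1Z : E * (e1 * Z) <= e.
  have key (x y z : R) : 0 < y -> 0 <= z -> y * (x / (y * (z + 1)) * z) = x * (z / (z + 1)).
    move=> y0 z0; have z1 : 0 < z + 1 by rewrite ltr_wpDl.
    by field; rewrite (gt_eqF z1) (gt_eqF y0).
  by rewrite /e1 key// ler_piMr ?(ltW e0)// ler_pdivrMr ?ltr_wpDl// mul1r lerDl.
have [d d0 Sd] := Su e1 e10.
(* A mesh below d keeps S within e1 of S (T i) on a cell, which supplies the bound M of the
   increment estimate; a mesh below e1 turns the error with factor D h into one with factor e1 D. *)
pose d1 := Num.min d e1; have d10 : 0 < d1 by rewrite lt_min d0.
pose n := Num.truncn ((t - a) / d1).
pose h := (t - a) / n.+1%:R.
have n0 : 0 < n.+1%:R :> R by rewrite ltr0n.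
have h0 : 0 < h by rewrite divr_gt0// subr_gt0.
have hd1 : h < d1.
  rewrite ltr_pdivrMr// mulrC -ltr_pdivrMr//.
  by rewrite truncnS_gt.
have /andP[hd he1] : (h < d) && (h < e1) by rewrite -lt_min.
pose T (i : nat) := a + i%:R * h.
have T0 : T 0%N = a by rewrite /T mul0r addr0.
have TS i : T i.+1 = T i + h by rewrite /T -natr1 mulrDl mul1r addrA.
have Tn : T n.+1 = t by rewrite /T /h; field; rewrite gt_eqF//= nat1r.
clearbody h.
have Tmono i j : (i <= j)%N -> T i <= T j.
  by move=> ij; rewrite lerD2l ler_wpM2r ?(ltW h0)// ler_nat.
have aT i : a <= T i by rewrite -T0 Tmono.
have Tb i : (i <= n.+1)%N -> T i <= b by move=> /Tmono; rewrite Tn => /le_trans; exact.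
have /choice[r Hr] : forall i, exists r, (i <= n)%N -> T i <= r <= T i.+1 /\ P r.
  move=> i; have [ni|_] := boolP (i <= n)%N; last by exists 0.
  have [|||r h1 h2] := dense (T i) (T i.+1); last by exists r.
  - exact: aT.
  - by rewrite TS ltrDl.
  - exact: Tb.
have Tin i : (i <= n.+1)%N -> a <= T i <= b by move=> ?; rewrite aT Tb.
have rin i : (i <= n)%N -> a <= r i <= b.
  move=> /[dup] /Hr[/andP[h1 h2] _] ni.
  by rewrite (le_trans (aT i) h1) (le_trans h2 (Tb _ _)).
pose g i := (G (T i.+1) - G (T i)) + e1 * (C * h + D * (v (T i.+1) - v (T i))).
have vT i : (i <= n)%N -> 0 <= v (T i.+1) - v (T i).
  by move=> ni; rewrite subr_ge0 vm ?Tmono ?Tb.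
have GT i : (i <= n)%N -> 0 <= G (T i.+1) - G (T i).
  by move=> ni; rewrite subr_ge0 Gm ?Tmono ?Tb.
have g0 i : (i <= n)%N -> 0 <= g i.
  move=> ni; rewrite /g addr_ge0 ?GT// mulr_ge0 ?(ltW e10)//.
  by rewrite addr_ge0// mulr_ge0 ?vT ?(ltW h0).
pose p := lo^-1 * (C * h).
have p0 : 0 <= p by rewrite /p !mulr_ge0 ?invr_ge0 ?(ltW lo0) ?(ltW h0).
have inc i : (i <= n)%N -> F (r i) (T i.+1) <= (1 + p) * F (r i) (T i) + g i.
  move=> /[dup] ni /[dup] /Hr[/andP[h1 h2] Pr] ni'.
  have SM x : T i <= x <= T i.+1 -> S x <= S (T i) + e1.
    move=> /andP[x1 x2]; rewrite addrC -lerBlDr; apply: le_trans (ler_norm _) _.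
    apply: Sd => //; first exact: (le_trans x2 (Tb i.+1 ni)).
    by apply: le_lt_trans hd; rewrite lerBlDl -TS.
  have /(le_trans (ler_norm _)) := Finc _ _ _ _ Pr (aT i) h1 h2 (Tb i.+1 ni) SM.
  rewrite [T i.+1 - T i](_ : _ = h); last by rewrite TS addrAC subrr add0r.
  have /andP[l1 _] := Fb _ _ Pr (rin i ni) (Tin i (leqW ni)).
  have l2 : lo^-1 * (C * h) * (lo * S (T i)) <= lo^-1 * (C * h) * F (r i) (T i) by rewrite ler_wpM2l.
  have l3 : h * (D * (v (T i.+1) - v (T i))) <= e1 * (D * (v (T i.+1) - v (T i))).
    by rewrite ler_wpM2r ?(ltW he1)// mulr_ge0 ?vT.
  rewrite (_ : lo^-1 * (C * h) * (lo * S (T i)) = C * h * S (T i)) in l2; last first.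
    by field; rewrite gt_eqF.
  rewrite /g -/p in l2 *.
  move: (F _ _) (F _ _) (v _ - _) (G _ - _) (S _) l2 l3 => f1 f2 dv dG s1 l2 l3 l4.
  nra.
(* Consecutive frozen points lie in adjacent cells, so a change costs c times v (T i.+2) - v (T i).
   These differences telescope with stride two, which leaves two values of v and gives the factor 2
   c in the exponent. *)
pose A i := lo^-1 * (C * (i.+1%:R * h) + c * (v (T i.+1) + v (T i) - 2 * v a)).
pose B i := up * S a + (G (T i.+1) - G a) +
  e1 * (C * (i.+1%:R * h) + D * (v (T i.+1) - v a)).
have va i : (i <= n.+1)%N -> 0 <= v (T i) - v a by move=> ni; rewrite subr_ge0 vm// Tb.
have A0 i : (i <= n)%N -> 0 <= A i.
  move=> ni; have := va i.+1 ni; have := va _ (leqW ni); rewrite /A => v1 v2.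
  rewrite mulr_ge0 ?invr_ge0 ?(ltW lo0)// addr_ge0 ?mulr_ge0// ?(ltW h0)//; lra.
have B0 i : (i <= n)%N -> 0 <= B i.
  move=> ni; have Ga : 0 <= G (T i.+1) - G a by rewrite subr_ge0 Gm// Tb.
  rewrite /B addr_ge0//; first by rewrite addr_ge0.
  by rewrite mulr_ge0 ?(ltW e10)// addr_ge0 ?mulr_ge0// ?(ltW h0)// va.
have claim i : (i <= n)%N -> F (r i) (T i.+1) <= expR (A i) * B i.
  elim: i => [|i IH] ni.
    apply: le_trans (inc 0%N ni) _.
    have [_ Pr] := Hr _ ni; have /andP[_ u1] := Fb _ _ Pr (rin _ ni) (Tin 0%N (leq0n _)).
    have := @gronwall_step p 0 0 (up * S a) (g 0%N) (F (r 0%N) (T 0%N)) p0 (lexx _) (lexx _) (g0 _ ni) Sa0.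
    rewrite expR0 mul1r addr0 mul1r addr0 add0r => /(_ _)/le_trans; apply; first by rewrite T0 in u1 *.
    rewrite (_ : B 0%N = up * S a + g 0%N); last by rewrite /B /g T0; ring.
    have Bg : 0 <= up * S a + g 0%N by rewrite addr_ge0// g0.
    apply: ler_wpM2r => //; rewrite ler_expR /A /p T0 mul1r.
    apply: ler_wpM2l; first by rewrite invr_ge0 ltW.
    rewrite lerDl mulr_ge0//; have := va 1%N ni; lra.
  have ni' : (i <= n)%N by exact: ltnW.
  apply: le_trans (inc _ ni) _.
  have [/andP[r1 r2] Pr] := Hr _ ni'; have [/andP[r3 r4] Pr'] := Hr _ ni.
  have q0 : 0 <= lo^-1 * (c * (v (T i.+2) - v (T i))).
    rewrite !mulr_ge0 ?invr_ge0 ?(ltW lo0)//.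
    have := vT _ ni; have := vT _ ni'; lra.
  have jump : F (r i.+1) (T i.+1) <=
      (1 + lo^-1 * (c * (v (T i.+2) - v (T i)))) * F (r i) (T i.+1).
    have rr : r i <= r i.+1 := le_trans r2 r3.
    have /andP[ar rb] := rin _ ni'; have /andP[ar' rb'] := rin _ ni.
    have := Fjump _ _ _ Pr Pr' ar rr rb' (Tin i.+1 ni').
    rewrite distrC => /(le_trans (ler_norm _)).
    have /andP[l1 _] := Fb _ _ Pr (rin _ ni') (Tin i.+1 ni').
    have v1 : v (r i.+1) <= v (T i.+2) by rewrite vm// Tb.
    have v2 : v (T i) <= v (r i) by rewrite vm.
    have v3 : c * (v (r i.+1) - v (r i)) * S (T i.+1) <= c * (v (T i.+2) - v (T i)) * S (T i.+1).
      rewrite ler_wpM2r ?S0 ?Tin// ler_wpM2l//; lra.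
    have l2 : lo^-1 * (c * (v (T i.+2) - v (T i))) * (lo * S (T i.+1)) <=
      lo^-1 * (c * (v (T i.+2) - v (T i))) * F (r i) (T i.+1) by rewrite ler_wpM2l.
    rewrite [leLHS](_ : _ = c * (v (T i.+2) - v (T i)) * S (T i.+1)) in l2; last first.
      by field; rewrite gt_eqF.
    move: (F _ _) (F _ _) v3 l2 => f1 f2 v3 l2 l3; lra.
  have := gronwall_step p0 q0 (A0 _ ni') (g0 _ ni) (B0 _ ni') (IH ni').
  rewrite (_ : A i + p + _ = A i.+1); last by rewrite /A /p -[i.+2%:R]natr1; ring.
  rewrite (_ : B i + g i.+1 = B i.+1); last by rewrite /B /g -[i.+2%:R]natr1; ring.
  by apply: le_trans; rewrite lerD2r ler_wpM2l// addr_ge0.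
have [_ Pr] := Hr n (leqnn n).
have /andP[l1 _] := Fb _ _ Pr (rin _ (leqnn n)) (Tin n.+1 (leqnn n.+1)).
rewrite Tn in l1; apply: (le_trans l1); rewrite -Tn.
apply: le_trans (claim _ (leqnn n)) _.
have vtb : v (T n.+1) <= v b by rewrite Tn vm// ltW.
have vtb' : v (T n) <= v b by rewrite vm// Tb.
have Gtb : G (T n.+1) <= G b by rewrite Tn Gm// ltW.
have nh : n.+1%:R * h <= b - a by move: tb; rewrite -{1}Tn /T; lra.
have Bn : B n <= up * S a + (G b - G a) + e1 * Z.
  rewrite /B /Z; apply: lerD; first by lra.
  rewrite ler_wpM2l ?(ltW e10)//; apply: lerD; rewrite ler_wpM2l//; lra.
have An : A n <= lo^-1 * (C * (b - a) + 2 * c * (v b - v a)).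
  rewrite /A ler_wpM2l ?invr_ge0 ?(ltW lo0)//; apply: lerD; first by rewrite ler_wpM2l.
  rewrite [2 * c]mulrC -mulrA ler_wpM2l//; lra.
apply: le_trans (_ : E * (up * S a + (G b - G a) + e1 * Z) <= _).
  by rewrite ler_pM ?expR_ge0 ?B0// ler_expR.
by rewrite [E * (_ + e1 * Z)]mulrDr lerD2l.
Qed.

(** The reflection t |-> a + b - t exchanges the endpoints and so reduces data at b to data at a; v
    and G change sign to stay nondecreasing. *)
Lemma frozen_energy_reflect a b P F S v G lo up C c D :
  frozen_energy a b P F S v G lo up C c D ->
  frozen_energy a b (fun r => P (a + b - r)) (fun r t => F (a + b - r) (a + b - t))
    (fun t => S (a + b - t)) (fun t => - v (a + b - t)) (fun t => - G (a + b - t))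
    lo up C c D.
Proof.
move=> [dense Fb Finc Fjump vm Gm Su S0]; split.
- move=> s t as_ st tb; have [|||r /andP[r1 r2] Pr] := dense (a + b - t) (a + b - s); try lra.
  exists (a + b - r); first by apply/andP; split; lra.
  by rewrite (_ : a + b - (a + b - r) = r)//; ring.
- move=> r t Pr /andP[r1 r2] /andP[t1 t2]; apply: Fb => //; apply/andP; split; lra.
- move=> r s t M Pr as_ sr rt tb SM; rewrite distrC.
  have := Finc (a + b - r) (a + b - t) (a + b - s) M Pr.
  rewrite (_ : a + b - s - (a + b - t) = t - s); last by ring.
  move=> h; rewrite (_ : - G _ - - G _ = G (a + b - s) - G (a + b - t)); last by ring.
  rewrite (_ : - v _ - - v _ = v (a + b - s) - v (a + b - t)); last by ring.
  apply: h; try lra.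
  move=> x /andP[x1 x2]; have := SM (a + b - x).
  rewrite (_ : a + b - (a + b - x) = x); last by ring.
  by apply; apply/andP; split; lra.
- move=> r r' t Pr Pr' ar rr rb /andP[t1 t2]; rewrite distrC.
  rewrite (_ : - v _ - - v _ = v (a + b - r) - v (a + b - r')); last by ring.
  by apply: Fjump => //; try lra; apply/andP; split; lra.
- by move=> s t as_ st tb; rewrite lerN2; apply: vm; lra.
- by move=> s t as_ st tb; rewrite lerN2; apply: Gm; lra.
- move=> e /Su[d d0 Sd]; exists d => // s t as_ st tb ts.
  by rewrite distrC; apply: Sd; lra.
- by move=> t /andP[t1 t2]; apply: S0; apply/andP; split; lra.
Qed.

Lemma bv_gronwall a b P F S v G lo up C c D e t :
  a < b -> 0 < lo -> 0 <= up -> 0 <= C -> 0 <= c -> 0 <= D ->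
  frozen_energy a b P F S v G lo up C c D -> e = a \/ e = b -> a <= t <= b ->
  lo * S t <= expR (lo^-1 * (C * (b - a) + 2 * c * (v b - v a))) *
    (up * S e + (G b - G a)).
Proof.
move=> ab lo0 up0 C0 c0 D0 FE [->|->] tab; first exact: bv_gronwall_left FE tab.
have tab' : a <= a + b - t <= b by case/andP: tab => t1 t2; apply/andP; split; lra.
have := bv_gronwall_left ab lo0 up0 C0 c0 D0 (frozen_energy_reflect FE) tab'.
rewrite (_ : a + b - (a + b - t) = t); last by ring.
rewrite (_ : a + b - a = b); last by ring.
rewrite (_ : a + b - b = a); last by ring.
by rewrite !opprK ![- v a + _]addrC ![- G a + _]addrC.
Qed.

End Gronwall.

(** Evaluate at r = - q / s or, if s = 0 and q is nonzero, where the affine function takes the value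
    -1. The Cauchy-Schwarz inequalities for [dot], for the energy and for integrals come from
    here. *)
Lemma discriminant_le (R : realType) (p q s : R) : (forall r, 0 <= p + 2 * r * q + r ^+ 2 * s) ->
  0 <= s -> q ^+ 2 <= p * s.
Proof.
move=> h; rewrite le_eqVlt => /predU1P[s0|s0].
  have [->|/eqP q0] := eqVneq q 0; first by rewrite expr0n -s0 mulr0.
  have := h (- (p + 1) / (2 * q)); rewrite -s0 mulr0 addr0.
  have -> : p + 2 * (- (p + 1) / (2 * q)) * q = - 1 by field; exact/eqP.
  by rewrite lerNr oppr0 ler10.
have := h (- q / s).
have -> : p + 2 * (- q / s) * q + (- q / s) ^+ 2 * s = p - q ^+ 2 / s.
  by field; rewrite gt_eqF.
by rewrite subr_ge0 ler_pdivrMr.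
Qed.

Section VectorAbsCont.
Context {k : scalar_kind} {R : realType} {m : nat}.
Local Notation K := (scalar_field k R).
Implicit Types (a b : R) (f g : R -> 'cV[K]_m) (M : 'M[K]_m).

Lemma dot_cauchy (w z : 'cV[K]_m) : `|dot w z| <= vnorm w * vnorm z.
Proof.
have w0 := vnorm_ge0 w; have z0 := vnorm_ge0 z.
rewrite -ler_sqr ?nnegrE ?mulr_ge0// exprMn !vnorm_dot real_normK ?num_real//.
apply: discriminant_le; last exact: dot_ge0.
move=> r; have := dot_ge0 (w + of_real r *: z).
rewrite dotDl !dotDr !dotZl !dotZr (dotC z w).
by move: (dot w w) (dot w z) (dot z z) => p q s; congr (0 <= _); ring.
Qed.

Lemma vnorm_leB (w z : 'cV[K]_m) : vnorm (w - z) <= vnorm w + vnorm z.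
Proof.
have w0 := vnorm_ge0 w; have z0 := vnorm_ge0 z.
rewrite -ler_sqr ?nnegrE ?vnorm_ge0 ?addr_ge0// vnorm_dot sqr_vnormB sqrrD !vnorm_dot.
have := dot_cauchy w z; rewrite ler_norml => /andP[h _].
by rewrite -mulr_natl; move: (vnorm w * _) h => p h; lra.
Qed.

Lemma eq_ac a b (f g f' g' : R -> R) : (forall t, f t = g t) ->
  (forall t, f' t = g' t) -> ac a b f f' -> ac a b g g'.
Proof. by move=> /funext <- /funext <-. Qed.

Lemma vac_mulmx a b M f f' : vac a b f f' ->
  vac a b (fun t => M *m f t) (fun t => M *m f' t).
Proof.
move=> h p; apply: (@eq_ac _ _ (fun t => \sum_q mc M p q * co q (f t))
  _ (fun t => \sum_q mc M p q * co q (f' t))) => [t|t|]; rewrite ?co_mulmx//.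
by apply: ac_sum => q _; apply: acZ; exact: h.
Qed.

Lemma vacB a b f f' g g' : vac a b f f' -> vac a b g g' ->
  vac a b (fun t => f t - g t) (fun t => f' t - g' t).
Proof.
move=> hf hg p; apply: (@eq_ac _ _ (fun t => co p (f t) - co p (g t)) _
  (fun t => co p (f' t) - co p (g' t))) => [t|t|]; rewrite ?coB//.
exact: acB (hf p) (hg p).
Qed.

Lemma ac_dot a b f f' g g' : a <= b -> vac a b f f' -> vac a b g g' ->
  ac a b (fun t => dot (f t) (g t)) (fun t => dot (f t) (g' t) + dot (f' t) (g t)).
Proof.
move=> ab hf hg; apply: (@eq_ac _ _ (fun t => \sum_p co p (f t) * co p (g t)) _
  (fun t => \sum_p (co p (f t) * co p (g' t) + co p (f' t) * co p (g t)))) => [//|t|].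
  by rewrite big_split.
by apply: ac_sum => p _; exact: ac_mul (hf p) (hg p).
Qed.

Lemma mnormN M : mnorm (- M) = mnorm M.
Proof.
apply: eq_bigr => p _; apply: eq_bigr => q _.
by rewrite -[- M]sub0r mcB distrC -mcB subr0.
Qed.

Lemma mnorm_le_sub M (M' : 'M[K]_m) : mnorm M <= mnorm (M - M') + mnorm M'.
Proof.
rewrite -big_split/=; apply: ler_sum => p _; rewrite -big_split/=; apply: ler_sum => q _.
by rewrite mcB; have := ler_normD (mc M p q - mc M' p q) (mc M' p q); rewrite subrK.
Qed.

Lemma mc_le_mnorm M p q : `|mc M p q| <= mnorm M.
Proof.
rewrite /mnorm (bigD1 p)//= (bigD1 q)//= -addrA lerDl.
by rewrite addr_ge0// ?sumr_ge0// => i _; rewrite sumr_ge0.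
Qed.

Lemma dot_mulmx_self_le M (v : 'cV[K]_m) : `|dot v (M *m v)| <= mnorm M * dot v v.
Proof. by rewrite -vnorm_dot expr2; exact: dot_mulmx_le. Qed.

(** For symmetric M, 2 <M p, p - q> = <p, M p> - <q, M q> + <p - q, M (p - q)>. It serves for M =
    [P1], in general indefinite, hence the absolute values in [dot_sub_telescope_le]. *)
Lemma dot_sub_telescope M (u : nat -> 'cV[K]_m) N : adjmx M = M ->
  \sum_(i < N) 2 * dot (M *m u i.+1) (u i.+1 - u i) =
  dot (u N) (M *m u N) - dot (u 0%N) (M *m u 0%N) +
  \sum_(i < N) dot (u i.+1 - u i) (M *m (u i.+1 - u i)).
Proof.
move=> Ma; elim: N => [|N IH]; first by rewrite !big_ord0 subrr add0r.
rewrite !big_ord_recr/= IH.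
have e : dot (u N.+1) (M *m u N) = dot (u N) (M *m u N.+1).
  by rewrite dot_selfadj// dotC.
rewrite mulmxBr !dotBr !dotBl ![dot (M *m _) _]dotC e.
move: (\sum_i _) (dot (u 0%N) _) (dot (u N.+1) _) (dot (u N) _) (dot (u N) _) => ? ? ? ? ?.
by ring.
Qed.

Lemma dot_sub_telescope_le M (u : nat -> 'cV[K]_m) N : adjmx M = M ->
  `|\sum_(i < N) 2 * dot (M *m u i.+1) (u i.+1 - u i)| <=
  mnorm M * (dot (u 0%N) (u 0%N) + dot (u N) (u N) +
    \sum_(i < N) dot (u i.+1 - u i) (u i.+1 - u i)).
Proof.
move=> Ma; rewrite dot_sub_telescope//; apply: le_trans (ler_normD _ _) _.
rewrite mulrDr; apply: lerD.
  apply: le_trans (ler_normB _ _) _.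
  by rewrite addrC mulrDr; apply: lerD; exact: dot_mulmx_self_le.
rewrite mulr_sumr; apply: le_trans (ler_norm_sum _ _ _) _.
by apply: ler_sum => i _; exact: dot_mulmx_self_le.
Qed.

(** The Sobolev bound in one dimension: f t - f c is an integral of the density, and Cauchy-Schwarz
    against 1 gives the factor b - a. *)
Lemma vac_sup_le a b f g c t : a < b -> vac a b f g -> vl2 a b g -> a <= c <= b -> a <= t <= b ->
  dot (f t) (f t) <= 2 * dot (f c) (f c) +
    2 * ((b - a) * rint a b (fun r => dot (g r) (g r))).
Proof.
move=> ab hf hg cab tab.
have -> : rint a b (fun r => dot (g r) (g r)) = \sum_p rint a b (fun r => co p (g r) ^+ 2).
  rewrite -rint_sum; last by move=> p _; exact: (hg p).2.
  by apply: eq_rint => r _; apply: eq_bigr => p _; rewrite expr2.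
rewrite /dot mulr_sumr !mulr_sumr -big_split/=; apply: ler_sum => p _.
have ip := l2_intg (hg p).
have d1 : `|co p (f t) - co p (f c)| <= rint a b (fun r => `|co p (g r)|).
  have le s s' : a <= s -> s <= s' -> s' <= b ->
      `|co p (f s') - co p (f s)| <= rint a b (fun r => `|co p (g r)|).
    move=> as_ ss sb; rewrite (ac_diff (hf p) as_ ss sb).
    apply: le_trans (rint_norm (intgW as_ sb ip)) _.
    by apply: rint_nonneg_mono => //; exact: intg_norm.
  have /andP[ac cb] := cab; have /andP[at_ tb] := tab.
  have [ct|/ltW tc] := leP c t; first exact: le.
  by rewrite distrC; exact: le.
have d2 : rint a b (fun r => `|co p (g r)|) ^+ 2 <=
    rint a b (fun r => co p (g r) ^+ 2) * (b - a).
  apply: discriminant_le; last by rewrite subr_ge0 ltW.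
  move=> r; have i2 := (hg p).2; have i1 := intg_norm ip.
  have -> : rint a b (fun s => co p (g s) ^+ 2) + 2 * r * rint a b (fun s => `|co p (g s)|) +
      r ^+ 2 * (b - a) =
      rint a b (fun s => (co p (g s) ^+ 2 + 2 * r * `|co p (g s)|) + r ^+ 2).
    rewrite rintD//; [|by apply: intgD => //; exact: intgZ|exact: intg_cst].
    rewrite rintD//; last exact: intgZ.
    by rewrite rintZ// rint_cst// ltW.
  apply: rint_ge0 => s _; rewrite -[co p (g s) ^+ 2]real_normK ?num_real//.
  by rewrite (_ : _ + _ = (`|co p (g s)| + r) ^+ 2) ?sqr_ge0//; ring.
have d3 : (co p (f t) - co p (f c)) ^+ 2 <= (b - a) * rint a b (fun r => co p (g r) ^+ 2).
  rewrite mulrC; apply: le_trans d2; rewrite -[leLHS]real_normK ?num_real//.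
  by rewrite ler_sqr ?nnegrE// (le_trans _ d1).
move: (co p (f t)) (co p (f c)) ((b - a) * _) d3 => p1 p2 q h.
have := sqr_ge0 (p1 - 2 * p2); nra.
Qed.

End VectorAbsCont.

(** The crude constant 1 + C replaces the square root of C. *)
Lemma sqr_le_bound (R : realType) (p q C : R) : 0 <= p -> 0 <= q -> 0 <= C -> p ^+ 2 <= C * q ^+ 2 ->
  p <= (1 + C) * q.
Proof.
move=> p0 q0 C0 h; rewrite -ler_sqr ?nnegrE ?mulr_ge0 ?addr_ge0//.
apply: (le_trans h); rewrite exprMn ler_wpM2r ?sqr_ge0// sqrrD expr1n mul1r.
by rewrite mulr2n addrA addrAC lerDr !addr_ge0// sqr_ge0.
Qed.

(** To be read with n = |x|, nz = |z| for z the image of x at parameter theta, q = |(Hx)(c)|^2 and s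
    = |T0 x - A x|. If theta >= 1/Z, the term theta lambda n^2 alone controls n. If theta < 1/Z, the
    part theta beta n of s is absorbed in n^2 by the choice of Z, and q is at most n nz / kappa. *)
Lemma coercive_arith (R : realType) (n nz q s theta lambda kappa C beta : R) :
  0 <= n -> 0 <= nz -> 0 <= q -> 0 <= s -> 0 <= theta <= 1 -> 0 < lambda -> 0 < kappa ->
  0 <= C -> 0 <= beta -> kappa * q + theta * lambda * n ^+ 2 <= n * nz ->
  n ^+ 2 <= C * (q + s ^+ 2) -> s <= nz + theta * beta * n ->
  n <= ((1 + 4 * C * beta ^+ 2) / lambda + (1 + 2 * C * (kappa^-1 + 2))) * nz.
Proof.
move=> n0 nz0 q0 s0 /andP[t0 t1] l0 k0 C0 b0 h1 h2 h3.
set Z := 1 + 4 * C * beta ^+ 2.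
have Zgt0 : 0 < Z by rewrite ltr_pwDl// !mulr_ge0 ?sqr_ge0.
have c1 : 0 <= Z / lambda by rewrite divr_ge0 ?ltW.
have c2 : 0 <= 2 * C * (kappa^-1 + 2) by rewrite mulr_ge0 ?mulr_ge0// addr_ge0// invr_ge0 ltW.
have [->|nn0] := eqVneq n 0; first by rewrite !mulr_ge0 ?addr_ge0.
have ngt0 : 0 < n by rewrite lt_neqAle eq_sym nn0.
have [tZ|tZ] := leP 1 (theta * Z).
  apply: le_trans (_ : Z / lambda * nz <= _); last first.
    by apply: ler_wpM2r => //; rewrite lerDl addr_ge0.
  rewrite mulrAC ler_pdivlMr// -(ler_pM2r ngt0).
  have e1 : theta * lambda * n ^+ 2 <= n * nz.
    by apply: le_trans h1; rewrite lerDr mulr_ge0// ltW.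
  have e2 := ler_wpM2l (ltW Zgt0) e1.
  have e3 : 0 <= lambda * n ^+ 2 by rewrite mulr_ge0 ?sqr_ge0 ?ltW.
  have e4 := ler_wpM2r e3 tZ.
  apply: le_trans (_ : theta * Z * (lambda * n ^+ 2) <= _).
    by apply: le_trans e4; rewrite mul1r le_eqVlt; apply/predU1P; left; ring.
  by apply: le_trans (_ : Z * (theta * lambda * n ^+ 2) <= _);
    [rewrite le_eqVlt; apply/predU1P; left; ring|rewrite -(mulrA Z) (mulrC nz)].
have tt : theta ^+ 2 <= theta by rewrite expr2 ler_piMl.
have h4 : 4 * C * beta ^+ 2 * theta ^+ 2 <= 1.
  have cb : 0 <= 4 * C * beta ^+ 2 by rewrite !mulr_ge0 ?sqr_ge0.
  have e1 := ler_wpM2l cb tt.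
  have e2 : theta * (4 * C * beta ^+ 2) <= theta * Z by rewrite ler_wpM2l// lerDr.
  by apply: (le_trans e1); rewrite mulrC; apply: (le_trans e2); exact: ltW.
have h5 : s ^+ 2 <= 2 * nz ^+ 2 + 2 * (theta * beta * n) ^+ 2.
  have tb : 0 <= theta * beta * n by rewrite !mulr_ge0.
  move: (theta * beta * n) h3 tb => w h3 w0.
  apply: le_trans (_ : (nz + w) ^+ 2 <= _); first by rewrite ler_sqr ?nnegrE ?addr_ge0.
  have := sqr_ge0 (nz - w); lra.
have h6 : n ^+ 2 <= 2 * C * q + 4 * C * nz ^+ 2.
  have e1 := ler_wpM2l C0 h5.
  have e2 := ler_wpM2r (sqr_ge0 n) h4.
  have -> : 2 * C * q + 4 * C * nz ^+ 2 = 2 * (C * (q + (2 * nz ^+ 2 + 2 * (theta * beta * n) ^+ 2)))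
     - 4 * C * beta ^+ 2 * theta ^+ 2 * n ^+ 2 by ring.
  lra.
have h7 : q <= kappa^-1 * (n * nz).
  rewrite ler_pdivlMl//; apply: le_trans h1; rewrite lerDl !mulr_ge0 ?sqr_ge0//; exact: ltW.
apply: le_trans (_ : (1 + 2 * C * (kappa^-1 + 2)) * nz <= _); last first.
  by rewrite ler_wpM2r// lerDr.
have [nle|/ltW nle] := leP n nz.
  by apply: (le_trans nle); rewrite mulrDl mul1r lerDl mulr_ge0.
rewrite -(ler_pM2r ngt0).
have e1 := ler_wpM2l C0 h7.
have e2 : C * (nz * nz) <= C * (n * nz) by rewrite !ler_wpM2l// ler_wpM2r.
have e3 : 0 <= nz * n by rewrite mulr_ge0.
have -> : (1 + 2 * C * (kappa^-1 + 2)) * nz * n =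
  nz * n + (2 * (C * (kappa^-1 * (n * nz))) + 4 * (C * (n * nz))) by ring.
lra.
Qed.

Lemma polarization (R : realType) (V : zmodType) (f : V -> V -> R) (n : V -> R) x y :
  (forall x y z, f x (y + z) = f x y + f x z) -> (forall x y, f x (- y) = - f x y) ->
  (forall x y, f x y = f y x) -> (forall x, n x ^+ 2 = f x x) ->
  n y ^+ 2 = n x ^+ 2 - 2 * f x (x - y) + n (x - y) ^+ 2.
Proof.
move=> fD fN fC nE; rewrite !nE !fD !fN [f (x - y) x]fC [f (x - y) y]fC !fD !fN (fC y x).
by ring.
Qed.

Lemma sqr_mono (R : realType) (p q : R) : 0 <= p -> p <= q -> p ^+ 2 <= q ^+ 2.
Proof. by move=> p0 pq; rewrite ler_sqr ?nnegrE// (le_trans p0). Qed.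

Lemma decay_step (R : realType) (n1 n2 n3 e q s1 s2 h kappa : R) :
  n1 = n2 - 2 * (h * e) + n3 -> h * e <= h * (- kappa * q) ->
  n2 + (s1 + n3 + 2 * kappa * (h * (s2 + q))) <= n1 + (s1 + 2 * kappa * (h * s2)).
Proof. by move=> -> e2; lra. Qed.

(** * Port-Hamiltonian operators *)

Section PortHamiltonian.
Context {k : scalar_kind} {R : realType} {m : nat}.
Variables (a b lo up Hb : R).
Local Notation K := (scalar_field k R).
Local Notation X := (L2 k a b m).
Variables (H : R -> 'M[K]_m) (V : R -> R).
Hypothesis ab : a < b.
Hypothesis lo0 : 0 < lo.
Hypothesis up0 : 0 < up.
Hypothesis measH : measurable_mx `[a, b] H.
Hypothesis adjH : \forall t \ae mu, `[a, b]%classic t -> adjmx (H t) = H t.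
Hypothesis quadH : \forall t \ae mu, `[a, b]%classic t -> forall w : 'cV[K]_m,
  lo * dot w w <= dot w (H t *m w) <= up * dot w w.
Hypothesis varH : forall s t, a <= s -> s <= t -> t <= b -> mnorm (H t - H s) <= V t - V s.
Hypothesis boundN : forall t, a <= t <= b -> mnorm (H t) <= Hb.
Implicit Types (x y z : X) (u g : R -> 'cV[K]_m) (r : R).

Local Notation eN := (energy_norm H : X -> R).

Let boundH t p q : a <= t <= b -> `|mc (H t) p q| <= Hb.
Proof. by move=> tab; apply: le_trans (mc_le_mnorm _ _ _) (boundN tab). Qed.

Let Hb0 : 0 <= Hb.
Proof. by apply: le_trans (mnorm_ge0 (H a)) (boundN _); rewrite lexx ltW. Qed.

Let uplo0 : 0 <= up / lo. Proof. by rewrite divr_ge0// ltW. Qed.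

Definition energy x y : R := re (energy_product H x y).

Lemma vl2_H (u : R -> 'cV[K]_m) : vl2 a b u -> vl2 a b (fun t => H t *m u t).
Proof. exact: vl2_mulmx measH boundH. Qed.

Lemma energyE x y : energy x y = 2^-1 * rint a b (fun t => dot (x t) (H t *m y t)).
Proof.
rewrite /energy /energy_product half_of_real reM re_of_real im_of_real mul0r subr0.
congr (_ * _); rewrite mxE.
have reE r s : re (mkscalar r s : K) = r by rewrite /re /mkscalar; case: k.
rewrite reE; apply: eq_Rintegral => t _.
by rewrite -mulmxA dotE.
Qed.

(** Elements of [L2] are evaluated through chosen representatives, which algebraic operations
    respect only almost everywhere; this lemma permits the change of representatives. *)
Lemma energy_ae x y u v : vl2 a b u -> vl2 a b v ->
  ae_equal a b x u -> ae_equal a b y v ->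
  energy x y = 2^-1 * rint a b (fun t => dot (u t) (H t *m v t)).
Proof.
move=> hu hv xu yv; rewrite energyE; congr (_ * _).
apply: rint_dot_ae => //; try exact: vl2_H; try exact: L2_vl2.
  exact/vl2_H/L2_vl2.
by apply: filterS yv => t h tab; rewrite h.
Qed.

Lemma energyC x y : energy x y = energy y x.
Proof.
rewrite !energyE; congr (_ * _); apply: ae_eq_rint.
- by apply: intg_dot; [exact: L2_vl2|exact/vl2_H/L2_vl2].
- by apply: intg_dot; [exact: L2_vl2|exact/vl2_H/L2_vl2].
- by apply: filterS adjH => t h tab; rewrite dot_selfadj ?h// dotC.
Qed.

Lemma energyDr x y z : energy x (y + z) = energy x y + energy x z.
Proof.
have hx := L2_vl2 x; have hy := L2_vl2 y; have hz := L2_vl2 z.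
rewrite (energy_ae hx (vl2D hy hz) (ae_eq_refl _ _ _) (L2_DE y z)) !energyE.
rewrite -mulrDr -rintD; [|by apply: intg_dot => //; exact: vl2_H..].
by congr (_ * _); apply: eq_rint => t _; rewrite mulmxDr dotDr.
Qed.

Lemma energyZr x y r : energy x (of_real r *: y) = r * energy x y.
Proof.
have hx := L2_vl2 x; have hy := L2_vl2 y.
rewrite (energy_ae hx (vl2_scale _ hy) (ae_eq_refl _ _ _) (L2_ZE _ y)) energyE.
rewrite [RHS]mulrCA -[in RHS]rintZ; last by apply: intg_dot => //; exact: vl2_H.
by congr (_ * _); apply: eq_rint => t _; rewrite -scalemxAr dotZr.
Qed.

Lemma energyDl x y z : energy (x + y) z = energy x z + energy y z.
Proof. by rewrite energyC energyDr !(energyC z). Qed.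

Lemma energyZl x y r : energy (of_real r *: x) y = r * energy x y.
Proof. by rewrite energyC energyZr energyC. Qed.

Lemma energyNr x y : energy x (- y) = - energy x y.
Proof. by rewrite -scaleN1r -(@of_real1 k R) -of_realN energyZr mulN1r. Qed.

Definition sqint (x : X) : R := rint a b (fun t => dot (x t) (x t)).

Lemma energy_bounds x : lo / 2 * sqint x <= energy x x <= up / 2 * sqint x.
Proof.
have hx := L2_vl2 x; have i1 := intg_dot hx hx; have i2 := intg_dot hx (vl2_H hx).
rewrite energyE mulrAC [up / 2 * _]mulrAC ![_ / 2]mulrC !ler_pM2l ?invr_gt0//.
rewrite /sqint -!rintZ//; apply/andP; split; apply: ae_le_rint => //; try exact: intgZ.
  by apply: filterS quadH => t h tab; have /andP[] := h tab (x t).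
by apply: filterS quadH => t h tab; have /andP[] := h tab (x t).
Qed.

Lemma sqint_ge0 x : 0 <= sqint x.
Proof. by apply: rint_ge0 => t _; exact: dot_ge0. Qed.

Lemma energy_ge0 x : 0 <= energy x x.
Proof.
have /andP[h _] := energy_bounds x; apply: le_trans h.
by rewrite mulr_ge0 ?sqint_ge0// divr_ge0// ltW.
Qed.

Lemma energy_norm_sqr x : energy_norm H x ^+ 2 = energy x x.
Proof. by rewrite sqr_sqrtr// energy_ge0. Qed.

Lemma energy_norm_ge0 x : 0 <= energy_norm H x.
Proof. exact: sqrtr_ge0. Qed.

Lemma energy_cauchy x y : `|energy x y| <= energy_norm H x * energy_norm H y.
Proof.
rewrite -ler_sqr ?nnegrE ?mulr_ge0 ?energy_norm_ge0// real_normK ?num_real//.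
rewrite exprMn !energy_norm_sqr; apply: discriminant_le; last exact: energy_ge0.
move=> r; have := energy_ge0 (x + of_real r *: y).
rewrite energyDl !energyDr energyZl !energyZr energyZl (energyC y x).
move: (energy x x) (energy x y) (energy y y) => e1 e2 e3.
by congr (0 <= _); ring.
Qed.

Lemma energy_normD x y : energy_norm H (x + y) <= energy_norm H x + energy_norm H y.
Proof.
rewrite -ler_sqr ?nnegrE ?addr_ge0 ?energy_norm_ge0// energy_norm_sqr.
rewrite energyDl !energyDr (energyC y x) sqrrD !energy_norm_sqr.
have := energy_cauchy x y; have := ler_norm (energy x y).
move: (energy x x) (energy x y) (energy y y) (_ * _) => e1 e2 e3 e4; lra.
Qed.

Lemma energy_normZ c x : energy_norm H (c *: x) = modulus c * energy_norm H x.
Proof.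
have hx := L2_vl2 x; rewrite /energy_norm /modulus -sqrtrM; last first.
  by rewrite addr_ge0 ?sqr_ge0.
congr Num.sqrt; rewrite -/(energy _ _) -/(energy x x).
rewrite (energy_ae (vl2_scale c hx) (vl2_scale c hx) (L2_ZE c x) (L2_ZE c x)) energyE.
rewrite [RHS]mulrCA -[in RHS]rintZ; last by apply: intg_dot => //; exact: vl2_H.
by congr (_ * _); apply: eq_rint => t _; rewrite -scalemxAr dot_scale.
Qed.

Lemma sqint_eq0 x : sqint x = 0 -> x = 0.
Proof.
move=> x0; apply: L2_ext; have hx := L2_vl2 x.
have h := rint_eq0_ae (intg_dot hx hx) (fun t _ => dot_ge0 (x t)) x0.
apply: filterS2 h (@L2_0E k R m a b) => t h1 h2 tab; rewrite h2//.
by apply/vnorm_eq0/eqP; rewrite -sqrf_eq0 vnorm_dot h1.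
Qed.

Lemma energy_is_norm : is_norm (energy_norm H : X -> R).
Proof.
split; [exact: energy_normD|exact: energy_normZ|].
move=> x /eqP; rewrite -sqrf_eq0 energy_norm_sqr => /eqP e0.
apply: sqint_eq0; have /andP[h _] := energy_bounds x; apply/eqP.
rewrite eq_le sqint_ge0 andbT; move: h; rewrite e0 pmulr_rle0// divr_gt0//.
Qed.

Lemma sqint_sum x : sqint x = \sum_p rint a b (fun t => co p (x t) ^+ 2).
Proof. by rewrite /sqint /dot rint_sum// => p _; exact: (L2_vl2 x p).2. Qed.

(** [riesz_fischer] in each coordinate: increments of size 2^-n have squares of size 4^-n, the rate
    it takes. It returns squared distances to the limit of size 2^-n, still enough for
    convergence. *)
Lemma energy_complete : norm_complete (energy_norm H : X -> R).
Proof.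
move=> u' C; pose u n : X := u' n; rewrite -/(u _) => uC.
have sq n : sqint (u n.+1 - u n) <= 2 / lo * C ^+ 2 * 4 ^- n.
  have /andP[h _] := energy_bounds (u n.+1 - u n).
  rewrite -energy_norm_sqr in h.
  have h2 : energy_norm H (u n.+1 - u n) ^+ 2 <= C ^+ 2 * 4 ^- n.
    rewrite (_ : 4 = 2 ^+ 2); last by ring.
    rewrite exprAC -exprVn -exprMn; apply: lerXn2r => //.
      by rewrite nnegrE energy_norm_ge0.
    by rewrite nnegrE (le_trans (energy_norm_ge0 _) (uC n)).
  have l2' : 0 < lo / 2 by rewrite divr_gt0.
  rewrite -(ler_pM2l l2') (le_trans h)// (le_trans h2)// -!mulrA.
  by rewrite le_eqVlt; apply/orP; left; apply/eqP; field; rewrite expf_neq0// gt_eqF.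
have /choice[F HF] : forall p : bool * 'I_m, exists F : R -> R,
   [/\ l2 a b F, k = RealScalars -> p.1 -> F = (fun=> 0) &
       exists C' : R, forall n, rint a b (fun t => (co p (u n t) - F t) ^+ 2) <= C' * 2 ^- n].
  move=> p; have [[kR p1]|np] := pselect (k = RealScalars /\ p.1).
    exists (fun=> 0); split=> //; first exact: l2_cst.
    exists 0 => n; rewrite mul0r; case: p p1 => -[]//= i _.
    under eq_rint do rewrite co_real// subrr expr0n.
    rewrite /rint Rintegral_cst// mul0r//.
  have hr n : rint a b (fun t => (co p (u n.+1 t) - co p (u n t)) ^+ 2) <=
      2 / lo * C ^+ 2 * 4 ^- n.
    apply: le_trans (sq n); rewrite sqint_sum.
    rewrite (@le_trans _ _ (rint a b (fun t => co p ((u n.+1 - u n : X) t) ^+ 2)))//.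
      rewrite le_eqVlt; apply/orP; left; apply/eqP; apply: ae_eq_rint.
      - exact: (l2B (L2_vl2 (u n.+1) p) (L2_vl2 (u n) p)).2.
      - exact: (L2_vl2 (u n.+1 - u n) p).2.
      - by apply: filterS (L2_BE (u n.+1) (u n)) => t h tab; rewrite h// coB.
    rewrite (bigD1 p)//= lerDl; apply: sumr_ge0 => q _.
    by apply: rint_ge0 => t _; exact: sqr_ge0.
  have [F lF [C' HC']] := riesz_fischer (fun n => L2_vl2 (u n) p) hr.
  exists F; split=> //; last by exists C'.
  by move=> kR p1; case: np.
have coF t p : co p (mkvec (fun q => F q t) : 'cV[K]_m) = F p t.
  by apply: co_mkvec_of => kR i; have [_ /(_ kR isT) -> _] := HF (true, i).
have [x xF] : exists x : X, ae_equal a b x (fun t => mkvec (fun q => F q t)).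
  apply: L2_of => p; under [X in l2 _ _ X]eq_fun do rewrite coF.
  by have [] := HF p.
have /choice[C' HC'] : forall p, exists C' : R, forall n,
   rint a b (fun t => (co p (u n t) - F p t) ^+ 2) <= C' * 2 ^- n.
  by move=> p; have [_ _ h] := HF p.
exists x; rewrite /ncvg -/(u _); pose c := up / 2 * \sum_p C' p.
have Nx n : energy_norm H (u n - x) ^+ 2 <= c * 2 ^- n.
  rewrite energy_norm_sqr; have /andP[_ h] := energy_bounds (u n - x).
  rewrite (le_trans h)// /c -[in leRHS]mulrA ler_pM2l ?divr_gt0// sqint_sum mulr_suml.
  apply: ler_sum => p _; apply: le_trans (HC' p n).
  rewrite le_eqVlt; apply/orP; left; apply/eqP; apply: ae_eq_rint.
  - exact: (L2_vl2 (u n - x) p).2.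
  - by have [lF _ _] := HF p; exact: (l2B (L2_vl2 (u n) p) lF).2.
  - apply: filterS2 (L2_BE (u n) x) xF => t h1 h2 tab.
    by rewrite h1// coB h2// coF.
apply/cvgr0Pnorm_le => e e0.
have /cvgr0Pnorm_le/(_ _ (exprn_gt0 2 e0)) := cvg_geom2 c.
apply: filterS => n h; rewrite ger0_norm ?energy_norm_ge0//.
rewrite -ler_sqr ?nnegrE ?energy_norm_ge0 ?(ltW e0)// (le_trans (Nx n))//.
exact: le_trans (ler_norm _) h.
Qed.

Let Nnorm : is_norm eN := energy_is_norm.
Let Ncpl : norm_complete eN := energy_complete.

(** The points of full measure at which the coefficient may be frozen. *)
Definition regular_point t := adjmx (H t) = H t /\
  forall w : 'cV[K]_m, lo * dot w w <= dot w (H t *m w) <= up * dot w w.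

Lemma regular_point_ae : {ae mu, forall t, `[a, b]%classic t -> regular_point t}.
Proof. by apply: filterS2 adjH quadH => t h1 h2 tab; split; auto. Qed.

Lemma mnorm_sub_le s t r r' : a <= s -> t <= b -> s <= r <= t -> s <= r' <= t ->
  mnorm (H r - H r') <= V t - V s.
Proof.
move=> as_ tb /andP[sr rt] /andP[sr' r't].
have vm (x y : R) : a <= x -> x <= y -> y <= b -> V x <= V y.
  by move=> ax xy yb; rewrite -subr_ge0; apply: le_trans (varH ax xy yb); exact: mnorm_ge0.
have vs (z : R) : s <= z -> z <= t -> V s <= V z by move=> h1 h2; apply: vm => //; exact: le_trans tb.
have vt (z : R) : s <= z -> z <= t -> V z <= V t by move=> h1 h2; apply: vm => //; exact: le_trans h1.
have [rr|/ltW rr] := leP r' r.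
  apply: le_trans (varH (le_trans as_ sr') rr (le_trans rt tb)) _.
  by apply: lerB; [exact: vt|exact: vs].
rewrite -opprB mnormN; apply: le_trans (varH (le_trans as_ sr) rr (le_trans r't tb)) _.
by apply: lerB; [exact: vt|exact: vs].
Qed.

Lemma regular_point_inv_le t (w : 'cV[K]_m) : regular_point t ->
  lo * vnorm w <= vnorm (H t *m w).
Proof.
move=> [_ /(_ w)/andP[h _]].
have [w0|w0] := eqVneq (vnorm w) 0; first by rewrite w0 mulr0 vnorm_ge0.
have wgt0 : 0 < vnorm w by rewrite lt_neqAle eq_sym w0 vnorm_ge0.
rewrite -(ler_pM2r wgt0) -mulrA -expr2 vnorm_dot; apply: (le_trans h).
apply: le_trans (ler_norm _) _; apply: le_trans (_ : _ <= vnorm w * vnorm (H t *m w)) _.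
  exact: dot_cauchy.
by rewrite mulrC.
Qed.

(** Multiplication by P H as a map of classes: P = 1 serves to invert multiplication by [H], and P =
    [P0] gives the bounded part of the operator. *)
Lemma mulmx_L2 (P : 'M[K]_m) :
  exists T : X -> X, forall x, ae_equal a b (T x) (fun t => P *m (H t *m x t)).
Proof.
have /choice[T hT] : forall x : X, exists y : X, ae_equal a b y (fun t => P *m (H t *m x t)).
  by move=> x; apply: L2_of; apply: vl2_cmulmx; exact: vl2_H (L2_vl2 x).
by exists T.
Qed.

Lemma L2_linear_of (T : X -> X) (P : 'M[K]_m) :
  (forall x, ae_equal a b (T x) (fun t => P *m (H t *m x t))) ->
  forall c x y, T (c *: x + y) = c *: T x + T y.
Proof.
move=> hT c x y; apply: L2_ext.
have h1 := @filterI _ _ (aeF _) _ _ (hT (c *: x + y)) (L2_linE c x y).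
have h2 := @filterI _ _ (aeF _) _ _ (hT x) (hT y).
apply: filterS3 h1 h2 (L2_linE c (T x) (T y)) => t [e1 e2] [e3 e4] e5 tab.
by rewrite e1// e2// e5// e3// e4// !mulmxDr -!scalemxAr.
Qed.

Lemma energy_norm_le_ae C x y : 0 <= C ->
  {ae mu, forall t, `[a, b]%classic t -> dot (x t) (x t) <= C * dot (y t) (y t)} ->
  eN x ^+ 2 <= up / lo * C * eN y ^+ 2.
Proof.
move=> C0 h; have s : sqint x <= C * sqint y.
  rewrite /sqint -rintZ; last exact: intg_dot (L2_vl2 y) (L2_vl2 y).
  apply: ae_le_rint => //; first exact: intg_dot (L2_vl2 x) (L2_vl2 x).
  by apply: intgZ; exact: intg_dot (L2_vl2 y) (L2_vl2 y).
rewrite !energy_norm_sqr.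
have /andP[_ h1] := energy_bounds x.
have /andP[h2 _] := energy_bounds y.
apply: (le_trans h1); apply: le_trans (_ : up / 2 * (C * sqint y) <= _).
  by rewrite ler_wpM2l// divr_ge0// ltW.
have -> : up / 2 * (C * sqint y) = up / lo * C * (lo / 2 * sqint y).
  by field; rewrite gt_eqF.
by rewrite ler_wpM2l// mulr_ge0// divr_ge0 ?ltW.
Qed.

Lemma mulH_dot_bounds x u : ae_equal a b u (mulH H x) ->
  {ae mu, forall t, `[a, b]%classic t ->
    lo ^+ 2 * dot (x t) (x t) <= dot (u t) (u t) <= Hb ^+ 2 * dot (x t) (x t)}.
Proof.
move=> hu; apply: filterS2 hu regular_point_ae => t e r tab.
rewrite e// /mulH -!vnorm_dot -!exprMn; apply/andP; split.
  rewrite ler_sqr ?nnegrE ?mulr_ge0 ?vnorm_ge0 ?(ltW lo0)//.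
  exact: regular_point_inv_le (r tab).
rewrite ler_sqr ?nnegrE ?mulr_ge0 ?vnorm_ge0//.
apply: le_trans (vnorm_mulmx_le _ _) _; by rewrite ler_wpM2r ?vnorm_ge0// boundN.
Qed.

Lemma energy_norm_mulH_ge x u : vl2 a b u -> ae_equal a b u (mulH H x) ->
  eN x ^+ 2 <= up / 2 * lo ^- 2 * rint a b (fun t => dot (u t) (u t)).
Proof.
move=> u2 hu; rewrite energy_norm_sqr.
have /andP[_ h1] := energy_bounds x; apply: (le_trans h1).
rewrite -(mulrA (up / 2)) ler_wpM2l ?divr_ge0 ?(ltW up0)// ler_pdivlMl ?exprn_gt0//.
rewrite /sqint -rintZ; last exact: intg_dot (L2_vl2 x) (L2_vl2 x).
apply: ae_le_rint; first by apply: intgZ; exact: intg_dot (L2_vl2 x) (L2_vl2 x).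
  exact: intg_dot.
by apply: filterS (mulH_dot_bounds hu) => t h tab; have /andP[] := h tab.
Qed.

Lemma energy_norm_mulH_le x u : vl2 a b u -> ae_equal a b u (mulH H x) ->
  rint a b (fun t => dot (u t) (u t)) <= Hb ^+ 2 * (2 / lo) * eN x ^+ 2.
Proof.
move=> u2 hu; rewrite energy_norm_sqr.
have /andP[h1 _] := energy_bounds x.
apply: le_trans (_ : Hb ^+ 2 * sqint x <= _).
  rewrite /sqint -rintZ; last exact: intg_dot (L2_vl2 x) (L2_vl2 x).
  apply: ae_le_rint; first exact: intg_dot.
    by apply: intgZ; exact: intg_dot (L2_vl2 x) (L2_vl2 x).
  by apply: filterS (mulH_dot_bounds hu) => t h tab; have /andP[] := h tab.
rewrite -(mulrA (Hb ^+ 2)) ler_wpM2l ?sqr_ge0//.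
have -> : sqint x = 2 / lo * (lo / 2 * sqint x) by field; rewrite gt_eqF.
by rewrite ler_wpM2l// divr_ge0// ltW.
Qed.

Lemma energy_norm_mulmx_le (P : 'M[K]_m) (T : X -> X) :
  (forall x, ae_equal a b (T x) (fun t => P *m (H t *m x t))) ->
  exists2 beta, 0 <= beta & forall x, eN (T x) <= beta * eN x.
Proof.
move=> hT; pose C := (mnorm P * Hb) ^+ 2; have C0 : 0 <= C by exact: sqr_ge0.
exists (1 + up / lo * C) => [|x].
  by rewrite addr_ge0// mulr_ge0.
apply: sqr_le_bound; [exact: energy_norm_ge0|exact: energy_norm_ge0|exact: mulr_ge0|].
apply: energy_norm_le_ae => //; apply: filterS (hT x) => t e tab.
rewrite e// -!vnorm_dot -exprMn ler_sqr ?nnegrE ?mulr_ge0 ?vnorm_ge0 ?mnorm_ge0//.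
apply: le_trans (vnorm_mulmx_le _ _) _; rewrite -mulrA ler_wpM2l ?mnorm_ge0//.
apply: le_trans (vnorm_mulmx_le _ _) _; by rewrite ler_wpM2r ?vnorm_ge0// boundN.
Qed.

(* Deform the identity into multiplication by H along (1 - theta) + theta H. *)
Lemma mulH_onto u : vl2 a b u -> exists x, ae_equal a b u (mulH H x).
Proof.
move=> u2; have [T hT] := mulmx_L2 1%:M; have Tlin := L2_linear_of hT.
have [beta beta0 Tb] := energy_norm_mulmx_le hT.
(* A common lower bound for the quadratic forms of (1 - theta) + theta H, whatever theta in
   [0, 1]. *)
pose nu := Num.min 1 lo; have nu0 : 0 < nu by rewrite lt_min ltr01.
have nu1 : nu <= 1 by rewrite ge_min lexx.
have nulo : nu <= lo by rewrite ge_min lexx orbT.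
have [y hy] := L2_of u2.
have coercive theta (z : X) : 0 <= theta <= 1 ->
    eN z <= (1 + up / lo * nu ^- 2) * eN (z + of_real theta *: (T z - z)).
  move=> /andP[t0 t1]; set w : X := (z + _).
  have nu2 : 0 <= nu ^- 2 by rewrite invr_ge0 sqr_ge0.
  apply: sqr_le_bound; [exact: energy_norm_ge0|exact: energy_norm_ge0|exact: mulr_ge0|].
  apply: energy_norm_le_ae => //.
  have h1 := @filterI _ _ (aeF _) _ _ (L2_DE z (of_real theta *: (T z - z))) (L2_ZE (of_real theta) (T z - z)).
  have h2 := @filterI _ _ (aeF _) _ _ (L2_BE (T z) z) (hT z).
  apply: filterS3 h1 h2 regular_point_ae => t [e1 e2] [e3 e4] r tab.
  have wE : w t = z t + of_real theta *: (H t *m z t - z t).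
    by rewrite /w e1// e2// e3// e4// mul1mx.
  rewrite ler_pdivlMl ?exprn_gt0// -!vnorm_dot -exprMn.
  rewrite ler_sqr ?nnegrE ?mulr_ge0 ?vnorm_ge0 ?(ltW nu0)//.
  have [z0|z0] := eqVneq (vnorm (z t)) 0; first by rewrite z0 mulr0 vnorm_ge0.
  have zgt0 : 0 < vnorm (z t) by rewrite lt_neqAle eq_sym z0 vnorm_ge0.
  rewrite -(ler_pM2r zgt0) -mulrA -expr2 vnorm_dot [leRHS]mulrC.
  apply: le_trans (dot_cauchy _ _); apply: le_trans (ler_norm _).
  rewrite wE dotDr dotZr dotBr.
  have [_ /(_ (z t))/andP[r1 _]] := r tab.
  have := dot_ge0 (z t).
  have l2 : theta * (lo * dot (z t) (z t)) <= theta * dot (z t) (H t *m z t) by rewrite ler_wpM2l.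
  move: (dot (z t) (H t *m z t)) (dot (z t) (z t)) r1 l2 => q p r1 l2 p0.
  have l3 : 0 <= theta * (lo - nu) * p by rewrite !mulr_ge0// subr_ge0.
  have l4 : 0 <= (1 - theta) * (1 - nu) * p by rewrite !mulr_ge0// subr_ge0.
  lra.
have [x _ Tx] : exists2 x, setT x & x + (T x - x) = y.
  apply: (@continuity_method _ _ _ (energy_norm H) Nnorm setT id (fun x => T x - x) (1 + up / lo * nu ^- 2) (beta + 1)) => //.
  - by move=> c z w _ _ /=; rewrite Tlin scalerBr opprD addrACA.
  - move=> z _; apply: le_trans (normB Nnorm _ _) _; rewrite mulrDl mul1r lerD2r; exact: Tb.
  - by move=> theta z t01 _; exact: coercive.
  - by move=> z; exists z.
exists x; apply: filterS2 hy (hT x) => t e1 e2 tab.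
by rewrite -e1// -Tx addrC subrK e2// mul1mx.
Qed.

(** * Boundary observability of Euler orbits *)

Variables P1 P0 : 'M[K]_m.
Hypothesis P1u : P1 \in unitmx.
Hypothesis P1a : adjmx P1 = P1.

(* x n.+1 - x n = h A (x n.+1), with A expressed through u n = H (x n) and u' n = (u n)'. *)
Record euler_scheme N (h : R) (u u' x : nat -> R -> 'cV[K]_m) : Prop := EulerScheme {
  euler_ac : forall n, vac a b (u n) (u' n);
  euler_mul : forall n, (n <= N)%N -> ae_equal a b (fun t => H t *m x n t) (u n);
  euler_step : forall n, (n < N)%N ->
    ae_equal a b (fun t => of_real h *: (P1 *m u' n.+1 t + P0 *m u n.+1 t))
                 (fun t => x n.+1 t - x n t) }.

Definition euler_energy N h (u : nat -> R -> 'cV[K]_m) t :=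
  h * \sum_(i < N) dot (P1 *m u i.+1 t) (P1 *m u i.+1 t).

(** What [dot_sub_telescope_le] leaves after summation in time: the two end states and the squared
    increments, the latter paid for by the numerical dissipation of implicit Euler. *)
Definition euler_forcing N (u : nat -> R -> 'cV[K]_m) t :=
  dot (u 0%N t) (u 0%N t) + dot (u N t) (u N t) +
  \sum_(i < N) dot (u i.+1 t - u i t) (u i.+1 t - u i t).

(** The scheme expresses h P1 u' as an increment of x minus h P0 u, and M is split as Ht + (M - Ht),
    where Ht x = u. Three sums result: one with P0, bounded by the energy itself; one that
    telescopes; and one with M - Ht, estimated term by term, whence its factor N. *)
Lemma euler_pointwise N h (u u' x : nat -> 'cV[K]_m) (M Ht : 'M[K]_m) U dv :
  0 <= h -> adjmx M = M -> mnorm M <= Hb -> mnorm (M - Ht) <= dv ->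
  (forall n, (n <= N)%N -> vnorm (u n) <= U /\ vnorm (x n) <= U / lo) ->
  (forall n, (n <= N)%N -> Ht *m x n = u n) ->
  (forall n, (n < N)%N -> of_real h *: (P1 *m u' n.+1 + P0 *m u n.+1) = x n.+1 - x n) ->
  `|h * \sum_(i < N) (dot (P1 *m u i.+1) (M *m (P1 *m u' i.+1)) +
                      dot (P1 *m u' i.+1) (M *m (P1 *m u i.+1)))| <=
  2 * Hb * mnorm P0 * mnorm (invmx P1) *
    (h * \sum_(i < N) dot (P1 *m u i.+1) (P1 *m u i.+1)) +
  mnorm P1 * (dot (u 0%N) (u 0%N) + dot (u N) (u N) +
    \sum_(i < N) dot (u i.+1 - u i) (u i.+1 - u i)) +
  N%:R * (4 * mnorm P1 * U ^+ 2 / lo) * dv.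
Proof.
move=> h0 Ma MHb Mdv bnd ux step.
have U0 : 0 <= U by have [h1 _] := bnd 0%N (leq0n _); exact: le_trans (vnorm_ge0 _) h1.
have dv0 : 0 <= dv := le_trans (mnorm_ge0 _) Mdv.
have -> : h * \sum_(i < N) (dot (P1 *m u i.+1) (M *m (P1 *m u' i.+1)) +
                      dot (P1 *m u' i.+1) (M *m (P1 *m u i.+1))) =
  - (\sum_(i < N) 2 * h * dot (P1 *m u i.+1) (M *m (P0 *m u i.+1))) +
  \sum_(i < N) 2 * dot (P1 *m u i.+1) (u i.+1 - u i) +
  \sum_(i < N) 2 * dot (P1 *m u i.+1) ((M - Ht) *m (x i.+1 - x i)).
  rewrite -sumrN mulr_sumr -!big_split/=; apply: eq_bigr => i _.
  have -> : u i.+1 - u i = Ht *m (x i.+1 - x i).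
    by rewrite mulmxBr ux ?ux// ltnW.
  rewrite mulmxBl -(step _ (ltn_ord i)) [dot (P1 *m u' _) _]dot_selfadj//.
  rewrite [dot (M *m _) _]dotC.
  rewrite dotBr -!scalemxAr !dotZr ![M *m (_ + _)]mulmxDr dotDr.
  by move: (dot _ _) (dot _ _) (dot _ _) => ? ? ?; ring.
apply: le_trans (ler_normD _ _) _; apply: lerD; last first.
  apply: le_trans (ler_norm_sum _ _ _) _.
  apply: le_trans (_ : \sum_(i < N) (4 * mnorm P1 * U ^+ 2 / lo) * dv <= _); last first.
    by rewrite sumr_const card_ord -[X in X <= _]mulr_natl mulrA.
  apply: ler_sum => i _; rewrite normrM ger0_norm//.
  have [b1 _] := bnd _ (ltn_ord i).
  have b2 : vnorm (x i.+1 - x i) <= 2 * (U / lo).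
    have [_ b2] := bnd _ (ltn_ord i); have [_ b2'] := bnd _ (ltnW (ltn_ord i)).
    by apply: le_trans (vnorm_leB _ _) _; rewrite mulr_natl mulr2n lerD.
  have b3 := vnorm_mulmx_le P1 (u i.+1).
  have b4 := dot_mulmx_le (P1 *m u i.+1) (M - Ht) (x i.+1 - x i).
  apply: le_trans (_ : 2 * (dv * ((mnorm P1 * U) * (2 * (U / lo)))) <= _); last first.
    by rewrite le_eqVlt; apply/predU1P; left; ring.
  rewrite ler_wpM2l//; apply: (le_trans b4); rewrite ler_pM ?mnorm_ge0 ?mulr_ge0 ?vnorm_ge0//.
  rewrite ler_pM ?vnorm_ge0//; apply: (le_trans b3); by rewrite ler_wpM2l// mnorm_ge0.
apply: le_trans (ler_normD _ _) _; apply: lerD; last exact: dot_sub_telescope_le.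
rewrite normrN; apply: le_trans (ler_norm_sum _ _ _) _.
rewrite [h * _]mulr_sumr [X in _ <= X]mulr_sumr; apply: ler_sum => i _.
rewrite normrM ger0_norm ?mulr_ge0//.
have c1 := dot_mulmx_le (P1 *m u i.+1) M (P0 *m u i.+1).
have c2 := vnorm_mulmx_le P0 (u i.+1).
have c3 : vnorm (u i.+1) <= mnorm (invmx P1) * vnorm (P1 *m u i.+1).
  by rewrite -{1}[u _](mulKmx P1u); exact: vnorm_mulmx_le.
rewrite -vnorm_dot.
apply: le_trans (_ : 2 * h * (Hb * (vnorm (P1 *m u i.+1) *
   (mnorm P0 * (mnorm (invmx P1) * vnorm (P1 *m u i.+1))))) <= _); last first.
  by rewrite le_eqVlt; apply/predU1P; left; ring.
rewrite ler_wpM2l ?mulr_ge0//; apply: (le_trans c1).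
rewrite ler_pM ?mnorm_ge0 ?mulr_ge0 ?vnorm_ge0// ler_wpM2l ?vnorm_ge0//.
by apply: (le_trans c2); rewrite ler_wpM2l ?mnorm_ge0.
Qed.

Lemma vac_bounded N (u u' : nat -> R -> 'cV[K]_m) : (forall n, vac a b (u n) (u' n)) ->
  exists2 U, 0 <= U & forall n t, (n <= N)%N -> a <= t <= b -> vnorm (u n t) <= U.
Proof.
move=> hu; pose f t := \sum_(i < N.+1) dot (u i t) (u i t).
have [B B0 fB] : exists2 B, 0 <= B & forall t, a <= t <= b -> `|f t| <= B.
  apply: ac_bounded; apply: ac_sum => i _; exact: (ac_dot (ltW ab) (hu i) (hu i)).
exists (Num.sqrt B); first exact: sqrtr_ge0.
move=> n t nN tab; rewrite -ler_sqr ?nnegrE ?vnorm_ge0 ?sqrtr_ge0// [X in _ <= X]sqr_sqrtr//.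
rewrite vnorm_dot; apply: le_trans (fB t tab); apply: le_trans (ler_norm _).
have nN' : (n < N.+1)%N by [].
rewrite /f (bigD1 (Ordinal nN'))//= lerDl.
by apply: sumr_ge0 => i _; exact: dot_ge0.
Qed.

Lemma euler_energy_ge0 N h (u : nat -> R -> 'cV[K]_m) t : 0 <= h -> 0 <= euler_energy N h u t.
Proof. by move=> h0; rewrite mulr_ge0// sumr_ge0// => i _; exact: dot_ge0. Qed.

Lemma euler_forcing_ge0 N (u : nat -> R -> 'cV[K]_m) t : 0 <= euler_forcing N u t.
Proof.
by rewrite addr_ge0 ?addr_ge0 ?dot_ge0// sumr_ge0// => i _; exact: dot_ge0.
Qed.

Definition frozen_euler N h (u : nat -> R -> 'cV[K]_m) r t :=
  h * \sum_(i < N) dot (P1 *m u i.+1 t) (H r *m (P1 *m u i.+1 t)).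

Lemma euler_frozen_energy N h (u u' x : nat -> R -> 'cV[K]_m) :
  0 <= h -> euler_scheme N h u u' x ->
  exists2 D, 0 <= D &
    frozen_energy a b regular_point (frozen_euler N h u) (euler_energy N h u) V
      (fun t => mnorm P1 * rint a t (euler_forcing N u)) lo up
      (2 * Hb * mnorm P0 * mnorm (invmx P1)) 1 D.
Proof.
move=> h0 [hu ux step]; have [U U0 uU] := vac_bounded N hu.
have acP n : vac a b (fun t => P1 *m u n t) (fun t => P1 *m u' n t) by exact: vac_mulmx.
have acS : ac a b (euler_energy N h u) (fun t => h * \sum_(i < N)
   (dot (P1 *m u i.+1 t) (P1 *m u' i.+1 t) + dot (P1 *m u' i.+1 t) (P1 *m u i.+1 t))).
  apply: acZ; apply: ac_sum => i _; exact: (ac_dot (ltW ab) (acP _) (acP _)).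
have iforce : intg a b (euler_forcing N u).
  have acd f f' : vac a b f f' -> intg a b (fun t => dot (f t) (f t)).
    by move=> hf; exact: ac_intg (ltW ab) (ac_dot (ltW ab) hf hf).
  apply: intgD; first by apply: intgD; exact: acd (hu _).
  by apply: intg_sum => i _; exact: acd (vacB (hu _) (hu _)).
have aux : {ae mu, forall y : R, `[a, b]%classic y -> forall n, (n <= N)%N -> H y *m x n y = u n y}.
  have hux (i : 'I_N.+1) := ux i (ltn_ord i : (i <= N)%N).
  have := filter_forall (aeF _) hux; apply: filterS => y hy yab n nN.
  exact: (hy (Ordinal (nN : (n < N.+1)%N)) yab).
have astep : {ae mu, forall y : R, `[a, b]%classic y -> forall n, (n < N)%N ->
    of_real h *: (P1 *m u' n.+1 y + P0 *m u n.+1 y) = x n.+1 y - x n y}.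
  have hst (i : 'I_N) := step i (ltn_ord i).
  have := filter_forall (aeF _) hst; apply: filterS => y hy yab n nN.
  exact: (hy (Ordinal nN) yab).
set C := 2 * Hb * mnorm P0 * mnorm (invmx P1).
have C0 : 0 <= C by rewrite !mulr_ge0 ?mnorm_ge0.
pose D := N%:R * (4 * mnorm P1 * U ^+ 2 / lo).
exists D.
  by rewrite !mulr_ge0 ?invr_ge0 ?mnorm_ge0 ?(ltW lo0)// exprn_ge0.
split.
- move=> s t as_ st tb; exact: ae_dense regular_point_ae as_ st tb.
- move=> r t [_ rq] _ _; rewrite /euler_energy /frozen_euler !(mulrCA _ h).
  by apply/andP; split; apply: ler_wpM2l => //; rewrite mulr_sumr;
    apply: ler_sum => i _; have /andP[] := rq (P1 *m u i.+1 t).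
- move=> r s t M Pr as_ sr rt tb SM.
  have st := le_trans sr rt; have at_ := le_trans as_ st; have sb := le_trans st tb.
  have rab : a <= r <= b by rewrite (le_trans as_ sr) (le_trans rt tb).
  pose f' (y : R) := h * \sum_(i < N)
   (dot (P1 *m u i.+1 y) (H r *m (P1 *m u' i.+1 y)) + dot (P1 *m u' i.+1 y) (H r *m (P1 *m u i.+1 y))).
  have acF : ac a b (frozen_euler N h u r) f'.
    apply: acZ; apply: ac_sum => i _.
    exact: (ac_dot (ltW ab) (acP _) (vac_mulmx (H r) (acP _))).
  have [iF' _] := acF; have iF'st := intgW as_ tb iF'.
  have iS := intgW as_ tb (ac_intg (ltW ab) acS); have iG := intgW as_ tb iforce.
  rewrite (ac_diff acF as_ st tb); apply: le_trans (rint_norm iF'st) _.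
  have iC := intg_cst s t (D * (V t - V s)).
  have iCS := intgZ C iS; have iPG := intgZ (mnorm P1) iG.
  apply: le_trans (_ : rint s t (fun y : R => (C * euler_energy N h u y +
      mnorm P1 * euler_forcing N u y) + D * (V t - V s)) <= _).
    apply: ae_le_rint; [exact: intg_norm|by apply: intgD => //; exact: intgD|].
    apply: filterS3 aux regular_point_ae astep => y h1 h2 h3.
    move=> /= /[!in_itv]/= /andP[sy yt].
    have yab : `[a, b]%classic y by rewrite /= in_itv/= (le_trans as_ sy) (le_trans yt tb).
    have [r1 _] := Pr.
    apply: (@euler_pointwise N h (u ^~ y) (u' ^~ y) (x ^~ y) (H r) (H y) U) => //.
    + exact: boundN.
    + by apply: mnorm_sub_le => //; apply/andP.
    + move=> n nN; rewrite uU//; split=> //.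
      rewrite ler_pdivlMr// mulrC; apply: le_trans (regular_point_inv_le _ (h2 yab)) _.
      by rewrite h1// uU.
    + by move=> n nN; exact: h1.
    + by move=> n nN; exact: h3.
  rewrite rintD//; last exact: intgD.
  rewrite (rint_cst _ st) rintD// (rintZ _ iS) (rintZ _ iG).
  have -> : mnorm P1 * rint a t (euler_forcing N u) - mnorm P1 * rint a s (euler_forcing N u)
     = mnorm P1 * rint s t (euler_forcing N u).
    rewrite (rint_split as_ st (intgW (lexx a) tb iforce)); ring.
  have e1 : D * (V t - V s) * (t - s) = D * (t - s) * (V t - V s) by ring.
  rewrite e1 lerD2r lerD2r -mulrA ler_wpM2l ?C0//.
  rewrite -rint_cst//; apply: rint_le => //; first exact: intg_cst.
- move=> r r' t [_ _] [_ _] ar rr rb tab.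
  rewrite /frozen_euler /euler_energy -mulrBr -sumrB normrM ger0_norm// mul1r mulrCA.
  rewrite ler_wpM2l// mulr_sumr; apply: le_trans (ler_norm_sum _ _ _) _.
  apply: ler_sum => i _; rewrite -dotBr -mulmxBl; apply: le_trans (dot_mulmx_self_le _ _) _.
  rewrite ler_wpM2r ?dot_ge0//; apply: mnorm_sub_le => //; apply/andP; split=> //.
- by move=> s t as_ st tb; rewrite -subr_ge0; apply: le_trans (varH as_ st tb); exact: mnorm_ge0.
- move=> s t as_ st tb; rewrite ler_wpM2l ?mnorm_ge0//.
  apply: (@rint_nonneg_mono _ a t) => //.
    by apply: intgW iforce.
  by move=> r _; exact: euler_forcing_ge0.
- by move=> e e0; exact: ac_unif acS e0.
- by move=> t _; exact: euler_energy_ge0.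
Qed.

(** K0 is fixed before N, h and the orbit; this uniformity is what makes the estimate useful as the
    time N h grows. [P1] and its inverse convert between |u| and |P1 u|. *)
Lemma euler_boundary_estimate : exists2 K0, 0 <= K0 & forall N h (u u' x : nat -> R -> 'cV[K]_m) c t,
  0 <= h -> euler_scheme N h u u' x -> c = a \/ c = b -> a <= t <= b ->
  h * \sum_(i < N) dot (u i.+1 t) (u i.+1 t) <=
  K0 * (h * \sum_(i < N) dot (u i.+1 c) (u i.+1 c) + rint a b (euler_forcing N u)).
Proof.
have aab : a <= a <= b by rewrite lexx ltW.
set C := 2 * Hb * mnorm P0 * mnorm (invmx P1).
have C0 : 0 <= C by rewrite !mulr_ge0 ?mnorm_ge0.
pose E := expR (lo^-1 * (C * (b - a) + 2 * 1 * (V b - V a))).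
have E0 : 0 <= E by exact: expR_ge0.
pose q := mnorm (invmx P1); pose p := mnorm P1.
have q0 : 0 <= q := mnorm_ge0 _; have p0 : 0 <= p := mnorm_ge0 _.
pose Z := up * p ^+ 2 + p.
have Z0 : 0 <= Z by rewrite addr_ge0// mulr_ge0 ?(ltW up0)// sqr_ge0.
exists (q ^+ 2 * (lo^-1 * (E * Z))).
  by rewrite !mulr_ge0 ?invr_ge0 ?(ltW lo0)// sqr_ge0.
move=> N h u u' x c t h0 sch hc tab.
have [D D0 FE] := euler_frozen_energy h0 sch.
have := bv_gronwall ab lo0 (ltW up0) C0 ler01 D0 FE hc tab.
rewrite -/C -/E rint_set1 mulr0 subr0 => key.
have s1 : h * \sum_(i < N) dot (u i.+1 t) (u i.+1 t) <= q ^+ 2 * euler_energy N h u t.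
  rewrite mulrCA ler_wpM2l// mulr_sumr ler_sum// => i _.
  rewrite -!vnorm_dot -exprMn ler_sqr ?nnegrE ?mulr_ge0 ?vnorm_ge0//.
  by rewrite -{1}[u _ _](mulKmx P1u); exact: vnorm_mulmx_le.
have s2 : euler_energy N h u c <= p ^+ 2 * (h * \sum_(i < N) dot (u i.+1 c) (u i.+1 c)).
  rewrite mulrCA ler_wpM2l// mulr_sumr ler_sum// => i _.
  rewrite -!vnorm_dot -exprMn ler_sqr ?nnegrE ?mulr_ge0 ?vnorm_ge0//.
  exact: vnorm_mulmx_le.
have f0 : 0 <= rint a b (euler_forcing N u) by apply: rint_ge0 => r _; exact: euler_forcing_ge0.
have c0 : 0 <= h * \sum_(i < N) dot (u i.+1 c) (u i.+1 c).
  by rewrite mulr_ge0// sumr_ge0// => i _; exact: dot_ge0.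
apply: (le_trans s1); rewrite -!(mulrA (q ^+ 2)) -!(mulrA lo^-1) -(mulrA E).
rewrite ler_wpM2l ?sqr_ge0// ler_pdivlMl//; apply: (le_trans key); rewrite ler_wpM2l//.
have s3 := ler_wpM2l (ltW up0) s2.
rewrite /Z; set e1 := euler_energy _ _ _ _ in s2 s3 *; set f1 := rint _ _ _ in f0 *.
set c1 := h * _ in c0 s2 s3 *.
have h1 : 0 <= up * p ^+ 2 * f1 by rewrite !mulr_ge0 ?sqr_ge0 ?(ltW up0).
have h2 : 0 <= p * c1 by rewrite mulr_ge0.
apply: le_trans (_ : up * (p ^+ 2 * c1) + p * f1 <= _); first by rewrite lerD2r.
rewrite mulrDl !mulrDr mulrA; lra.
Qed.

(** * Resolvent estimates and decay for the operator *)

Local Notation crep x := (continuous_representative a b (mulH H x)).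
Local Notation wd x := (weak_derivative a b (mulH H x)).

Variables (D : set X) (A : X -> X) (W : 'M[K]_(m, m + m)).
Variables (kappa c : R).
Hypothesis linA : linear_operator D A.
Hypothesis DE : forall x, D x <->
  W12 a b (mulH H x) /\ W *m boundary_values a b (mulH H x) = 0.
Hypothesis P0s : adjmx P0 = - P0.
Hypothesis AE : forall x, D x ->
  ae_equal a b (A x) (fun t => P1 *m wd x t + P0 *m mulH H x t).
Hypothesis kappa0 : 0 < kappa.
Hypothesis cab : c = a \/ c = b.
Hypothesis dissE : forall x, D x -> energy x (A x) <= - kappa * vnorm (crep x c) ^+ 2.

Let aab : a <= a <= b. Proof. by rewrite lexx ltW. Qed.
Let bab : a <= b <= b. Proof. by rewrite lexx ltW. Qed.
Let cin : a <= c <= b. Proof. by case: cab => ->. Qed.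

Let N0 x : 0 <= eN x := energy_norm_ge0 x.

Lemma D_subspace : is_subspace D. Proof. by have [h1 h2 _] := linA; exact: conj h1 h2. Qed.
Lemma A_linear : linear_on D A. Proof. by case: linA => _ _; exact. Qed.

Lemma crep_vac x : D x ->
  [/\ vac a b (crep x) (wd x), ae_equal a b (crep x) (mulH H x) & vl2 a b (wd x)].
Proof.
move=> /DE[hW _]; have [f hf fu] := W12_ac ab hW.
have E t : a <= t <= b -> crep x t = f t by exact: continuous_representativeE hf fu t.
split; last by have [] := W12P hW.
  move=> p; have [i h] := hf p; split=> // t tab.
  by rewrite !E// h.
by apply: filterS fu => t h tab; rewrite E ?h//; move: tab; rewrite /= in_itv.
Qed.

(** Elements of D are prescribed through u = H x, from which [mulH_onto] recovers x. *)
Lemma domain_intro u g : vac a b u g -> vl2 a b g -> W *m col_mx (u b) (u a) = 0 ->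
  exists x, [/\ D x, forall t, a <= t <= b -> crep x t = u t,
    ae_equal a b u (mulH H x) & ae_equal a b (A x) (fun t => P1 *m g t + P0 *m u t)].
Proof.
move=> hu hg Wu; have u2 := vl2_vac (ltW ab) hu.
have [x hx] := mulH_onto u2.
have h2 : vl2 a b (mulH H x) by exact: vl2_H (L2_vl2 x).
have E := continuous_representativeE ab hu hx.
have Dx : D x.
  by apply/DE; split; [exact: vac_W12 hu hg h2 hx|rewrite /boundary_values !E].
exists x; split=> //.
have h3 := vac_weak_derivativeE ab hu hg h2 hx.
by apply: filterS3 (AE Dx) h3 hx => t e1 e2 e3 tab; rewrite e1// e2// -e3.
Qed.

(** T0 x is the class of P0 H x, so that T0 - A is the pure derivative x |-> - P1 (H x)', the
    starting point of the continuity method. *)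
Variable T0 : X -> X.
Hypothesis T0E : forall x, ae_equal a b (T0 x) (fun t => P0 *m (H t *m x t)).

Let T0lin : forall d x y, T0 (d *: x + y) = d *: T0 x + T0 y := L2_linear_of T0E.

(** Where H is self-adjoint the integrand is <H x, P0 H x>, which vanishes for skew P0. *)
Lemma energy_skew x : energy x (T0 x) = 0.
Proof.
have hx := L2_vl2 x; have h1 := vl2_H hx.
have h2 := vl2_cmulmx P0 h1; have h3 := vl2_H h2.
rewrite (energy_ae hx h2 _ (T0E x)); last exact: ae_eq_refl.
rewrite (@ae_eq_rint _ _ _ _ (fun=> 0)) ?rint_cst ?mul0r ?mulr0 ?(ltW ab)//.
- exact: intg_dot.
- exact: intg_cst.
- apply: filterS regular_point_ae => t h tab; have [r _] := h tab.
  by rewrite dot_selfadj// dot_skew.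
Qed.

Lemma derivative_ae x : D x -> ae_equal a b (wd x) (fun t => - (invmx P1 *m (T0 x - A x : X) t)).
Proof.
move=> Dx; apply: filterS3 (AE Dx) (T0E x) (L2_BE (T0 x) (A x)) => t e1 e2 e3 tab.
by rewrite e3// e2// e1// /mulH opprD addrCA subrr addr0 mulmxN opprK mulKmx.
Qed.

(** u = H x satisfies u' = - P1^-1 (T0 x - A x), so [vac_sup_le] bounds u everywhere by its value at
    c and the L2 norm of T0 x - A x. *)
Lemma graph_estimate : exists2 C, 0 <= C & forall x, D x ->
  eN x ^+ 2 <= C * (vnorm (crep x c) ^+ 2 + eN (T0 x - A x) ^+ 2).
Proof.
pose q := mnorm (invmx P1); have q0 : 0 <= q := mnorm_ge0 _.
pose C1 := up / 2 * lo ^- 2 * (b - a).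
have ba0 : 0 <= b - a by rewrite subr_ge0 ltW.
have C10 : 0 <= C1 by rewrite !mulr_ge0 ?invr_ge0 ?sqr_ge0 ?(ltW up0).
pose C2 := (b - a) * (q ^+ 2 * (2 / lo)).
have C20 : 0 <= C2 by rewrite !mulr_ge0 ?invr_ge0 ?sqr_ge0 ?(ltW lo0).
exists (2 * C1 * (1 + C2)) => [|x Dx].
  by apply: mulr_ge0; [exact: mulr_ge0|exact: addr_ge0].
have [hu hx hw] := crep_vac Dx; have u2 := vl2_vac (ltW ab) hu.
have e1 := energy_norm_mulH_ge u2 hx.
set y := T0 x - A x.
have e2 : rint a b (fun r => dot (wd x r) (wd x r)) <= q ^+ 2 * (2 / lo) * eN y ^+ 2.
  have h1 : rint a b (fun r => dot (wd x r) (wd x r)) <= q ^+ 2 * sqint y.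
    rewrite /sqint -rintZ; last exact: intg_dot (L2_vl2 y) (L2_vl2 y).
    apply: ae_le_rint; first exact: intg_dot.
      by apply: intgZ; exact: intg_dot (L2_vl2 y) (L2_vl2 y).
    apply: filterS (derivative_ae Dx) => t e tab.
    rewrite e// dotNl dotNr opprK -!vnorm_dot -exprMn.
    by rewrite ler_sqr ?nnegrE ?mulr_ge0 ?vnorm_ge0//; exact: vnorm_mulmx_le.
  apply: (le_trans h1); rewrite -mulrA ler_wpM2l ?sqr_ge0// energy_norm_sqr.
  have /andP[h2 _] := energy_bounds y.
  have -> : sqint y = 2 / lo * (lo / 2 * sqint y) by field; rewrite gt_eqF.
  by rewrite ler_wpM2l// divr_ge0// ltW.
set Q := vnorm _ ^+ 2.
have e3 : rint a b (fun t => dot (crep x t) (crep x t)) <= (b - a) * (2 * Q + 2 * (C2 * eN y ^+ 2)).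
  rewrite [leRHS]mulrC -rint_cst ?(ltW ab)//; apply: rint_le; [exact: intg_dot|exact: intg_cst|].
  move=> t tab; apply: le_trans (vac_sup_le ab hu hw cin tab) _.
  rewrite /Q vnorm_dot lerD2l ler_wpM2l// /C2 -[leRHS]mulrA.
  by rewrite ler_wpM2l//.
have e4 := ler_wpM2l (_ : 0 <= up / 2 * lo ^- 2) e3.
apply: (le_trans e1); apply: le_trans (e4 _) _.
  by rewrite !mulr_ge0 ?invr_ge0 ?sqr_ge0 ?(ltW up0).
have Q0 : 0 <= Q := sqr_ge0 _; have y0 : 0 <= eN y ^+ 2 := sqr_ge0 _.
move: (eN y ^+ 2) y0 => Y Y0.
have -> : up / 2 / lo ^+ 2 * ((b - a) * (2 * Q + 2 * (C2 * Y))) = 2 * C1 * (Q + C2 * Y).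
  by rewrite /C1; ring.
rewrite -[leRHS]mulrA; apply: ler_wpM2l; first exact: mulr_ge0.
have := mulr_ge0 C20 Q0; have := mulr_ge0 C20 Y0; lra.
Qed.

(** The homotopy runs from T0 - A at theta = 0 to lambda - A at theta = 1. Since T0 is skew, pairing
    with x gives theta lambda |x|^2 - Re <x, A x>; the dissipation at c together with
    [graph_estimate] keeps control even at theta = 0. *)
Lemma coercive_estimate lambda : 0 < lambda -> exists C, forall theta x,
  0 <= theta <= 1 -> D x ->
  eN x <= C * eN ((T0 x - A x) + of_real theta *: (of_real lambda *: x - T0 x)).
Proof.
move=> l0; have [C C0 hC] := graph_estimate.
have [beta beta0 Tb] := energy_norm_mulmx_le T0E.
exists ((1 + 4 * C * (lambda + beta) ^+ 2) / lambda + (1 + 2 * C * (kappa^-1 + 2))).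
move=> theta x t01 Dx; set z : X := (T0 x - A x + _).
apply: (@coercive_arith _ _ _ (vnorm (crep x c) ^+ 2) (eN (T0 x - A x)) theta); rewrite ?N0 ?sqr_ge0//.
- by rewrite addr_ge0// ltW.
- have /ler_normlW := energy_cauchy x z; apply: le_trans.
  rewrite /z !energyDr energyZr energyDr.
  rewrite !energyNr energy_skew energyZr -energy_norm_sqr.
  have := dissE Dx; move: (energy _ _) (eN x ^+ 2) (vnorm _ ^+ 2) => e n q h.
  rewrite oppr0 addr0 add0r mulrA; lra.
- exact: hC.
- rewrite (_ : T0 x - A x = z - of_real theta *: (of_real lambda *: x - T0 x)); last by rewrite /z addrK.
  apply: le_trans (normB Nnorm _ _) _; rewrite lerD2l (normZr Nnorm) -mulrA.
  have /andP[t0 _] := t01; rewrite ger0_norm// ler_wpM2l//.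
  apply: le_trans (normB Nnorm _ _) _; rewrite (normZr Nnorm) ger0_norm ?(ltW l0)// mulrDl lerD2l.
  exact: Tb.
Qed.

(** If w is in the kernel, the x in D with H x = w constant satisfies T0 x - A x = 0; the coercive
    estimate at theta = 0 gives x = 0, hence w = 0. *)
Lemma boundary_matrix_unit : W *m col_mx 1%:M 1%:M \in unitmx.
Proof.
rewrite -unitmx_tr -row_free_unit; apply: inj_row_free => r hr.
pose w : 'cV[K]_m := r^T.
have hw : W *m col_mx w w = 0.
  have -> : col_mx w w = col_mx 1%:M 1%:M *m w by rewrite mul_col_mx !mul1mx.
  by apply: trmx_inj; rewrite mulmxA trmx_mul /w trmxK hr trmx0.
have cw : vac a b (fun=> w) (fun=> 0).
  by move=> p; apply: (@eq_ac _ _ _ (fun=> co p w) _ (fun=> 0)) => // [t|]; [rewrite co0|exact: ac_cst].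
have z2 : vl2 a b (fun=> 0 : 'cV[K]_m).
  by move=> p; apply: (@eq_l2 _ _ _ (fun=> 0)); [move=> t _; rewrite co0|exact: l2_cst].
have [x [Dx _ hx hA]] := domain_intro cw z2 hw.
have S0 : T0 x - A x = 0.
  have h1 := @filterI _ _ (aeF _) _ _ hA (T0E x).
  have h2 := @filterI _ _ (aeF _) _ _ (L2_BE (T0 x) (A x)) (@L2_0E k R m a b).
  apply: L2_ext; apply: filterS3 h1 h2 hx => t [e1 e2] [e3 e4] e5 tab.
  rewrite e3// e4// e1// e2// mulmx0 add0r.
  by rewrite -[H t *m x t]/(mulH H x t) -e5// subrr.
have [C hC] := coercive_estimate ltr01.
have x0 : x = 0.
  apply: (norm_eq0 Nnorm); apply/eqP; rewrite eq_le N0 andbT.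
  have := hC 0 x; rewrite lexx ler01 of_real0 scale0r addr0 S0 (norm0 Nnorm) mulr0; exact.
have [s _ ws] : exists2 s, a <= s <= b & w = 0.
  apply: (@ae_dense R a b a b (fun=> w = 0)) => //.
  apply: filterS2 hx (@L2_0E k R m a b) => t e1 e2 tab.
  by rewrite e1// x0 /mulH e2// mulmx0.
by apply: trmx_inj; rewrite -/w ws trmx0.
Qed.

(** Integrating - P1^-1 y from a gives z; adding a constant w shifts the boundary values by (w, w),
    and [boundary_matrix_unit] lets w be chosen to meet the boundary condition. *)
Lemma skew_shift_onto y : exists2 x, D x & T0 x - A x = y.
Proof.
pose g t := - (invmx P1 *m y t); have hg : vl2 a b g.
  move=> p; have h := vl2_cmulmx (invmx P1) (L2_vl2 y) p.
  by apply: (@eq_l2 _ _ _ (fun t => -1 * co p (invmx P1 *m y t))); [move=> t _; rewrite coN mulN1r|exact: l2Z].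
pose z t : 'cV[K]_m := mkvec (fun p => rint a t (fun r => co p (g r))).
have zE t p : co p (z t) = rint a t (fun r => co p (g r)).
  apply: (@co_mkvec_of k R m (fun q => rint a t (fun r => co q (g r)))) => kR i.
  rewrite -(rint_set1 a (fun=> 0)) rint_set1; under eq_rint do rewrite co_real//.
  by rewrite -[RHS](mul0r (rint a t (fun=> 0))) -rintZ ?mul0r//; exact: intg_cst.
have hz : vac a b z g.
  move=> p; apply: (@eq_ac _ _ _ (rint a ^~ (fun r => co p (g r))) _ (fun t => co p (g t))) => //.
  by apply: ac_primitive; exact: l2_intg (hg p).
pose w : 'cV[K]_m := - (invmx (W *m col_mx 1%:M 1%:M) *m (W *m col_mx (z b) (z a))).
have hu : vac a b (fun t => w + z t) g.
  move=> p; apply: (@eq_ac _ _ _ (fun t => co p w + co p (z t)) _ (fun t => 0 + co p (g t))) => [t|t|].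
  - by rewrite coD.
  - by rewrite add0r.
  - exact: acD (ac_cst _ _ _) (hz p).
have [|x [Dx _ hx hA]] := domain_intro hu hg.
  rewrite -add_col_mx mulmxDr.
  have -> : col_mx w w = col_mx 1%:M 1%:M *m w by rewrite mul_col_mx !mul1mx.
  by rewrite mulmxA /w mulmxN mulKVmx ?boundary_matrix_unit// addNr.
exists x => //; apply: L2_ext; have h1 := @filterI _ _ (aeF _) _ _ hA (T0E x).
apply: filterS3 h1 (L2_BE (T0 x) (A x)) hx => t [e1 e2] e3 e4 tab.
rewrite e3// e2// e1// e4// /mulH /g mulmxN mulKVmx// opprD opprK addrCA subrr addr0//.
Qed.

Lemma dissipative h x : 0 < h -> D x -> eN x <= eN (x - of_real h *: A x).
Proof.
move=> h0 Dx; have := energy_cauchy x (x - of_real h *: A x).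
move=> /(le_trans (ler_norm _)).
rewrite energyDr energyNr energyZr -energy_norm_sqr => e1.
have e2 : energy x (A x) <= 0.
  by apply: le_trans (dissE Dx) _; rewrite mulNr oppr_le0 mulr_ge0 ?sqr_ge0// ltW.
have [x0|x0] := eqVneq (eN x) 0; first by rewrite x0.
have xgt0 : 0 < eN x by rewrite lt_neqAle eq_sym x0 N0.
rewrite -(ler_pM2l xgt0); apply: le_trans e1; rewrite expr2 lerDl oppr_ge0.
by rewrite mulr_ge0_le0// ltW.
Qed.

(** The continuity method with lambda = 1/h solves x / h - A x = y / h. *)
Lemma range_condition h y : 0 < h -> exists2 x, D x & x - of_real h *: A x = y.
Proof.
move=> h0; have l0 : 0 < h^-1 by rewrite invr_gt0.
have [C hC] := coercive_estimate l0.
have [beta beta0 Tb] := energy_norm_mulmx_le T0E.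
have [||||||x Dx hx] := @continuity_method _ _ _ eN Nnorm D (fun x => T0 x - A x)
  (fun x => of_real h^-1 *: x - T0 x) C (h^-1 + beta) energy_complete _ _ _ _ _ _ (of_real h^-1 *: y).
- exact: D_subspace.
- move=> d x z Dx Dz /=; rewrite T0lin (A_linear d Dx Dz) scalerBr opprD addrACA//.
- move=> d x z _ _ /=; rewrite T0lin scalerDr scalerA mulrC -scalerA scalerBr opprD addrACA//.
- move=> x _; apply: le_trans (normB Nnorm _ _) _.
  by rewrite (normZr Nnorm) ger0_norm ?(ltW l0)// mulrDl lerD2l; exact: Tb.
- by move=> theta x t01 Dx; exact: hC.
- by move=> z; exact: skew_shift_onto.
exists x => //.
have e : of_real h^-1 *: x - A x = of_real h^-1 *: y by rewrite -hx [RHS]addrC addrA subrK.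
have hh : of_real h * of_real h^-1 = 1 :> K by rewrite -of_realM mulfV ?gt_eqF// of_real1.
by rewrite -[y]scale1r -hh -scalerA -e scalerBr scalerA hh scale1r.
Qed.

Lemma energy_norm_sub x y :
  eN y ^+ 2 = eN x ^+ 2 - 2 * energy x (x - y) + eN (x - y) ^+ 2.
Proof.
exact: (@polarization R (X : zmodType) (energy) eN x y energyDr
  energyNr energyC energy_norm_sqr).
Qed.

Lemma stability_estimate : exists C, forall j n x, D x ->
  n%:R * 2 ^- j * eN (iter n (resolvent D A (2 ^- j)) x) ^+ 2 <= C * eN x ^+ 2.
Proof.
have subD := D_subspace; have linA' := A_linear.
have [K0 K00 hK0] := euler_boundary_estimate.
pose B := Hb ^+ 2 * (2 / lo); have B0 : 0 <= B by rewrite mulr_ge0 ?sqr_ge0 ?divr_ge0 ?(ltW lo0).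
(* The first summand comes from the dissipation at c, the second from the forcing: the two end
   states and the sum of the squared increments contribute at most B |x|^2 each. *)
pose K1 := K0 * ((2 * kappa)^-1 + 3 * B).
pose E := up / 2 * lo ^- 2 * ((b - a) * K1).
exists E => j n x Dx; pose h : R := 2 ^- j; rewrite -/h.
have h0 : 0 < h by exact: mesh_gt0.
pose J := resolvent D A h; pose X' i : X := iter i J x; rewrite -/J -/(X' n).
have DX i : D (X' i) by exact: (iter_resolvent_in range_condition i h0 Dx).
have stepX i : X' i.+1 - X' i = of_real h *: A (X' i.+1).
  exact: (resolvent_sub range_condition (X' i) h0).
pose u i := crep (X' i); pose u' i := wd (X' i).
have sch : euler_scheme n h u u' (fun i => L2_to_fun (X' i)).
  split=> [i|i _|i _].
  - by have [] := crep_vac (DX i).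
  - by have [_ e _] := crep_vac (DX i); exact: ae_eq_sym.
  - have [_ hx _] := crep_vac (DX i.+1).
    have h1 := @filterI _ _ (aeF _) _ _ (L2_BE (X' i.+1) (X' i)) (L2_ZE (of_real h) (A (X' i.+1))).
    apply: filterS3 h1 (AE (DX i.+1)) hx => t [e1 e2] e3 e4 tab.
    by rewrite -e1// stepX e2// e3// -e4.
(* Energy balance of implicit Euler: |x_i|^2 = |x_(i+1)|^2 - 2 h Re <x_(i+1), A x_(i+1)> + |x_(i+1)
   - x_i|^2. One budget, the initial energy, thus pays for the squared increments and for the
   boundary term. *)
have decay N' : eN (X' N') ^+ 2 + (\sum_(i < N') eN (X' i.+1 - X' i) ^+ 2 +
    2 * kappa * (h * \sum_(i < N') vnorm (u i.+1 c) ^+ 2)) <= eN x ^+ 2.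
  elim: N' => [|i IH]; first by rewrite !big_ord0 !mulr0 !addr0.
  have recr (f : nat -> R) j' : \sum_(l < j'.+1) f l = \sum_(l < j') f l + f j'.
    by rewrite big_ord_recr.
  rewrite (recr (fun l => eN (X' l.+1 - X' l) ^+ 2)) (recr (fun l => vnorm (u l.+1 c) ^+ 2)).
  apply: le_trans IH.
  have e1 := energy_norm_sub (X' i.+1) (X' i).
  rewrite {1}stepX energyZr in e1.
  have e2 : h * energy (X' i.+1) (A (X' i.+1)) <= h * (- kappa * vnorm (u i.+1 c) ^+ 2).
    exact: (ler_wpM2l (ltW h0) (dissE (DX i.+1))).
  exact: decay_step e1 e2.
have hu i : [/\ vac a b (u i) (u' i), ae_equal a b (u i) (mulH H (X' i)) & vl2 a b (u i)].
  by have [h1 h2 _] := crep_vac (DX i); split=> //; exact: vl2_vac (ltW ab) h1.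
have mulle i : rint a b (fun t => dot (u i t) (u i t)) <= B * eN x ^+ 2.
  have [_ h1 h2] := hu i.
  apply: le_trans (energy_norm_mulH_le h2 h1) _.
  apply: (@ler_wpM2l R B B0); apply: sqr_mono (N0 _) _.
  exact: (iter_resolvent_le dissipative range_condition i x h0).
have forcing : rint a b (euler_forcing n u) <= 3 * B * eN x ^+ 2.
  have int i : intg a b (fun t => dot (u i t) (u i t)) by have [_ _ h2] := hu i; exact: intg_dot.
  have intd i : intg a b (fun t => dot (u i.+1 t - u i t) (u i.+1 t - u i t)).
    by have [_ _ h1] := hu i; have [_ _ h2] := hu i.+1; apply: intg_dot; exact: vl2B.
  rewrite rintD; [|exact: intgD|by apply: intg_sum => i _; exact: intd].
  have rs : rint a b (fun t => \sum_(i < n) dot (u i.+1 t - u i t) (u i.+1 t - u i t)) =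
      \sum_(i < n) rint a b (fun t => dot (u i.+1 t - u i t) (u i.+1 t - u i t)).
    by apply: rint_sum => i _; exact: intd.
  rewrite rintD// rs.
  have hd : \sum_(i < n) rint a b (fun t => dot (u i.+1 t - u i t) (u i.+1 t - u i t)) <= B * eN x ^+ 2.
    apply: le_trans (_ : \sum_(i < n) B * eN (X' i.+1 - X' i) ^+ 2 <= _).
      apply: ler_sum => i _; have [_ h1 h2] := hu i; have [_ h3 h4] := hu i.+1.
      have e : ae_equal a b (fun t => u i.+1 t - u i t) (mulH H (X' i.+1 - X' i : X)).
        apply: filterS3 h1 h3 (L2_BE (X' i.+1) (X' i)) => t e1 e2 e3 tab.
        by rewrite e1// e2// /mulH e3// mulmxBr.
      exact: (energy_norm_mulH_le (vl2B h4 h2) e).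
    rewrite -mulr_sumr; apply: (@ler_wpM2l R B B0); apply: le_trans (decay n).
    rewrite addrCA lerDl addr_ge0 ?sqr_ge0// !mulr_ge0 ?(ltW kappa0) ?(ltW h0)//.
    by apply: sumr_ge0 => i _; exact: sqr_ge0.
  have three p : 3 * B * p = B * p + B * p + B * p by ring.
  by rewrite three; exact: lerD (lerD (mulle 0%N) (mulle n)) hd.
have boundary : h * \sum_(i < n) dot (u i.+1 c) (u i.+1 c) <= (2 * kappa)^-1 * eN x ^+ 2.
  rewrite ler_pdivlMl ?mulr_gt0//; under eq_bigr do rewrite -vnorm_dot.
  apply: le_trans (decay n); rewrite addrA lerDr addr_ge0 ?sqr_ge0//.
  by apply: sumr_ge0 => i _; exact: sqr_ge0.
have pointwise t : a <= t <= b -> h * \sum_(i < n) dot (u i.+1 t) (u i.+1 t) <= K1 * eN x ^+ 2.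
  move=> tab; apply: le_trans (hK0 _ _ _ _ _ _ _ (ltW h0) sch cab tab) _.
  by rewrite /K1 -mulrA ler_wpM2l// mulrDl lerD.
have int i : intg a b (fun t => dot (u i t) (u i t)) by have [_ _ h2] := hu i; exact: intg_dot.
have total : h * \sum_(i < n) rint a b (fun t => dot (u i.+1 t) (u i.+1 t)) <=
    (b - a) * (K1 * eN x ^+ 2).
  rewrite -rint_sum// -rintZ; last exact: intg_sum.
  rewrite [leRHS]mulrC -rint_cst ?(ltW ab)//; apply: rint_le => //; last exact: intg_cst.
  by apply: intgZ; exact: intg_sum.
(* The resolvent is a contraction, so the last norm is the smallest of the n summed ones. *)
have mono : n%:R * h * eN (X' n) ^+ 2 <= h * \sum_(i < n) eN (X' i.+1) ^+ 2.
  rewrite mulrAC mulrC ler_wpM2l ?(ltW h0)//.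
  have -> : n%:R * eN (X' n) ^+ 2 = \sum_(i < n) eN (X' n) ^+ 2.
    by rewrite sumr_const card_ord mulr_natl.
  apply: ler_sum => i _; apply: sqr_mono (N0 _) _.
  have -> : X' n = iter (n - i.+1) J (X' i.+1) by rewrite /X' -iterD subnK.
  exact: (iter_resolvent_le dissipative range_condition (n - i.+1) (X' i.+1) h0).
apply: (le_trans mono).
have up2 : 0 <= up / 2 * lo ^- 2.
  by rewrite mulr_ge0 ?divr_ge0 ?invr_ge0 ?sqr_ge0 ?(ltW up0).
apply: le_trans (_ : h * \sum_(i < n) (up / 2 * lo ^- 2 *
    rint a b (fun t => dot (u i.+1 t) (u i.+1 t))) <= _).
  rewrite ler_wpM2l ?(ltW h0)//; apply: ler_sum => i _; have [_ h1 h2] := hu i.+1.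
  exact: (energy_norm_mulH_ge h2 h1).
rewrite -mulr_sumr mulrCA; apply: le_trans (ler_wpM2l up2 total) _.
by rewrite /E /K1 -!mulrA.
Qed.

End PortHamiltonian.

Theorem theorem3p5 (k : scalar_kind) (R : realType) (a b : R) (hab : a < b)
    (m : nat) (H : R -> 'M[scalar_field k R]_m)
    (H_density : energy_density a b H)
    (H_BV : BV_mx a b H)
    (D : set (L2 k a b m)) (A : L2 k a b m -> L2 k a b m)
    (A_pH : port_hamiltonian H D A)
    (W : 'M[scalar_field k R]_(m, m + m))
    (D_eq : D = [set x | W12 a b (mulH H x) /\
                         W *m boundary_values a b (mulH H x) = 0])
    (A_diss : exists kappa c : R,
       [/\ 0 < kappa, c = a \/ c = b &
         forall x, D x -> re (energy_product H x (A x)) <=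
           - kappa * vnorm (continuous_representative a b (mulH H x) c) ^+ 2]) :
  exists T : R -> L2 k a b m -> L2 k a b m,
    [/\ contraction_semigroup (energy_norm H) T,
        is_generator (energy_norm H) D A T &
        exponentially_stable (energy_norm H) T].
Proof.
have [measH adjH [lo [up [lo0 up0 quad]]]] := H_density.
have quadH : \forall t \ae (@lebesgue_measure R), `[a, b]%classic t ->
    forall w : 'cV[scalar_field k R]_m, lo * dot w w <= dot w (H t *m w) <= up * dot w w.
  apply: filterS quad => t h tab w.
  by have := h tab w; rewrite -mulmxA dotE vnorm_dot.
have [v varH] := BV_majorant hab H_BV.
(* Bounded variation bounds H at every point of [a, b], whereas the energy density bounds it only
   almost everywhere. *)
have boundN t : a <= t <= b -> mnorm (H t) <= v b - v a + mnorm (H a).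
  move=> /andP[at_ tb]; apply: le_trans (mnorm_le_sub (H t) (H a)) _; rewrite lerD2r.
  apply: le_trans (varH _ _ (lexx a) at_ tb) _; rewrite lerD2r -subr_ge0.
  by apply: le_trans (varH _ _ at_ tb (lexx b)); exact: mnorm_ge0.
have [linA denseD _ [P1 [P0 [P1u P1a P0s AE]]]] := A_pH.
have [kappa [c [kappa0 cab dissE]]] := A_diss.
have DE x : D x <-> W12 a b (mulH H x) /\ W *m boundary_values a b (mulH H x) = 0 by rewrite D_eq.
have [T0 T0E] := mulmx_L2 measH boundN P0.
have Nnorm := energy_is_norm lo0 measH adjH quadH boundN.
have Ncpl := energy_complete lo0 up0 measH quadH boundN.
have subD := D_subspace linA; have linA' := A_linear linA.
have diss := dissipative lo0 measH adjH quadH boundN kappa0 dissE.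
have range := range_condition hab lo0 up0 measH adjH quadH boundN P1u linA DE P0s AE
  kappa0 cab dissE T0E.
have [C stab] := stability_estimate hab lo0 up0 measH adjH quadH varH boundN P1u P1a linA DE
  P0s AE kappa0 cab dissE T0E.
exists (semigroup (energy_norm H) D A); split.
- exact: (semigroup_contraction Nnorm subD linA' diss range Ncpl denseD).
- exact: (semigroup_generator Nnorm subD linA' diss range Ncpl denseD).
- exact: (semigroup_stable Nnorm subD linA' diss range Ncpl denseD stab).
Qed.
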